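(* As $t\to\infty$, $$\frac{u(t,Z^{(1)}_t)+u(t,-Z^{(1)}_t)}{U(t)}\to 1\qquad\text{in probability.}$$
   Context: Fix $\alpha\ge 2$. Let $(\xi_0(z))_{z\in\mathbb Z}$ be i.i.d. Pareto random variables with parameter $\alpha$, i.e. $\mathrm{Prob}(\xi_0(z)>x)=x^{-\alpha}$ for $x\ge 1$. Let $p:\mathbb N\to[0,1]$ be eventually nondecreasing with $p(n)\to 1$, and $q=1-p$ (extended to $(0,\infty)$ by $p(x)=p(\lceil x\rceil)$, $q(x)=q(\lceil x\rceil)$). Define the potential $\xi:\mathbb Z\to[1,\infty)$ by $\xi(n)=\xi_0(n)$ for $n\ge 0$ and, independently for each $n\ge1$ (and independently of $\xi_0$), $\xi(-n)=\xi_0(n)$ with probability $p(n)$ and $\xi(-n)=\xi_0(-n)$ with probability $q(n)$. $\mathrm{Prob}$ denotes the law of $\xi$. Let $u$ be the solution of $\partial_t u(t,z)=\Delta u(t,z)+\xi(z)u(t,z)$ on $(0,\infty)\times\mathbb Z$, $u(0,z)=\mathbf 1_{\{0\}}(z)$, where $(\Delta f)(z)=\sum_{|y-z|=1}(f(y)-f(z))$; it is given by the Feynman–Kac formula $u(t,z)=\mathbb E[\exp\{\int_0^t\xi(X_s)ds\}\mathbf 1\{X_t=z\}]$ with $(X_s)$ the continuous-time random walk on $\mathbb Z$ with generator $\Delta$ started at $0$. Let $U(t)=\sum_{z\in\mathbb Z}u(t,z)$. Let $D=\{z\in\mathbb N_0:\xi(z)=\xi(-z)\}$, $E=\mathbb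 N_0\setminus D$, $\Psi_t(z)=\xi(z)-\frac{|z|}{t}\log\xi(z)$, and let $Z^{(1)}_t$ be a maximiser of $\Psi_t$ over $D$ (which exists almost surely). *)

(* Defs.v *)
From HB Require Import structures.
From mathcomp Require Import all_boot all_order all_algebra.
From mathcomp Require Import all_classical all_reals all_analysis.
Set Implicit Arguments. Unset Strict Implicit. Unset Printing Implicit Defensive.
Import Order.TTheory GRing.Theory Num.Theory.
Local Open Scope classical_set_scope.
Local Open Scope ring_scope.

Section PAM.
Context {R : realType}.

Definition mutually_independent {d} {Omega : measurableType d}
    (P : probability Omega R) {I : eqType} (X : I -> Omega -> R) : Prop :=
  (forall i, measurable_fun setT (X i)) /\
  forall (F : seq I), uniq F -> forall (B : I -> set R),
    (forall i, measurable (B i)) ->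
    P (\big[setI/setT]_(i <- F) (X i @^-1` B i)) =
    (\big[*%E/1%E]_(i <- F) P (X i @^-1` B i))%E.

(* Joint family of the potential's ingredients:
   inl z  |-> xi_0(z)    (z : int),
   inr n  |-> coin for the site -(n+1), taking values in {0,1}. *)
Definition pot_family {T} (xi0 : int -> T -> R) (C : nat -> T -> R)
  : int + nat -> T -> R :=
  fun i => match i with inl z => xi0 z | inr n => C n end.

(* The potential xi : Z -> [1,oo):  xi(n) = xi_0(n) for n >= 0, and for
   n >= 1, xi(-n) = xi_0(n) if the coin C (n-1) equals 1 (probability p(n)),
   and xi(-n) = xi_0(-n) otherwise (probability q(n)). *)
Definition potential {T} (xi0 : int -> T -> R) (C : nat -> T -> R)
    (w : T) (z : int) : R :=
  if (0 <= z)%R then xi0 z w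
  else if C (`|z|%N.-1) w == 1 then xi0 (`|z|%N%:Z) w else xi0 z w.

(* Continuous-time simple random walk with generator Delta (total jump rate 2)
   from i.i.d. Exp(2) holding times tau and i.i.d. uniform +-1 steps eps. *)
Definition jump_time {T} (tau : nat -> T -> R) (n : nat) (w : T) : R :=
  \sum_(k < n) tau k w.

Definition num_jumps {T} (tau : nat -> T -> R) (s : R) (w : T) : nat :=
  xget 0%N [set n | jump_time tau n w <= s < jump_time tau n.+1 w].

Definition step {T} (eps : nat -> T -> R) (k : nat) (w : T) : int :=
  if eps k w == 1 then 1 else -1.

Definition walk {T} (tau eps : nat -> T -> R) (s : R) (w : T) : int :=
  \sum_(k < num_jumps tau s w) step eps k w.

(* Feynman-Kac: u(t,z) = E[ exp(int_0^t xi(X_s) ds) 1{X_t = z} ], as an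
   extended real, for the potential xi : int -> R. *)
Definition uFK {d'} {Omega' : measurableType d'} (P' : probability Omega' R)
    (tau eps : nat -> Omega' -> R) (xi : int -> R) (t : R) (z : int) : \bar R :=
  (\int[P']_w
     (expeR (\int[lebesgue_measure]_(s in `[0%R, t]%classic) (xi (walk tau eps s w))%:E)
      * ((walk tau eps t w == z)%:R)%:E))%E.

Definition UFK {d'} {Omega' : measurableType d'} (P' : probability Omega' R)
    (tau eps : nat -> Omega' -> R) (xi : int -> R) (t : R) : \bar R :=
  (\esum_(z in [set: int]) uFK P' tau eps xi t z)%E.

Definition Psi (xi : int -> R) (t : R) (z : int) : R :=
  xi z - (`|z|%N%:R / t) * ln (xi z).

Definition Dset (xi : int -> R) : set nat := [set z | xi z%:Z = xi (- z%:Z)].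

Definition is_maximiser_D (xi : int -> R) (t : R) (z : nat) : Prop :=
  Dset xi z /\ forall y, Dset xi y -> Psi xi t y%:Z <= Psi xi t z%:Z.

End PAM.

(* Main.v *)
Require Import Defs.
From HB Require Import structures.
From mathcomp Require Import all_boot all_order all_algebra.
From mathcomp Require Import all_classical all_reals all_analysis.
From mathcomp Require Import measurable_realfun.
From mathcomp Require Import ring lra.
From mathcomp Require Import zify.
Set Implicit Arguments. Unset Strict Implicit. Unset Printing Implicit Defensive.
Import Order.TTheory GRing.Theory Num.Theory.
Import numFieldNormedType.Exports.
Local Open Scope classical_set_scope.
Local Open Scope ring_scope.

(** Put [a = (t / ln t)^(1/(alpha-1))] and [r = t a / ln t]: [a] is the order of the
    largest values of the potential in a box of radius [r], and of [Psi_t] at its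
    maximum.  With probability at least [1 - delta], and with constants [c], [K],
    [eta] that depend only on [delta],
    - every site of modulus at most [2 K r] whose potential exceeds [c a / 2] is
      symmetric (asymmetric sites have density [o(1)] and there are [O(1)] tall ones);
    - [Psi_t] reaches [c a] on [D], its maximiser [n] is at most [K r], and it exceeds
      [Psi_t] at all other sites, except [-n], by [eta a];
    - beyond distance [K r], [xi y] is at most a small multiple of [|y| ln t / t].

    For such a potential the statement about [u] is deterministic.  Forcing the walk
    to go straight to [n] and stay gives [u(t,n) >= exp(t Psi_t(n) - zeta t a)] for any
    small [zeta].  Paths ending outside [{n, -n}] that never visit [{n, -n}], or make
    more than [n + eta r / 8] jumps, contribute at most [kap exp(t Psi_t(n) - zeta t a)], by
    the Chernoff bound for the number of jumps.  Any other such path is cut at its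
    last exit from [{n, -n}]: the potential seen afterwards is at least [eta a / 2] below
    [xi n], so by independence of the holding time at this exit the contribution is at
    most [kap (u(t,n) + u(t,-n))] with [kap] arbitrarily small. *)

(** * Integration and independence *)

(** The energy [t a] equals [r L] with [L = ln t], whereas the combinatorial factors are of size
    [exp(O(r))] or [exp(O(r ln L))]; an exponential margin [zeta t a] therefore absorbs them, and
    crude constants suffice everywhere. The integrand of [uFK] contains a Lebesgue integral along a
    random path, and its measurability is never established: it is replaced, off a null set, by a
    measurable series over the number of jumps. Only the tail [exp(-2x)] of a holding time is given,
    so estimates that would use its density are made by cutting the half-line into intervals. The
    gap [eta a] does not come from a limit theorem for extremes. The relevant range of [Psi_t] is
    cut into [O(1/eta)] windows; a given pair of distinct sites shares a given window with
    probability [O((eta/r)^2)], and there are [O(r^2)] pairs, so a near-tie has probability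
    [O(eta)]. Symmetry of the tall sites lets all competitors be taken in the nonnegative half-line,
    where they are independent. The constants are chosen in the order [c], [K], [eta], and only then
    is [t] taken large. *)

Section integral_lemmas.
Import HBNNSimple.
Context d (T : measurableType d) (R : realType).
Variable mu : {measure set T -> \bar R}.
Local Open Scope ereal_scope.

(** The integral of a nonnegative function is a supremum over simple functions below it, so
    monotonicity needs no measurability. *)
Lemma le_integral_ge0 (f g : T -> \bar R) :
  (forall x, 0 <= f x) -> (forall x, f x <= g x) ->
  \int[mu]_x f x <= \int[mu]_x g x.
Proof.
move=> f0 fg; have g0 x : 0 <= g x by exact: le_trans (f0 x) (fg x).
rewrite !ge0_integralE// !patch_setT; apply: le_ereal_sup => _ [h /= hf <-].
by exists h => // x; exact: le_trans (hf x) (fg x).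
Qed.

(** Measurability is asked of [g] alone: a simple function below [f] lies below [g] off [N], and
    conversely [g] cut off on [N] lies below [f]. This is what handles the integrand of [uFK]. *)
Lemma eq_integral_off_null (N : set T) (f g : T -> \bar R) :
  measurable N -> mu N = 0 ->
  (forall x, 0 <= f x) -> (forall x, 0 <= g x) -> measurable_fun setT g ->
  (forall x, ~ N x -> f x = g x) ->
  \int[mu]_x f x = \int[mu]_x g x.
Proof.
move=> mN N0 f0 g0 mg fg; apply/eqP; rewrite eq_le; apply/andP; split.
  rewrite ge0_integralE// patch_setT; apply: ge_ereal_sup => _ [h /= hf <-].
  have -> : sintegral mu h = \int[mu]_x (h x)%:E.
    by rewrite integral_nnsfun// patch_setT.
  rewrite (ge0_negligible_integral mN)//; last 2 first.
    exact/measurable_EFinP.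
    by move=> x _; rewrite lee_fin.
  rewrite [leRHS](ge0_negligible_integral mN)//.
  apply: ge0_le_integral => //.
  - by apply: measurableD.
  - by move=> x _; rewrite lee_fin.
  - by apply/measurable_EFinP; apply: measurable_funTS.
  - exact: measurable_funTS.
  - by move=> x [_ Nx]; rewrite -fg.
rewrite (ge0_negligible_integral mN)// integral_mkcond.
apply: le_integral_ge0 => x; rewrite patchE; case: ifPn => //.
by rewrite inE => -[_ Nx]; rewrite fg.
Qed.

End integral_lemmas.

Section independence.
Context d d' (Om : measurableType d) (T : measurableType d') (R : realType).
Variable P : probability Om R.

(** Independence makes the joint law a product measure, by uniqueness on rectangles; Tonelli then
    integrates [X] out with [V] frozen. *)
Lemma ge0_integral_indep (V : Om -> T) (X : Om -> R) (h : T * R -> \bar R) :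
  measurable_fun setT V -> measurable_fun setT X ->
  (forall A B, measurable A -> measurable B ->
    P ((V @^-1` A) `&` (X @^-1` B)) = (P (V @^-1` A) * P (X @^-1` B))%E) ->
  measurable_fun setT h -> (forall x, 0 <= h x)%E ->
  (\int[P]_w h (V w, X w) = \int[P]_w \int[P]_w' h (V w, X w'))%E.
Proof.
move=> mV mX indep mh h0.
pose V' : {mfun Om >-> T} := HB.pack V (isMeasurableFun.Build _ _ _ _ _ mV).
pose X' : {mfun Om >-> R} := HB.pack X (isMeasurableFun.Build _ _ _ _ _ mX).
have mVX : measurable_fun setT (fun w => (V w, X w)) by exact: measurable_fun_pair.
pose VX : {mfun Om >-> (T * R)%type} :=
  HB.pack (fun w => (V w, X w)) (isMeasurableFun.Build _ _ _ _ _ mVX).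
have -> : (\int[P]_w h (V w, X w) = \int[distribution P VX]_z h z)%E.
  by rewrite ge0_integral_distribution.
have -> : (\int[distribution P VX]_z h z =
    \int[distribution P V' \x distribution P X']_z h z)%E.
  apply: eq_measure_integral => A mA _.
  apply/esym; apply: product_measure_unique => //.
rewrite fubini_tonelli1//.
rewrite ge0_integral_distribution//; last 2 first.
- exact: measurable_fun_fubini_tonelli_F.
- by move=> y; exact: integral_ge0.
apply: eq_integral => w _ /=; rewrite /fubini_F.
rewrite ge0_integral_distribution//.
by apply: measurableT_comp mh _; exact: measurable_pair1.
Qed.

End independence.

Section cylinders.
Context d (Om : measurableType d) (R : realType) (I : eqType).
Variables (P : probability Om R) (X : I -> Om -> R).

(** A pi-system generating the sigma-algebra of the variables with index in [L]; its elements are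
    the sets on which [mutually_independent] gives a product formula. *)
Definition cylinder (L : seq I) : set (set Om) :=
  [set A | exists2 B : I -> set R, (forall i, measurable (B i)) &
    A = \big[setI/setT]_(i <- L) (X i @^-1` B i)].

Lemma cylinder_setI L : setI_closed (cylinder L).
Proof.
move=> _ _ [B mB ->] [C mC ->]; exists (fun i => B i `&` C i).
  by move=> i; exact: measurableI.
by rewrite -big_split.
Qed.

Lemma cylinder_setT L : cylinder L setT.
Proof.
by exists (fun=> setT) => //; rewrite big1.
Qed.

Lemma cylinder_preimage L i B : uniq L -> i \in L -> measurable B ->
  cylinder L (X i @^-1` B).
Proof.
move=> uL iL mB; exists (fun j => if j == i then B else setT).
  by move=> j; case: ifP.
rewrite (bigD1_seq i)//= eqxx big1 ?setIT// => j /negPf ->.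
exact: preimage_setT.
Qed.

Hypothesis indX : mutually_independent P X.

Lemma cylinder_measurable L : cylinder L `<=` measurable.
Proof.
move=> _ [B mB ->]; elim/big_ind: _ => //; first exact: measurableI.
by move=> i _; rewrite -[_ @^-1` _]setTI; apply: (indX.1 i).
Qed.

Lemma sigma_cylinder_measurable L : <<s cylinder L >> `<=` measurable.
Proof.
apply: smallest_sub; last exact: cylinder_measurable.
exact: sigma_algebra_measurable.
Qed.

(** As functions of [A], both sides are finite measures. They agree on the pi-system of cylinders,
    by independence over [j :: L], hence on the generated sigma-algebra. *)
Lemma sigma_cylinder_indep L j A D : uniq L -> j \notin L ->
  <<s cylinder L >> A -> measurable D ->
  P (A `&` X j @^-1` D) = (P A * P (X j @^-1` D))%E.
Proof.
move=> uL jL sA mD.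
have mXD : measurable (X j @^-1` D) by rewrite -[_ @^-1` _]setTI; apply: (indX.1 j).
pose q := fine (P (X j @^-1` D)).
have q0 : 0 <= q by rewrite fine_ge0.
have Pq : P (X j @^-1` D) = q%:E by rewrite fineK// fin_num_measure.
have : mrestr P mXD A = mscale (NngNum q0) P A; last first.
  by rewrite /mrestr /mscale /= => ->; rewrite Pq muleC.
apply: (@g_sigma_algebra_measure_unique _ _ _ (cylinder L)
  (@cylinder_measurable L) (fun=> setT) (fun=> cylinder_setT L) _
  (mrestr P mXD) (mscale (NngNum q0) P) (@cylinder_setI L)) => //.
- by apply/seteqP; split=> // x _; exists 0%N.
- move=> _ [B mB ->]; rewrite /mrestr /mscale /=.
  transitivity (P (\big[setI/setT]_(i <- j :: L)
     (X i @^-1` (if i == j then D else B i)))).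
    rewrite big_cons eqxx setIC; congr (P (_ `&` _)).
    apply: eq_big_seq => i iL; case: eqP => // ij.
    by rewrite -ij iL in jL.
  rewrite indX.2 /= ?jL//; last by move=> i; case: ifP.
  rewrite big_cons eqxx Pq; congr (_ * _)%E.
  rewrite -indX.2//; last by move=> i; case: ifP.
  congr (P _); apply: eq_big_seq => i iL; case: eqP => // ij.
  by rewrite -ij iL in jL.
- by move=> k; rewrite /= /mrestr /= setTI Pq ltry.
Qed.

End cylinders.

Section measurability.
Context d (T : measurableType d).

Lemma measurable_bool_set (b : T -> bool) : measurable_fun setT b ->
  measurable [set w | b w].
Proof.
move=> mb; have : measurable ([set: T] `&` b @^-1` [set true]) by exact: mb.
by rewrite setTI.
Qed.

Lemma measurable_int_comp d' (T' : measurableType d') (Y : T -> int)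
    (f : int -> T') :
  (forall z, measurable (Y @^-1` [set z])) ->
  measurable_fun setT (fun w => f (Y w)).
Proof.
move=> mY _ B mB; rewrite setTI.
rewrite (_ : _ @^-1` _ = \bigcup_z (if `[< B (f z) >] then Y @^-1` [set z] else set0)).
  apply: countable_bigcupT_measurable; first exact: countableP.
  by move=> z; case: ifP.
apply/seteqP; split=> [w /= Bw|w [z _]].
  by exists (Y w) => //; rewrite ifT//; apply/asboolP.
by case: ifPn => //= /asboolP Bz; rewrite /preimage /= => ->.
Qed.

Context (R : realType).

Lemma measurable_bool_natr (b : T -> bool) : measurable_fun setT b ->
  measurable_fun setT (fun w => (b w)%:R : R).
Proof.
move=> mb; rewrite (_ : (fun w => _) = (fun w => if b w then 1 else 0)).
  exact: measurable_fun_ifT.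
by apply/funext => w; case: (b w).
Qed.

Lemma integral_bool_natr (mu : {measure set T -> \bar R}) (b : T -> bool) :
  measurable_fun setT b -> (\int[mu]_w ((b w)%:R)%:E = mu [set w | b w])%E.
Proof.
move=> mb; rewrite -[in RHS](setIT [set w | b w]) -integral_indic//; last first.
  exact: measurable_bool_set.
by apply: eq_integral => w _; rewrite indicE mem_setE.
Qed.

Lemma ge0_integralAddr (mu : {measure set T -> \bar R}) (f g : T -> R) :
  (forall w, 0 <= f w) -> (forall w, 0 <= g w) ->
  measurable_fun setT f -> measurable_fun setT g ->
  (\int[mu]_w (f w + g w)%:E = \int[mu]_w (f w)%:E + \int[mu]_w (g w)%:E)%E.
Proof.
move=> f0 g0 mf mg; rewrite -ge0_integralD//.
- by move=> w _; rewrite lee_fin.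
- exact/measurable_EFinP.
- by move=> w _; rewrite lee_fin.
- exact/measurable_EFinP.
Qed.

Lemma ge0_integralMr (mu : {measure set T -> \bar R}) (c : R) (f : T -> R) :
  0 <= c -> (forall w, 0 <= f w) -> measurable_fun setT f ->
  (\int[mu]_w (c * f w)%:E = c%:E * \int[mu]_w (f w)%:E)%E.
Proof.
move=> c0 f0 mf; rewrite -ge0_integralZl_EFin//.
- by move=> w _; rewrite lee_fin.
- exact/measurable_EFinP.
Qed.

Lemma le_integral_fin (mu : {measure set T -> \bar R}) (f g : T -> R) :
  (forall w, 0 <= f w) -> (forall w, f w <= g w) ->
  (\int[mu]_w (f w)%:E <= \int[mu]_w (g w)%:E)%E.
Proof.
by move=> f0 fg; apply: le_integral_ge0 => w; rewrite lee_fin.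
Qed.

Lemma measurable_set_le (f g : T -> R) : measurable_fun setT f ->
  measurable_fun setT g -> measurable [set w | f w <= g w].
Proof. by move=> mf mg; apply: measurable_bool_set; exact: measurable_fun_ler. Qed.

Lemma measurable_set_lt (f g : T -> R) : measurable_fun setT f ->
  measurable_fun setT g -> measurable [set w | f w < g w].
Proof. by move=> mf mg; apply: measurable_bool_set; exact: measurable_fun_ltr. Qed.

End measurability.

Definition chain {R : realType} {T : Type} (eps : nat -> T -> R) (n : nat) (w : T)
  : int := \sum_(k < n) step eps k w.

(** The part of the Feynman-Kac weight collected during the first [n] complete holding times. It
    depends only on clocks of index below [n]. *)
Definition fkweight {R : realType} {T : Type} (xi : int -> R)
    (tau eps : nat -> T -> R) (n : nat) (w : T) : R :=
  expR (\sum_(i < n) xi (chain eps i w) * tau i w).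

Section chain_measurability.
Context d (T : measurableType d) (R : realType).
Variables (tau eps : nat -> T -> R) (xi : int -> R).

Lemma measurable_chain n z :
  (forall k, (k < n)%N -> measurable_fun setT (eps k)) ->
  measurable (chain eps n @^-1` [set z]).
Proof.
elim: n z => [|n IH] z me.
  rewrite (_ : _ @^-1` _ = if z == 0 then setT else set0).
    by case: ifP.
  apply/seteqP; split=> w; rewrite /preimage /= /chain big_ord0.
    by move=> <-; rewrite eqxx.
  by case: eqP.
have mE : measurable [set w | eps n w == 1].
  by apply: measurable_bool_set; apply: (@measurable_fun_eqr _ _ R) => //; exact: me.
have mY y : measurable (chain eps n @^-1` [set y]).
  by apply: IH => k kn; apply: me; exact: ltnW.
rewrite (_ : _ @^-1` _ =
    (chain eps n @^-1` [set z - 1] `&` [set w | eps n w == 1]) `|`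
    (chain eps n @^-1` [set z + 1] `&` ~` [set w | eps n w == 1])).
  by apply: measurableU; apply: measurableI => //; exact: measurableC.
apply/seteqP; split=> w; rewrite /preimage /= /chain big_ord_recr /= /step.
  move=> <-; case: ifPn => e; [left|right]; split => //; first by rewrite addrK.
    by rewrite subrK.
by move=> [[-> ->]|[-> /negP/negPf ->]]; rewrite ?subrK ?addrK.
Qed.

Lemma measurable_jump_time n :
  (forall k, (k < n)%N -> measurable_fun setT (tau k)) ->
  measurable_fun setT (jump_time tau n).
Proof.
move=> mt.
rewrite (_ : jump_time tau n = fun w => \sum_(i < n) (if insub (val i) is Some j then tau (val (j : 'I_n)) w else 0)).
  by apply: measurable_sum => i; rewrite valK /=; exact: mt.
by apply/funext => w; apply: eq_bigr => i _; rewrite valK.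
Qed.

Lemma measurable_fkweight n :
  (forall k, (k < n)%N -> measurable_fun setT (tau k)) ->
  (forall k, (k < n)%N -> measurable_fun setT (eps k)) ->
  measurable_fun setT (fkweight xi tau eps n).
Proof.
move=> mt me; apply: measurableT_comp; first exact: measurable_expR.
apply: measurable_sum => i; apply: measurable_funM; last exact: mt.
apply: measurable_int_comp => z.
by apply: measurable_chain => k ki; apply: me; exact: ltn_trans ki _.
Qed.

End chain_measurability.

(** * Holding times *)

Section exponential_clocks.
Context d (Om : measurableType d) (R : realType) (P : probability Om R).
Variables (tau eps : nat -> Om -> R).

Definition clocks : nat + nat -> Om -> R :=
  fun i => match i with inl k => tau k | inr k => eps k end.

Hypothesis ind : mutually_independent P clocks.
Hypothesis tauP : forall k (x : R), 0 <= x -> P [set w | x < tau k w] = (expR (- (2 * x)))%:E.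

Lemma measurable_tau k : measurable_fun setT (tau k).
Proof. exact: (ind.1 (inl k)). Qed.

Lemma measurable_eps k : measurable_fun setT (eps k).
Proof. exact: (ind.1 (inr k)). Qed.

Definition past n : seq (nat + nat) := map inl (iota 0 n) ++ map inr (iota 0 n).

Lemma past_uniq n : uniq (past n).
Proof.
rewrite cat_uniq !map_inj_uniq ?iota_uniq/= ?andbT; [|by move=> ? ? []..].
by apply/hasPn => _ /mapP[k _ ->]; apply/negP => /mapP[].
Qed.

Lemma past_notin n : inl n \notin past n.
Proof.
rewrite mem_cat negb_or; apply/andP; split; apply/negP => /mapP[k] // + [kn].
by rewrite -kn mem_iota add0n ltnn andbF.
Qed.

(** [Om] with the sigma-algebra of the holding times and steps of index below [n], so that being
    determined by the past is ordinary measurability from this type. *)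
Definition pastType n := g_sigma_algebraType (cylinder clocks (past n)).

Lemma past_tau n k : (k < n)%N ->
  measurable_fun [set: pastType n] (tau k : pastType n -> R).
Proof.
move=> kn _ B mB; rewrite setTI; apply: sub_sigma_algebra.
apply: (@cylinder_preimage _ _ _ _ clocks _ (inl k)) => //; first exact: past_uniq.
by rewrite mem_cat map_f// mem_iota.
Qed.

Lemma past_eps n k : (k < n)%N ->
  measurable_fun [set: pastType n] (eps k : pastType n -> R).
Proof.
move=> kn _ B mB; rewrite setTI; apply: sub_sigma_algebra.
apply: (@cylinder_preimage _ _ _ _ clocks _ (inr k)) => //; first exact: past_uniq.
by rewrite mem_cat map_f ?orbT// mem_iota.
Qed.

(** Plays the part of conditioning on the past: [tau n] is integrated first, with everything before
    it held fixed. It serves the Chernoff bound and the last-exit estimate. *)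
Lemma past_integral n d' (T : measurableType d') (V : Om -> T) (h : T * R -> \bar R) :
  measurable_fun [set: pastType n] (V : pastType n -> T) ->
  measurable_fun setT h -> (forall x, 0 <= h x)%E ->
  (\int[P]_w h (V w, tau n w) = \int[P]_w \int[P]_w' h (V w, tau n w'))%E.
Proof.
move=> mV mh h0; have sV A : measurable A -> <<s cylinder clocks (past n) >> (V @^-1` A).
  by move=> mA; have := mV measurableT A mA; rewrite setTI.
apply: ge0_integral_indep => //.
- move=> _ A mA; rewrite setTI.
  exact: (sigma_cylinder_measurable ind (sV A mA)).
- exact: measurable_tau.
- move=> A B mA mB.
  apply: (sigma_cylinder_indep ind (past_uniq n) (past_notin n)) => //.
  exact: sV.
Qed.

Lemma tau_le k (x : R) : 0 <= x -> P [set w | tau k w <= x] = (1 - expR (- (2 * x)))%:E.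
Proof.
move=> x0; have -> : [set w | tau k w <= x] = ~` [set w | x < tau k w].
  by apply/seteqP; split=> w /=; rewrite leNgt => /negP.
rewrite probability_setC ?tauP//.
by apply: measurable_set_lt => //; exact: measurable_tau.
Qed.

Lemma tau_itv k (x y : R) : 0 <= x -> x <= y ->
  P [set w | (x < tau k w) && (tau k w <= y)] =
    (expR (- (2 * x)) - expR (- (2 * y)))%:E.
Proof.
move=> x0 xy; have mt := measurable_tau k.
have mxy : measurable [set w | (x < tau k w) && (tau k w <= y)].
  by apply: measurable_bool_set; apply: measurable_and;
    [apply: (@measurable_fun_ltr _ _ R)|apply: (@measurable_fun_ler _ _ R)].
have my : measurable [set w | y < tau k w] by exact: measurable_set_lt.
have : P [set w | x < tau k w] =
    (P [set w | (x < tau k w) && (tau k w <= y)]%R + P [set w | y < tau k w]%R)%E.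
  rewrite -measureU//.
    congr (P _); apply/seteqP; split=> w /=.
      by move=> xw; have [h|h] := leP (tau k w) y; [left; rewrite xw|right].
    by move=> [/andP[]//|]; exact: le_lt_trans.
  rewrite -subset0 => w /= [/andP[_ wy]]; by rewrite ltNge wy.
rewrite !tauP//; last exact: le_trans xy.
have : P [set w | (x < tau k w) && (tau k w <= y)] \is a fin_num by exact: fin_num_measure.
case: (P [set w | (x < tau k w) && (tau k w <= y)]) => // a _ /eqP.
by rewrite -EFinD eqe => /eqP ->; rewrite addrK.
Qed.

Lemma lt0_tau : P [set w | exists k, tau k w <= 0] = 0%E.
Proof.
rewrite (_ : [set w | _] = \bigcup_k [set w | tau k w <= 0]); last first.
  by apply/seteqP; split=> w [k]; exists k.
have mt k : measurable [set w | tau k w <= 0].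
  by apply: measurable_set_le => //; exact: measurable_tau.
apply/eqP; rewrite eq_le measure_ge0 andbT.
apply: le_trans (measure_sigma_subadditive P mt _ (@subset_refl _ _)) _.
  exact: bigcup_measurable.
rewrite eseries0// => k _ _.
transitivity ((1 - expR (- (2 * 0 : R)))%:E); first exact: tau_le.
by rewrite mulr0 oppr0 expR0 subrr.
Qed.

End exponential_clocks.

Section clock_estimates.
Context d (Om : measurableType d) (R : realType) (P : probability Om R).
Variables (tau eps : nat -> Om -> R).
Hypothesis ind : mutually_independent P (clocks tau eps).
Hypothesis tauP : forall k (x : R), 0 <= x ->
  P [set w | x < tau k w] = (expR (- (2 * x)))%:E.

Let mtau k := measurable_tau ind k.
Let meps k := measurable_eps ind k.

Let mtau_le k (r : R) : measurable_fun setT (fun w => tau k w <= r).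
Proof. by apply: (@measurable_fun_ler _ _ R). Qed.

Let mtau_gt k (r : R) : measurable_fun setT (fun w => r < tau k w).
Proof. by apply: (@measurable_fun_ltr _ _ R). Qed.

(* The density of [tau k] is avoided: splitting at [tau k = r - b] turns the bound at
   [r - b] into the bound at [r], so it propagates from [[0, b]] to all [r]. *)
Lemma late_exit_contraction k (g b kap : R) : 0 <= g -> 0 < b -> 0 <= kap ->
  expR (- ((g - 2) * b)) * kap + (expR (2 * b) - 1) <= kap ->
  forall r : R, 0 <= r ->
  (\int[P]_w ((tau k w <= r)%R%:R * expR (- (g * (r - tau k w))))%:E
     <= (kap * expR (- (2 * r)))%:E)%E.
Proof.
move=> g0 b0 kap0 H.
pose f (r : R) w := (tau k w <= r)%R%:R * expR (- (g * (r - tau k w))).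
have mf r : measurable_fun setT (f r).
  apply: measurable_funM; first exact: measurable_bool_natr.
  apply: measurableT_comp; first exact: measurable_expR.
  by apply: measurable_funN; apply: measurable_funM => //; exact: measurable_funB.
have f0 r w : 0 <= f r w by rewrite mulr_ge0// expR_ge0.
have kapb : expR (2 * b) - 1 <= kap.
  apply: le_trans H; rewrite lerDr mulr_ge0// expR_ge0//.
have base (r : R) : 0 <= r -> r <= b ->
    (\int[P]_w (f r w)%:E <= (kap * expR (- (2 * r)))%:E)%E.
  move=> r0 rb; apply: (@le_trans _ _ (\int[P]_w ((tau k w <= r)%R%:R)%:E)%E).
    apply: le_integral_ge0 => w; rewrite lee_fin//.
    rewrite /f; case: (leP (tau k w) r) => h; last by rewrite mul0r.
    by rewrite mul1r expR_le1 oppr_le0 mulr_ge0// subr_ge0.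
  rewrite integral_bool_natr//= (tau_le ind tauP)// lee_fin.
  have -> : 1 - expR (- (2 * r)) = (expR (2 * r) - 1) * expR (- (2 * r)).
    by rewrite mulrBl -expRD subrr expR0 mul1r.
  rewrite ler_wpM2r ?expR_ge0//; apply: le_trans kapb.
  by rewrite lerD2r ler_expR ler_pM2l.
have main N : forall r : R, 0 <= r -> r <= N%:R * b ->
    (\int[P]_w (f r w)%:E <= (kap * expR (- (2 * r)))%:E)%E.
  elim: N => [|N IH] r r0 rN.
    by apply: base => //; apply: le_trans rN _; rewrite mul0r ltW.
  have [rb|rb] := leP r b; first exact: base.
  have rb0 : 0 <= r - b by rewrite subr_ge0 ltW.
  (* If the clock rings before [r - b], moving the deadline back by [b] costs exactly the factor
     [expR (- (g * b))]; if it rings in the last stretch of length [b], the integrand is at most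
     1. *)
  apply: (@le_trans _ _ (\int[P]_w (expR (- (g * b)) * f (r - b) w +
      ((r - b < tau k w) && (tau k w <= r))%R%:R)%:E)%E).
    apply: le_integral_fin => // w; rewrite /f.
    have [h1|h1] := leP (tau k w) (r - b).
      rewrite (le_trans h1) ?lerBlDr ?lerDl ?(ltW b0)//= !mul1r addr0.
      rewrite -expRD ler_expR; lra.
    rewrite mul0r mulr0 add0r /=; case: (leP (tau k w) r) => h2; last by rewrite mul0r.
    by rewrite mul1r expR_le1 oppr_le0 mulr_ge0// subr_ge0.
  have mI : measurable_fun setT (fun w => (r - b < tau k w) && (tau k w <= r)).
    by apply: measurable_and.
  rewrite ge0_integralAddr//; last 3 first.
  - by move=> w; rewrite mulr_ge0 ?expR_ge0.
  - exact: measurable_funM.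
  - exact: measurable_bool_natr.
  rewrite ge0_integralMr ?expR_ge0//.
  rewrite integral_bool_natr//= (tau_itv ind tauP)//; last lra.
  have := IH (r - b) rb0.
  have rN' : r - b <= N%:R * b by move: rN; rewrite -natr1; nra.
  move=> /(_ rN') => IHr.
  apply: (@le_trans _ _ ((expR (- (g * b)))%:E * (kap * expR (- (2 * (r - b))))%:E +
     (expR (- (2 * (r - b))) - expR (- (2 * r)))%:E)%E).
    by apply: leeD => //; apply: lee_wpmul2l => //; rewrite lee_fin expR_ge0.
  rewrite -EFinM -EFinD lee_fin.
  have -> : expR (- (2 * (r - b))) = expR (2 * b) * expR (- (2 * r)).
    by rewrite -expRD; congr expR; lra.
  have -> : expR (- (g * b)) = expR (- ((g - 2) * b)) * expR (- (2 * b)).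
    by rewrite -expRD; congr expR; lra.
  have e2b : expR (- (2 * b)) * expR (2 * b) = 1 by rewrite -expRD addNr expR0.
  rewrite [leLHS](_ : _ = (expR (- ((g - 2) * b)) * kap *
      (expR (- (2 * b)) * expR (2 * b)) + (expR (2 * b) - 1)) * expR (- (2 * r))).
    by rewrite e2b mulr1 ler_wpM2r ?expR_ge0.
  by ring.
move=> r r0; apply: (main (Num.truncn (r / b)).+1) => //.
by rewrite -ler_pdivrMr//; apply: ltW; rewrite truncnS_gt.
Qed.

(** Leaving a site before time [r] and then losing [g] per unit time is compared with staying until
    [r], which has probability [expR (- (2 * r))]. The step [b] makes [expR (2 * b) - 1] equal to
    [kap / 2], and [g] is so large that the contraction factor is at most [1 / 2]; the two halves
    add up to [kap]. *)
Lemma late_exit (kap : R) : 0 < kap -> exists2 g0 : R, 0 <= g0 &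
  forall g, g0 <= g -> forall k (r : R), 0 <= r ->
  (\int[P]_w ((tau k w <= r)%R%:R * expR (- (g * (r - tau k w))))%:E
     <= (kap * expR (- (2 * r)))%:E)%E.
Proof.
move=> k0; pose b := ln (1 + kap / 2) / 2.
have b0 : 0 < b by rewrite divr_gt0// ln_gt0//; lra.
have eb : expR (2 * b) = 1 + kap / 2.
  by rewrite /b mulrC divfK// lnK// posrE; lra.
have l2 : 0 < ln (2 : R) by rewrite ln_gt0//; lra.
exists (2 + ln 2 / b).
  by rewrite addr_ge0// divr_ge0// ltW.
move=> g gg k r r0; apply: (@late_exit_contraction k g b) => //.
- apply: le_trans gg; by rewrite addr_ge0// divr_ge0// ltW.
- exact: ltW.
have : expR (- ((g - 2) * b)) <= 1 / 2.
  rewrite -[leRHS]lnK ?posrE; last by lra.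
  rewrite ler_expR div1r lnV ?posrE; last by lra.
  rewrite lerN2 -ler_pdivrMr//; lra.
rewrite eb; nra.
Qed.

(** On the [i]-th interval of length [b = 1 / lam] the integrand is at most [2 ^- i] and the mass at
    most [2 * b]. The geometric series gives [4 * b], and the tail after [N] intervals a further
    [b], whence the 5. The indicator keeps the integrand bounded by 1. *)
Lemma tau_laplace k (lam : R) : 0 < lam ->
  (\int[P]_w ((0 < tau k w)%R%:R * expR (- (lam * tau k w)))%:E <= (5 / lam)%:E)%E.
Proof.
move=> l0; pose b := lam^-1; have b0 : 0 < b by rewrite invr_gt0.
pose f i w := (i%:R * b < tau k w)%R%:R * expR (- (lam * tau k w)).
have mexp : measurable_fun setT (fun w => expR (- (lam * tau k w))).
  apply: measurableT_comp; first exact: measurable_expR.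
  by apply: measurable_funN; apply: measurable_funM.
have mf i : measurable_fun setT (f i).
  by apply: measurable_funM => //; exact: measurable_bool_natr.
have f0 i w : 0 <= f i w by rewrite mulr_ge0// expR_ge0.
have lb : lam * b = 1 by rewrite mulfV// gt_eqF.
have ilb i : i%:R = lam * (i%:R * b) by rewrite mulrCA lb mulr1.
have e1 i : expR (- i%:R) <= (2 ^- i : R).
  rewrite -mulN1r expRM_natr.
  rewrite -exprVn lerXn2r ?nnegrE ?expR_ge0 ?invr_ge0//.
  rewrite expRN lef_pV2 ?posrE ?expR_gt0//.
  by have := expR_ge1Dx (1 : R).
have step i : (\int[P]_w (f i w)%:E <=
    (2 ^- i * (2 * b))%:E + \int[P]_w (f i.+1 w)%:E)%E.
  pose B w := (i%:R * b < tau k w) && (tau k w <= i.+1%:R * b).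
  have mB : measurable_fun setT B by exact: measurable_and.
  apply: (@le_trans _ _ (\int[P]_w (2 ^- i * (B w)%:R + f i.+1 w)%:E)%E).
    apply: le_integral_fin => // w; rewrite /f /B.
    have ib : i%:R * b <= i.+1%:R * b by rewrite ler_pM2r// ler_nat.
    have [h1|h1] := ltP (i%:R * b) (tau k w); last first.
      by rewrite mul0r addr_ge0 ?mulr_ge0 ?expR_ge0 ?invr_ge0 ?exprn_ge0.
    have [h2|h2] := leP (tau k w) (i.+1%:R * b); last by rewrite /= mulr0 add0r.
    rewrite /= !mul1r mul0r addr0 mulr1; apply: le_trans (e1 i).
    rewrite ler_expR lerN2 ilb ler_pM2l//; exact: ltW.
  rewrite ge0_integralAddr//; last first.
    by apply: measurable_funM => //; exact: measurable_bool_natr.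
  apply: leeD => //.
  rewrite ge0_integralMr ?invr_ge0 ?exprn_ge0//; last exact: measurable_bool_natr.
  rewrite integral_bool_natr//= (tau_itv ind tauP); last 2 first.
  - by rewrite mulr_ge0// ltW.
  - by rewrite ler_pM2r// ler_nat.
  rewrite -EFinM lee_fin ler_pM2l ?invr_gt0 ?exprn_gt0//.
  have -> : expR (- (2 * (i.+1%:R * b))) = expR (- (2 * (i%:R * b))) * expR (- (2 * b)).
    by rewrite -expRD -natr1; congr expR; ring.
  have := expR_ge1Dx (- (2 * b)).
  have : expR (- (2 * (i%:R * b))) <= 1.
    by rewrite expR_le1 oppr_le0 !mulr_ge0// ltW.
  have := expR_gt0 (- (2 * (i%:R * b))).
  by have := expR_gt0 (- (2 * b)); nra.
have sum N : (\int[P]_w (f 0%N w)%:E <=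
    (4 * b * (1 - 2 ^- N))%:E + \int[P]_w (f N w)%:E)%E.
  elim: N => [|N IH]; first by rewrite expr0 invr1 subrr mulr0 add0e.
  apply: le_trans IH _; apply: le_trans (leeD2l _ (step N)) _.
  rewrite addeA -EFinD; apply: leeD => //; rewrite lee_fin.
  rewrite exprS invfM; lra.
have fN N : (\int[P]_w (f N w)%:E <= (2 ^- N)%:E)%E.
  apply: (@le_trans _ _ (\int[P]_w (cst (2 ^- N)%:E w))%E); last first.
    by rewrite integral_cst// [X in (_ * X)%E]probability_setT mule1.
  apply: le_integral_ge0 => w; rewrite ?lee_fin// /f.
  case: (ltP (N%:R * b) (tau k w)) => h; last by rewrite mul0r invr_ge0 exprn_ge0.
  rewrite mul1r; apply: le_trans (e1 N).
  rewrite ler_expR lerN2 ilb ler_pM2l//; exact: ltW.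
have -> : (\int[P]_w ((0 < tau k w)%R%:R * expR (- (lam * tau k w)))%:E =
           \int[P]_w (f 0%N w)%:E)%E.
  by apply: eq_integral => w _; rewrite /f mul0r.
(* Enough intervals for the remainder [2 ^- N] to be at most [1 / lam]. *)
pose N := (Num.truncn lam).+1.
apply: le_trans (sum N) _; apply: le_trans (leeD2l _ (fN N)) _.
rewrite -EFinD lee_fin.
have N2 : (2 ^- N : R) <= b.
  rewrite lef_pV2 ?posrE ?exprn_gt0//.
  apply: le_trans (ltW (truncnS_gt lam)) _.
  by rewrite -natrX ler_nat ltnW// ltn_expl.
have : (0 : R) <= 2 ^- N by rewrite invr_ge0 exprn_ge0.
rewrite -/b; nra.
Qed.

End clock_estimates.

Section jump_times.
Context d (Om : measurableType d) (R : realType) (P : probability Om R).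
Variables (tau eps : nat -> Om -> R).
Hypothesis ind : mutually_independent P (clocks tau eps).
Hypothesis tauP : forall k (x : R), 0 <= x ->
  P [set w | x < tau k w] = (expR (- (2 * x)))%:E.

Let mtau k := measurable_tau ind k.
Let meps k := measurable_eps ind k.

Lemma measurable_jump n : measurable_fun setT (jump_time tau n).
Proof. by apply: measurable_jump_time => k _; exact: mtau. Qed.

Definition stuck : set Om := [set w | exists k, tau k w <= 0].

Lemma measurable_stuck : measurable stuck.
Proof.
rewrite (_ : stuck = \bigcup_k [set w | tau k w <= 0]).
  by apply: bigcup_measurable => k _; exact: measurable_set_le.
by apply/seteqP; split=> w [k]; exists k.
Qed.

Lemma stuck0 : P stuck = 0%E.
Proof. exact: (lt0_tau ind tauP). Qed.

(** Exponential Markov inequality: the factors [phi (tau i)] are integrated out one at a time, the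
    latest first, each costing [5 / lam]. *)
Lemma jump_time_chernoff (lam t : R) m : 0 < lam -> 0 <= t ->
  (P [set w | (jump_time tau m w <= t)%R] <= (expR (lam * t) * (5 / lam) ^+ m)%:E)%E.
Proof.
move=> l0 t0.
pose phi (x : R) : R := (0 < x)%R%:R * expR (- (lam * x)).
have phi0 x : 0 <= phi x by rewrite mulr_ge0// expR_ge0.
have mphi : measurable_fun setT phi.
  apply: measurable_funM.
    by apply: measurable_bool_natr; apply: (@measurable_fun_ltr _ _ R).
  apply: measurableT_comp; first exact: measurable_expR.
  by apply: measurable_funN; apply: measurable_funM.
pose Phi n w := \prod_(i < n) phi (tau i w).
have mPhi n d' (T : measurableType d') (f : nat -> T -> R) :
    (forall k, (k < n)%N -> measurable_fun setT (f k)) ->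
    measurable_fun setT (fun w => \prod_(i < n) phi (f i w)).
  elim: n => [|n IH] mf.
    by rewrite (_ : (fun w => _) = cst 1)//; apply/funext => w; rewrite big_ord0.
  rewrite (_ : (fun w => _) = (fun w => (\prod_(i < n) phi (f i w)) * phi (f n w))).
    apply: measurable_funM; last by apply: measurableT_comp => //; exact: mf.
    by apply: IH => k kn; apply: mf; exact: ltnW.
  by apply/funext => w; rewrite big_ord_recr.
have Phi0 n w : 0 <= Phi n w by apply: prodr_ge0.
have EPhi n : (\int[P]_w (Phi n w)%:E <= ((5 / lam) ^+ n)%:E)%E.
  elim: n => [|n IH].
    rewrite (eq_integral (cst 1%E)); last by move=> w _; rewrite /Phi big_ord0.
    by rewrite integral_cst// [X in (_ * X)%E]probability_setT mule1 expr0.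
  (* The absolute value makes [h] nonnegative on the whole plane; it changes nothing at [Phi n w],
     which is nonnegative. *)
  pose h (x : R * R) := (`|x.1| * phi x.2)%:E.
  have mh : measurable_fun setT h.
    apply/measurable_EFinP; apply: measurable_funM.
      by apply: measurableT_comp => //; exact: measurable_fst.
    by apply: measurableT_comp => //; exact: measurable_snd.
  have -> : (\int[P]_w (Phi n.+1 w)%:E = \int[P]_w h (Phi n w, tau n w))%E.
    apply: eq_integral => w _; rewrite /h /= ger0_norm//.
    by rewrite /Phi big_ord_recr.
  rewrite (past_integral ind)//; last 2 first.
  - by apply: mPhi => k kn; exact: past_tau.
  - by move=> x; rewrite lee_fin mulr_ge0.
  apply: (@le_trans _ _ (\int[P]_w ((5 / lam) * Phi n w)%:E)%E).
    apply: le_integral_ge0 => w.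
      by apply: integral_ge0 => w' _; rewrite lee_fin mulr_ge0.
    rewrite /h /= ger0_norm// ge0_integralMr//; last exact: measurableT_comp.
    rewrite mulrC EFinM; apply: lee_wpmul2l; first by rewrite lee_fin.
    exact: (tau_laplace ind tauP).
  rewrite ge0_integralMr//; last 2 first.
  - by rewrite divr_ge0// ltW.
  - by apply: mPhi.
  by rewrite exprS (EFinM (5 / lam)); apply: lee_wpmul2l => //; rewrite lee_fin divr_ge0// ltW.
pose b w := jump_time tau m w <= t.
have mb : measurable_fun setT b by apply: (@measurable_fun_ler _ _ R) => //; exact: measurable_jump.
have -> : P [set w | (jump_time tau m w <= t)%R] = (\int[P]_w ((b w)%:R)%:E)%E.
  by rewrite integral_bool_natr.
(* [Phi] carries positivity indicators, so they are first inserted into the event; this changes it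
   only on the null set [stuck]. *)
pose c (w : Om) : R := (b w)%:R * \prod_(i < m) (0 < tau i w)%R%:R.
have mc : measurable_fun setT c.
  apply: measurable_funM; first exact: measurable_bool_natr.
  rewrite (_ : (fun w => _) = (fun w => (all (fun i => 0 < tau i w) (iota 0 m))%:R)).
    apply: measurable_bool_natr; elim: (iota 0 m) => //= i s IH.
    by apply: measurable_and => //; apply: (@measurable_fun_ltr _ _ R).
  apply/funext => w; elim: m {b c mb} => [|m IH]; first by rewrite big_ord0.
  by rewrite -[in RHS](addn1 m) iotaD all_cat big_ord_recr /= IH andbT -natrM mulnb.
have c0 w : 0 <= c w by rewrite mulr_ge0// prodr_ge0.
rewrite (eq_integral_off_null (N := stuck) (g := fun w => (c w)%:E))//; last 4 first.
- exact: measurable_stuck.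
- exact: stuck0.
- exact/measurable_EFinP.
- move=> w nw; rewrite /c big1 ?mulr1// => i _.
  case: (ltP 0 (tau i w)) => // h; exfalso; apply: nw; by exists i.
apply: (@le_trans _ _ (\int[P]_w (expR (lam * t) * Phi m w)%:E)%E).
  apply: le_integral_fin => // w; rewrite /c /b /Phi big_split /=.
  have [h|h] := leP (jump_time tau m w) t; last first.
    by rewrite mul0r mulr_ge0 ?expR_ge0// mulr_ge0// prodr_ge0// => i _; rewrite expR_ge0.
  rewrite mul1r mulrCA ler_peMr ?prodr_ge0//.
  rewrite -expR_sum -expRD -expR0 ler_expR.
  by rewrite sumrN -mulr_sumr -mulrBr mulr_ge0 ?(ltW l0)// subr_ge0.
rewrite ge0_integralMr ?expR_ge0//; last exact: mPhi.
by rewrite EFinM; apply: lee_wpmul2l => //; rewrite lee_fin expR_ge0.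
Qed.

(** The choice [lam = m / t] minimises the Chernoff bound. *)
Lemma jump_time_tail (t : R) m : (0 < m)%N -> 0 < t ->
  (P [set w | (jump_time tau m w <= t)%R] <=
     ((5 * expR 1 * t / m%:R) ^+ m)%:E)%E.
Proof.
move=> m0 t0; have m0' : 0 < m%:R :> R by rewrite ltr0n.
apply: le_trans (@jump_time_chernoff (m%:R / t) t m _ (ltW t0)) _.
  by rewrite divr_gt0.
rewrite lee_fin divfK ?gt_eqF// -[X in expR X]mulr1 expRM_natl -exprMn_comm; last exact: mulrC.
rewrite lerXn2r ?nnegrE ?mulr_ge0 ?expR_ge0 ?invr_ge0 ?divr_ge0 ?(ltW t0)//.
by rewrite invf_div; lra.
Qed.

Definition explosive (t : R) : set Om := [set w | forall n, jump_time tau n w <= t].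

Lemma measurable_explosive t : measurable (explosive t).
Proof.
rewrite (_ : explosive t = \bigcap_n [set w | jump_time tau n w <= t]).
  by apply: bigcap_measurable => // n _; apply: measurable_set_le => //; exact: measurable_jump.
by apply/seteqP; split=> w h n; [move=> _|]; exact: h.
Qed.

Lemma explosive0 t : 0 < t -> P (explosive t) = 0%E.
Proof.
move=> t0; apply/eqP; rewrite eq_le measure_ge0 andbT.
apply/lee_addgt0Pr => e e0; rewrite add0e.
pose C := 5 * expR 1 * t; have C0 : 0 < C by rewrite !mulr_gt0// expR_gt0.
pose m := (maxn (Num.truncn (2 * C)).+1 (Num.truncn (e^-1)).+1).
have m0 : (0 < m)%N by rewrite leq_max.
have mC : 2 * C <= m%:R.
  by apply: le_trans (ltW (truncnS_gt _)) _; rewrite ler_nat leq_maxl.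
have me : e^-1 <= m%:R.
  by apply: le_trans (ltW (truncnS_gt _)) _; rewrite ler_nat leq_maxr.
apply: (@le_trans _ _ (P [set w | (jump_time tau m w <= t)%R])).
  apply: le_measure; rewrite ?inE; first exact: measurable_explosive.
    by apply: measurable_set_le => //; exact: measurable_jump.
  by move=> w; exact.
apply: le_trans (jump_time_tail m0 t0) _; rewrite lee_fin -/C.
have m0' : 0 < m%:R :> R by rewrite ltr0n.
apply: (@le_trans _ _ ((1 / 2) ^+ m)).
  rewrite lerXn2r ?nnegrE ?divr_ge0 ?(ltW C0)// ?ler_pdivrMr//; lra.
rewrite expr_div_n expr1n div1r -[leRHS]invrK lef_pV2 ?posrE ?invr_gt0 ?exprn_gt0//.
apply: le_trans me _; rewrite -natrX ler_nat ltnW// ltn_expl//.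
Qed.

End jump_times.

(** * The Feynman-Kac expansion over the number of jumps *)

Section paths.
Context (R : realType) (Om : Type) (tau eps : nat -> Om -> R) (w : Om).
Hypothesis tau_gt0 : forall k, 0 < tau k w.

Lemma jump_timeS n : jump_time tau n.+1 w = jump_time tau n w + tau n w.
Proof. by rewrite /jump_time big_ord_recr. Qed.

Lemma jump_time_lt m n : (m < n)%N -> jump_time tau m w < jump_time tau n w.
Proof.
elim: n => // n IH; rewrite ltnS leq_eqVlt jump_timeS => /predU1P[->|/IH h].
  by rewrite ltrDl.
by apply: lt_trans h _; rewrite ltrDl.
Qed.

Lemma jump_time_le m n : (m <= n)%N -> jump_time tau m w <= jump_time tau n w.
Proof. by rewrite leq_eqVlt => /predU1P[->//|/jump_time_lt/ltW]. Qed.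

Lemma jump_time_ge0 n : 0 <= jump_time tau n w.
Proof. by have := jump_time_le (leq0n n); rewrite {1}/jump_time big_ord0. Qed.

Lemma jump_time_inj_lt m n : jump_time tau m w < jump_time tau n w -> (m < n)%N.
Proof. by rewrite ltnNge; apply: contraTN => /jump_time_le; rewrite leNgt. Qed.

Lemma jump_time_uniq i j s : jump_time tau i w <= s -> s < jump_time tau i.+1 w ->
  jump_time tau j w <= s -> s < jump_time tau j.+1 w -> i = j.
Proof.
move=> i1 i2 j1 j2; apply/anti_leq/andP; split; rewrite -ltnS;
  apply: jump_time_inj_lt; [exact: le_lt_trans i1 j2|exact: le_lt_trans j1 i2].
Qed.

Lemma num_jumpsE n s : jump_time tau n w <= s -> s < jump_time tau n.+1 w ->
  num_jumps tau s w = n.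
Proof.
move=> h1 h2; rewrite /num_jumps; case: xgetP => [m _ /andP[m1 m2]|/(_ n)].
  exact: jump_time_uniq m1 m2 h1 h2.
by move=> /=; rewrite h1 h2.
Qed.

Lemma walkE n s : jump_time tau n w <= s -> s < jump_time tau n.+1 w ->
  walk tau eps s w = chain eps n w.
Proof. by move=> h1 h2; rewrite /walk (num_jumpsE h1 h2). Qed.

Lemma jump_time_cover n s : 0 <= s -> s < jump_time tau n.+1 w ->
  exists2 i, (i <= n)%N & jump_time tau i w <= s /\ s < jump_time tau i.+1 w.
Proof.
move=> s0; elim: n => [|n IH] sn.
  by exists 0%N => //; split => //; rewrite /jump_time big_ord0.
have [h|h] := ltP s (jump_time tau n.+1 w); last by exists n.+1.
by have [i ni hi] := IH h; exists i => //; exact: leqW.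
Qed.

(** The path is constant between jumps, so the integral is a finite sum over holding intervals, the
    last of them cut at [t]. *)
Lemma integral_path (xi : int -> R) (t : R) n : (forall z, 0 <= xi z) ->
  jump_time tau n w <= t -> t < jump_time tau n.+1 w ->
  (\int[lebesgue_measure]_(s in `[0%R, t]%classic) (xi (walk tau eps s w))%:E =
   (\sum_(i < n) xi (chain eps i w) * tau i w +
     xi (chain eps n w) * (t - jump_time tau n w))%:E)%E.
Proof.
move=> xi0 h1 h2.
pose A i := `[jump_time tau i w, jump_time tau i.+1 w[%classic : set R.
have mA i : measurable (A i) by exact: measurable_itv.
pose c i := xi (chain eps i w).
transitivity (\int[lebesgue_measure]_(s in `[0%R, t]%classic)
   \sum_(i < n.+1) (c i * \1_(A i) s)%:E)%E.
  apply: eq_integral => s; rewrite inE /= in_itv /= => /andP[s0 st].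
  have [i ni [si1 si2]] := jump_time_cover s0 (le_lt_trans st h2).
  rewrite (walkE si1 si2) (bigD1 (inord i)) //= inordK ?ltnS// big1 ?adde0.
    by rewrite indicE mem_set ?mulr1// /A /= in_itv /= si1.
  move=> j ji; rewrite indicE memNset ?mulr0// /A /= in_itv /= => /andP[j1 j2].
  move/negP: ji; apply; apply/eqP; apply: val_inj; rewrite /= inordK ?ltnS//.
  exact: jump_time_uniq j1 j2 si1 si2.
rewrite ge0_integral_sum//; last 2 first.
- move=> i; apply/measurable_EFinP; apply: measurable_funM => //.
  apply: measurable_indic; exact: measurable_itv.
- by move=> i s _; rewrite lee_fin indicE mulr_ge0 ?ler0n ?xi0.
have AE i : (\int[lebesgue_measure]_(s in `[0%R, t]%classic) (c i * \1_(A i) s)%:E =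
     (c i)%:E * lebesgue_measure (A i `&` `[0%R, t]%classic))%E.
  under eq_integral do rewrite EFinM.
  rewrite ge0_integralZl_EFin//; first by rewrite integral_indic; do ?exact: measurable_itv.
  by apply/measurable_EFinP; apply: measurable_indic; exact: measurable_itv.
  exact: xi0.
under eq_bigr do rewrite AE.
rewrite big_ord_recr /= EFinD; congr (_ + _)%E.
  rewrite -sumEFin; apply: eq_bigr => i _; rewrite EFinM; congr (_ * _)%E.
  have -> : A i `&` `[0, t]%classic = A i.
    apply/setIidPl => s; rewrite /A /= !in_itv /= => /andP[s1 s2].
    rewrite (le_trans (jump_time_ge0 _) s1)/=; apply: ltW.
    by apply: (lt_le_trans s2); apply: le_trans h1; exact: jump_time_le.
  by rewrite lebesgue_measure_itv /= lte_fin jump_time_lt// -EFinB jump_timeS addrAC subrr add0r.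
rewrite EFinM; congr (_ * _)%E.
have -> : A n `&` `[0, t]%classic = `[jump_time tau n w, t]%classic.
  apply/seteqP; split=> s; rewrite /A /= !in_itv /=.
    by move=> [/andP[-> _] /andP[_ ->]].
  move=> /andP[s1 s2]; rewrite s1 s2 (le_lt_trans s2 h2)/=.
  by rewrite (le_trans (jump_time_ge0 n) s1).
rewrite lebesgue_measure_itv /= lte_fin; case: ltP => [_|h]; first by rewrite -EFinB.
by congr EFin; apply/eqP; rewrite eq_sym subr_eq0 eq_le h1 h.
Qed.

End paths.

Lemma nneseries_single (R : realType) (u : nat -> \bar R) i :
  (forall n, 0 <= u n)%E -> (forall n, n != i -> u n = 0%E) ->
  (\sum_(n <oo) u n = u i)%E.
Proof.
move=> u0 ui; rewrite (@nneseriesD1 _ u i)//= eseries0 ?adde0// => n _ ni.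
exact: ui.
Qed.

Lemma le_nneseries_term (R : realType) (u : nat -> \bar R) i :
  (forall n, 0 <= u n)%E -> (u i <= \sum_(n <oo) u n)%E.
Proof.
move=> u0; rewrite (@nneseriesD1 _ u i)//= leeDl//.
by apply: nneseries_ge0.
Qed.

Lemma le_integral_off_null d (T : measurableType d) (R : realType)
    (mu : {measure set T -> \bar R}) (N : set T) (f g : T -> \bar R) :
  measurable N -> mu N = 0%E ->
  (forall x, 0 <= f x)%E -> (forall x, 0 <= g x)%E -> measurable_fun setT f ->
  (forall x, ~ N x -> f x <= g x)%E ->
  (\int[mu]_x f x <= \int[mu]_x g x)%E.
Proof.
move=> mN N0 f0 g0 mf fg.
rewrite -(eq_integral_off_null (f := fun x => if x \in N then 0%E else f x) mN N0)//.
- apply: le_integral_ge0 => x; case: ifPn => //.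
  by rewrite notin_setE; exact: fg.
- by move=> x; case: ifP.
- by move=> x Nx; rewrite memNset.
Qed.

Lemma chain_abs (R : realType) (T : Type) (eps : nat -> T -> R) n w :
  (`|chain eps n w| <= n)%N.
Proof.
elim: n => [|n IH]; first by rewrite /chain big_ord0.
rewrite /chain big_ord_recr /= -/(chain eps n w).
by rewrite /step; case: ifP => _; lia.
Qed.

Section feynman_kac.
Context d (Om : measurableType d) (R : realType) (P : probability Om R).
Variables (tau eps : nat -> Om -> R).
Hypothesis ind : mutually_independent P (clocks tau eps).
Hypothesis tauP : forall k (x : R), 0 <= x ->
  P [set w | x < tau k w] = (expR (- (2 * x)))%:E.
Variables (xi : int -> R) (t : R).
Hypotheses (xi0 : forall z, 0 <= xi z) (t0 : 0 < t).

Let mtau k := measurable_tau ind k.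
Let meps k := measurable_eps ind k.
Let mjump k := measurable_jump ind k.
Let u := uFK P tau eps xi t.

Definition in_state n w := (jump_time tau n w <= t) && (t < jump_time tau n.+1 w).

(* The Feynman-Kac weight of the path on the event that it has made exactly [n]
   jumps by time [t]. *)
Definition fkterm n w : R := (in_state n w)%:R *
  (fkweight xi tau eps n w * expR (xi (chain eps n w) * (t - jump_time tau n w))).

Lemma fkterm_ge0 n w : 0 <= fkterm n w.
Proof. by rewrite !mulr_ge0// expR_ge0. Qed.

Lemma measurable_chain_comp d' (T : measurableType d') (f : int -> T) n :
  measurable_fun setT (fun w => f (chain eps n w)).
Proof.
by apply: measurable_int_comp => z; apply: measurable_chain => k _; exact: meps.
Qed.

Lemma measurable_in_state n : measurable_fun setT (in_state n).
Proof.
apply: measurable_and; first exact: (@measurable_fun_ler _ _ R).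
exact: (@measurable_fun_ltr _ _ R).
Qed.

Lemma measurable_fkterm n : measurable_fun setT (fkterm n).
Proof.
apply: measurable_funM.
  by apply: measurable_bool_natr; exact: measurable_in_state.
apply: measurable_funM.
  by apply: measurable_fkweight => k _; [exact: mtau|exact: meps].
apply: measurableT_comp; first exact: measurable_expR.
apply: measurable_funM; first exact: measurable_chain_comp.
exact: measurable_funB.
Qed.

Definition fksum (p : pred int) w : \bar R :=
  (\sum_(n <oo) ((p (chain eps n w))%:R * fkterm n w)%:E)%E.

Lemma fksum_term_ge0 (p : pred int) n w :
  (0 <= ((p (chain eps n w))%:R * fkterm n w)%:E)%E.
Proof. by rewrite lee_fin mulr_ge0// fkterm_ge0. Qed.

Lemma fksum_ge0 p w : (0 <= fksum p w)%E.
Proof. by apply: nneseries_ge0 => n _ _; exact: fksum_term_ge0. Qed.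

Lemma measurable_fksum_term (p : pred int) n :
  measurable_fun setT (fun w => (p (chain eps n w))%:R * fkterm n w).
Proof.
apply: measurable_funM; last exact: measurable_fkterm.
exact: (measurable_chain_comp (fun z => (p z)%:R : R)).
Qed.

Lemma measurable_fksum p : measurable_fun setT (fksum p).
Proof.
apply: (ge0_emeasurable_sum (P := xpredT)).
  by move=> n w _ _; exact: fksum_term_ge0.
by move=> n _; apply/measurable_EFinP; exact: measurable_fksum_term.
Qed.

(** Off this null set exactly one index satisfies [in_state], so that the series [fksum] reduces to
    a single term. *)
Definition degenerate : set Om := stuck tau `|` explosive tau t.

Lemma measurable_degenerate : measurable degenerate.
Proof.
apply: measurableU; first exact: (measurable_stuck ind).
exact: (measurable_explosive ind).
Qed.

Lemma degenerate0 : P degenerate = 0%E.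
Proof.
rewrite measureU0.
- exact: (stuck0 ind tauP).
- exact: (measurable_stuck ind).
- exact: (measurable_explosive ind).
- exact: (explosive0 ind tauP).
Qed.

Lemma degenerate_tau w : ~ degenerate w -> forall k, 0 < tau k w.
Proof.
move=> nb k; rewrite ltNge; apply/negP => h; apply: nb; left; by exists k.
Qed.

Lemma degenerate_state w : ~ degenerate w -> exists i, in_state i w.
Proof.
move=> nb; have tau0 := degenerate_tau nb.
have [m tm] : exists m, t < jump_time tau m w.
  apply: contrapT => h; apply: nb; right => n; rewrite leNgt; apply/negP => tn.
  by apply: h; exists n.
case: m tm => [|m tm]; first by rewrite /jump_time big_ord0 ltNge (ltW t0).
have [i _ [h1 h2]] := jump_time_cover (ltW t0) tm.
by exists i; rewrite /in_state h1 h2.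
Qed.

Lemma fksum_state p w i : ~ degenerate w -> in_state i w ->
  fksum p w = ((p (chain eps i w))%:R * fkterm i w)%:E.
Proof.
move=> nb /[dup] si /andP[i1 i2].
rewrite /fksum (@nneseries_single _ _ i)// => [n|n ni].
  exact: fksum_term_ge0.
rewrite /fkterm; case: (boolP (in_state n w)) => [/andP[n1 n2]|]; last first.
  by rewrite mul0r mulr0.
by rewrite (jump_time_uniq (degenerate_tau nb) n1 n2 i1 i2) eqxx in ni.
Qed.

(** Replaces the Feynman-Kac integrand by a measurable series of nonnegative terms; all later
    estimates of [u] go through it. *)
Lemma uFK_fksum z : u z = (\int[P]_w fksum (pred1 z) w)%E.
Proof.
rewrite /u /uFK; apply: (eq_integral_off_null measurable_degenerate degenerate0).
- by move=> w; rewrite mule_ge0// ?expeR_ge0// lee_fin.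
- by move=> w; exact: fksum_ge0.
- exact: measurable_fksum.
move=> w nb; have [i si] := degenerate_state nb; rewrite (fksum_state _ nb si).
have tau0 := degenerate_tau nb; case/andP: (si) => i1 i2.
rewrite (integral_path eps tau0 xi0 i1 i2) (walkE eps tau0 i1 i2) /=.
by rewrite -EFinM /fkterm si mul1r /fkweight -expRD mulrC.
Qed.

Lemma uFK_ge0 z : (0 <= u z)%E.
Proof. by rewrite uFK_fksum; apply: integral_ge0 => w _; exact: fksum_ge0. Qed.

Lemma integral_fksum p : (\int[P]_w fksum p w =
  \sum_(n <oo) \int[P]_w ((p (chain eps n w))%:R * fkterm n w)%:E)%E.
Proof.
rewrite integral_nneseries//.
- by move=> n; apply/measurable_EFinP; exact: measurable_fksum_term.
- by move=> n w _; exact: fksum_term_ge0.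
Qed.

(** For every finite part of [A] the indicators of the possible end points add up to at most the
    indicator of [p], the path having only one end point. *)
Lemma esum_uFK (A : set int) (p : pred int) : (forall z, A z -> p z) ->
  (\esum_(z in A) u z <= \int[P]_w fksum p w)%E.
Proof.
move=> Ap; apply: ge_ereal_sup => _ [X [finX XA] <-].
under eq_fsbigr do rewrite uFK_fksum.
rewrite -ge0_integral_fsum//; last 2 first.
- by move=> z; exact: measurable_fksum.
- by move=> z w _; exact: fksum_ge0.
apply: (le_integral_off_null measurable_degenerate degenerate0).
- by move=> w; apply: fsume_ge0 => z _; exact: fksum_ge0.
- by move=> w; exact: fksum_ge0.
- by apply: emeasurable_fsum => // z; exact: measurable_fksum.
move=> w nb; have [i si] := degenerate_state nb; rewrite (fksum_state _ nb si).
under eq_fsbigr do rewrite (fksum_state _ nb si).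
rewrite fsbig_finite//=; set Y := chain eps i w.
have XA' z : z \in finmap.enum_fset (fset_set X) -> A z.
  move=> zX; apply: XA; have : z \in X by rewrite -(in_fset_set finX).
  by rewrite inE.
have us : uniq (finmap.enum_fset (fset_set X)) by exact: finmap.fset_uniq.
move: (finmap.enum_fset (fset_set X)) XA' us => s sA us.
have [YX|YX] := boolP (Y \in s).
  rewrite (bigD1_seq Y)//= eqxx big1 ?adde0.
    by rewrite lee_fin Ap//; exact: sA.
  by move=> z zY; rewrite eq_sym (negPf zY) mul0r.
rewrite big_seq big1; first exact: fksum_term_ge0.
move=> z zX; case: eqP => [Yz|]; last by rewrite mul0r.
by rewrite Yz zX in YX.
Qed.

Lemma exponent_le w (a : nat -> R) (c : R) k n : (forall i, 0 < tau i w) ->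
  (k <= n)%N -> (forall i, (k <= i)%N -> (i < n)%N -> a i <= c) ->
  \sum_(i < n) a i * tau i w <=
  \sum_(i < k) a i * tau i w + c * (jump_time tau n w - jump_time tau k w).
Proof.
move=> tau_gt0; elim: n => [|n IH].
  by rewrite leqn0 => /eqP -> _; rewrite subrr mulr0 addr0.
rewrite leq_eqVlt => /predU1P[-> _|]; first by rewrite subrr mulr0 addr0.
rewrite ltnS => kn ac; rewrite big_ord_recr /=.
have := IH kn (fun i ki i_n => ac i ki (ltnW i_n)).
have := ac n kn (leqnn _); have := tau_gt0 n.
rewrite jump_timeS; nra.
Qed.

Lemma fkterm_le w (n : nat) (c : R) : ~ degenerate w ->
  (forall i, (i <= n)%N -> xi (chain eps i w) <= c) ->
  fkterm n w <= (jump_time tau n w <= t)%R%:R * expR (t * c).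
Proof.
move=> nb cle; have tau0 := degenerate_tau nb; rewrite /fkterm /in_state.
have [h1|h1] := leP (jump_time tau n w) t; last by rewrite !mul0r.
have [h2|h2] := ltP t (jump_time tau n.+1 w); last by rewrite mul0r mul1r expR_ge0.
rewrite !mul1r /fkweight -expRD ler_expR.
have := @exponent_le w (fun i => xi (chain eps i w)) c 0 n tau0 (leq0n _).
move=> /(_ (fun i _ i_n => cle i (ltnW i_n))).
rewrite big_ord0 {2}/jump_time big_ord0.
by have := cle n (leqnn _); nra.
Qed.

(** The probability is that of at least [m] jumps before [t], not exactly [m]: an upper bound for
    which the tail estimate is directly available. *)
Definition jump_series (h : nat -> R) : \bar R :=
  (\sum_(m <oo) P [set w | (jump_time tau m w <= t)%R] * (expR (t * h m))%:E)%E.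

Definition jump_term (h : nat -> R) m w : R :=
  (jump_time tau m w <= t)%R%:R * expR (t * h m).

Lemma jump_term_ge0 h m w : 0 <= jump_term h m w.
Proof. by rewrite mulr_ge0// expR_ge0. Qed.

Lemma measurable_jump_term h m : measurable_fun setT (jump_term h m).
Proof.
apply: measurable_funM => //; apply: measurable_bool_natr.
exact: (@measurable_fun_ler _ _ R).
Qed.

Lemma integral_jump_term h :
  (\int[P]_w \sum_(m <oo) (jump_term h m w)%:E = jump_series h)%E.
Proof.
rewrite integral_nneseries//; last 2 first.
- by move=> n; apply/measurable_EFinP; exact: measurable_jump_term.
- by move=> n w _; rewrite lee_fin jump_term_ge0.
apply: eq_eseriesr => m _; rewrite /jump_term.
under eq_integral do rewrite mulrC.
have mb : measurable_fun setT (fun w => jump_time tau m w <= t).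
  exact: (@measurable_fun_ler _ _ R).
rewrite ge0_integralMr ?expR_ge0//; last exact: measurable_bool_natr.
by rewrite integral_bool_natr// muleC.
Qed.

(** With [m] jumps the walk stays within distance [m], so its potential never exceeds [H m]. The
    bound serves to show that [u] is finite. *)
Lemma uFK_le (H : nat -> R) z :
  (forall m y, (`|y| <= m)%N -> xi y <= H m) -> (u z <= jump_series H)%E.
Proof.
move=> xiH; rewrite uFK_fksum -integral_jump_term.
apply: (le_integral_off_null measurable_degenerate degenerate0).
- by move=> w; exact: fksum_ge0.
- by move=> w; apply: nneseries_ge0 => n _ _; rewrite lee_fin jump_term_ge0.
- exact: measurable_fksum.
move=> w nb; have [i si] := degenerate_state nb; rewrite (fksum_state _ nb si).
apply: (@le_trans _ _ (jump_term H i w)%:E); last first.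
  apply: (@le_nneseries_term _ (fun m => (jump_term H m w)%:E)) => n.
  by rewrite lee_fin jump_term_ge0.
rewrite lee_fin; apply: (@le_trans _ _ (fkterm i w)).
  by rewrite ler_piMl ?fkterm_ge0// lern1 leq_b1.
apply: fkterm_le => // k ki; apply: xiH.
exact: leq_trans (chain_abs _ _ _) ki.
Qed.

End feynman_kac.

Lemma last_index (p : pred nat) i : (exists2 j, (j < i)%N & p j) ->
  exists j, [/\ (j < i)%N, p j & forall k, (j < k)%N -> (k < i)%N -> ~~ p k].
Proof.
elim: i => [[]//|i IH] [j ji pj].
have [pi|npi] := boolP (p i).
  by exists i; split => // k ik; rewrite ltnS leqNgt ik.
have [|l [li pl lk]] := IH.
  exists j => //; rewrite ltn_neqAle -ltnS ji andbT; apply: contraNneq npi => <-.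
  exact: pj.
exists l; split => //; first exact: ltnW.
move=> k lk'; rewrite ltnS leq_eqVlt => /predU1P[->//|]; exact: lk.
Qed.

Lemma prode_const (R : realType) (I : eqType) (s : seq I) (f : I -> \bar R) (c : R) :
  (forall i, i \in s -> f i = c%:E) ->
  \big[*%E/1%E]_(i <- s) f i = (c ^+ size s)%:E.
Proof.
elim: s => [|i s IH] fc; first by rewrite big_nil expr0.
rewrite big_cons fc ?mem_head// IH ?exprS// => j js.
by apply: fc; rewrite inE js orbT.
Qed.

(** * Decomposition at the last exit *)

Section last_exit.
Context d (Om : measurableType d) (R : realType) (P : probability Om R).
Variables (tau eps : nat -> Om -> R).
Hypothesis ind : mutually_independent P (clocks tau eps).
Hypothesis tauP : forall k (x : R), 0 <= x ->
  P [set w | x < tau k w] = (expR (- (2 * x)))%:E.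
Variables (xi : int -> R) (t : R).
Hypotheses (xi0 : forall z, 0 <= xi z) (t0 : 0 < t).
Variables (p : pred int) (xiZ g kap : R).
Hypothesis xip : forall z, p z -> xi z = xiZ.
Hypothesis kap0 : 0 <= kap.
Hypothesis exitP : forall k (r : R), 0 <= r ->
  (\int[P]_w ((tau k w <= r)%R%:R * expR (- (g * (r - tau k w))))%:E
     <= (kap * expR (- (2 * r)))%:E)%E.

Let mtau k := measurable_tau ind k.
Let meps k := measurable_eps ind k.
Let mjump k := measurable_jump ind k.
Let u := uFK P tau eps xi t.
Let S := jump_time tau.

(* Dominates the weight of a path that leaves [p] for the last time at its jump [j+1]
   and then sees a potential at most [xiZ - g]. *)
Definition exit_term j w : R :=
  ((p (chain eps j w))%:R * fkweight xi tau eps j w) *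
  ((S j w <= t)%R%:R * expR (xiZ * (t - S j w))) *
  ((tau j w <= t - S j w)%R%:R * expR (- (g * (t - S j w - tau j w)))).

Lemma exit_term_ge0 j w : 0 <= exit_term j w.
Proof. by rewrite !mulr_ge0// expR_ge0. Qed.

Lemma measurable_exit_term j : measurable_fun setT (exit_term j).
Proof.
apply: measurable_funM; [apply: measurable_funM|]; apply: measurable_funM.
- exact: (measurable_chain_comp ind (fun z => (p z)%:R : R)).
- by apply: measurable_fkweight => k _.
- by apply: measurable_bool_natr; apply: (@measurable_fun_ler _ _ R); rewrite /S.
- apply: measurableT_comp; first exact: measurable_expR.
  by apply: measurable_funM => //; apply: measurable_funB; rewrite /S.
- apply: measurable_bool_natr; apply: (@measurable_fun_ler _ _ R) => //.
  by apply: measurable_funB; rewrite /S.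
- apply: measurableT_comp; first exact: measurable_expR.
  apply: measurable_funN; apply: measurable_funM => //.
  by apply: measurable_funB => //; apply: measurable_funB; rewrite /S.
Qed.

(** Freeze the past at the arrival time [S j] and put [r = t - S j]. The integral over [tau j] is at
    most [kap * expR (- (2 * r))] by [exitP], and [expR (- (2 * r))] is exactly the probability of
    staying put until [t]; the latter event carries the weight [fkterm] of paths ending in [p] after
    [j] jumps. *)
Lemma integral_exit_term j : (\int[P]_w (exit_term j w)%:E <=
  kap%:E * \int[P]_w ((p (chain eps j w))%:R * fkterm tau eps xi t j w)%:E)%E.
Proof.
pose V w : R * R := ((p (chain eps j w))%:R * fkweight xi tau eps j w, S j w).
pose c (v : R * R) : R := `|v.1| * ((v.2 <= t)%R%:R * expR (xiZ * (t - v.2))).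
have c0 v : 0 <= c v by rewrite !mulr_ge0// expR_ge0.
pose e1 (s x : R) : R := (x <= t - s)%R%:R * expR (- (g * (t - s - x))).
pose e2 (s x : R) : R := (t - s < x)%R%:R.
pose h1 (x : (R * R) * R) := (c x.1 * e1 x.1.2 x.2)%:E.
pose h2 (x : (R * R) * R) := (c x.1 * e2 x.1.2 x.2)%:E.
have m1 : measurable_fun setT (fun x : (R * R) * R => x.1.1).
  by apply: (measurableT_comp measurable_fst); exact: measurable_fst.
have m2 : measurable_fun setT (fun x : (R * R) * R => x.1.2).
  by apply: (measurableT_comp measurable_snd); exact: measurable_fst.
have m3 : measurable_fun setT (fun x : (R * R) * R => x.2) by exact: measurable_snd.
have mts : measurable_fun setT (fun x : (R * R) * R => t - x.1.2).
  exact: measurable_funB.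
have mc : measurable_fun setT (fun x : (R * R) * R => c x.1).
  apply: measurable_funM; first exact: measurableT_comp m1.
  apply: measurable_funM.
    by apply: measurable_bool_natr; apply: (@measurable_fun_ler _ _ R).
  apply: measurableT_comp; first exact: measurable_expR.
  exact: measurable_funM.
have mh1 : measurable_fun setT h1.
  apply/measurable_EFinP; apply: measurable_funM => //; apply: measurable_funM.
    by apply: measurable_bool_natr; apply: (@measurable_fun_ler _ _ R).
  apply: measurableT_comp; first exact: measurable_expR.
  by apply: measurable_funN; apply: measurable_funM => //; exact: measurable_funB.
have mh2 : measurable_fun setT h2.
  apply/measurable_EFinP; apply: measurable_funM => //.
  by apply: measurable_bool_natr; apply: (@measurable_fun_ltr _ _ R).
have mV : measurable_fun [set: pastType tau eps j] (V : pastType tau eps j -> R * R).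
  have mt k : (k < j)%N -> measurable_fun [set: pastType tau eps j] (tau k : pastType tau eps j -> R).
    exact: past_tau.
  have me k : (k < j)%N -> measurable_fun [set: pastType tau eps j] (eps k : pastType tau eps j -> R).
    exact: past_eps.
  apply: measurable_fun_pair; last exact: measurable_jump_time.
  apply: measurable_funM; last exact: measurable_fkweight.
  apply: (@measurable_int_comp _ _ _ _ _ (fun z => (p z)%:R : R)) => z.
  exact: measurable_chain.
have h10 x : (0 <= h1 x)%E by rewrite lee_fin !mulr_ge0// expR_ge0.
have h20 x : (0 <= h2 x)%E by rewrite lee_fin !mulr_ge0// expR_ge0.
have V0 w : 0 <= (V w).1 by rewrite mulr_ge0// expR_ge0.
have -> : (\int[P]_w (exit_term j w)%:E = \int[P]_w h1 (V w, tau j w))%E.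
  apply: eq_integral => w _; rewrite /h1 /c /exit_term /e1 /=.
  by rewrite ger0_norm//; exact: (V0 w).
have -> : (\int[P]_w ((p (chain eps j w))%:R * fkterm tau eps xi t j w)%:E =
    \int[P]_w h2 (V w, tau j w))%E.
  apply: eq_integral => w _; rewrite /h2 /c /=; congr EFin.
  rewrite ger0_norm; last exact: (V0 w).
  rewrite /fkterm /in_state /e2 /= jump_timeS -/(S j w) ltrBlDl.
  case: (boolP (p _)) => [/xip ->|]; last by rewrite !mul0r.
  by rewrite !mul1r -mulnb natrM; ring.
rewrite (past_integral ind)// (past_integral ind)//.
have mh2V : measurable_fun setT (fun w => \int[P]_w' h2 (V w, tau j w'))%E.
  have mVV : measurable_fun setT V.
    apply: measurable_fun_pair; last exact: mjump.
    apply: measurable_funM; last by apply: measurable_fkweight => k _.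
    exact: (measurable_chain_comp ind (fun z => (p z)%:R : R)).
  pose F (x : Om * Om) := h2 (V x.1, tau j x.2).
  have mF : measurable_fun setT F.
    apply: measurableT_comp mh2 _; apply: measurable_fun_pair.
      by apply: measurableT_comp mVV _; exact: measurable_fst.
    by apply: measurableT_comp (mtau j) _; exact: measurable_snd.
  exact: (@measurable_fun_fubini_tonelli_F _ _ _ _ _ P F mF (fun x => h20 _)).
rewrite -ge0_integralZl_EFin//; last first.
  by move=> w _; apply: integral_ge0 => w' _.
apply: le_integral_ge0 => w; first by apply: integral_ge0 => w' _.
have e10 x : 0 <= e1 (V w).2 x by rewrite mulr_ge0// expR_ge0.
have me1 : measurable_fun setT (fun w' => e1 (V w).2 (tau j w')).
  apply: measurable_funM.
    by apply: measurable_bool_natr; apply: (@measurable_fun_ler _ _ R).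
  apply: measurableT_comp; first exact: measurable_expR.
  by apply: measurable_funN; apply: measurable_funM => //; exact: measurable_funB.
have me2 : measurable_fun setT (fun w' => t - (V w).2 < tau j w').
  exact: (@measurable_fun_ltr _ _ R).
rewrite /h1 /h2 /= ge0_integralMr// ge0_integralMr//; last first.
  exact: measurable_bool_natr.
rewrite muleCA; have [st|st] := leP (S j w) t; last first.
  have -> : c (V w) = 0 by rewrite /c /= (leNgt (S j w)) st mul0r mulr0.
  by rewrite !mul0e.
apply: lee_wpmul2l; first by rewrite lee_fin.
rewrite integral_bool_natr//= tauP ?subr_ge0// -EFinM.
by apply: exitP; rewrite subr_ge0.
Qed.

Variables (h : nat -> R) (R0 : nat).
Hypothesis hP : forall m y, (`|y| <= m)%N -> ~~ p y || (R0 <= m)%N -> xi y <= h m.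
Hypothesis gapP : forall y, (`|y| < R0)%N -> ~~ p y -> xi y <= xiZ - g.

(** A path that never met [p], or made at least [R0] jumps, sees only potentials below [h i] and is
    charged to the jump series. Otherwise it is charged to its last visit of [p]: from then on it
    avoids [p] within distance less than [R0], where [gapP] applies. *)
Lemma fkterm_exit w i : ~ degenerate tau t w -> in_state tau t i w ->
  ~~ p (chain eps i w) ->
  ((fkterm tau eps xi t i w)%:E <= \sum_(m <oo) (jump_term tau t h m w)%:E +
     \sum_(j <oo) (exit_term j w)%:E)%E.
Proof.
move=> nb si npi; have tau0 := degenerate_tau nb; case/andP: (si) => i1 i2.
have J0 : (0 <= \sum_(m <oo) (jump_term tau t h m w)%:E)%E.
  by apply: nneseries_ge0 => n _ _; rewrite lee_fin jump_term_ge0.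
have E0 : (0 <= \sum_(j <oo) (exit_term j w)%:E)%E.
  by apply: nneseries_ge0 => n _ _; rewrite lee_fin exit_term_ge0.
have [[j ji pj]|nj] := pselect (exists2 j, (j < i)%N & p (chain eps j w)); last first.
  apply: (@le_trans _ _ (jump_term tau t h i w)%:E).
    rewrite lee_fin; apply: fkterm_le => // k ki; apply: hP.
      exact: leq_trans (chain_abs _ _ _) ki.
    apply/orP; left; apply/negP => pk; move: ki; rewrite leq_eqVlt => /predU1P[ki|ki].
      by rewrite ki (negPf npi) in pk.
    by apply: nj; exists k.
  apply: le_trans (leeDl _ E0).
  apply: (@le_nneseries_term _ (fun m => (jump_term tau t h m w)%:E)) => n.
  by rewrite lee_fin jump_term_ge0.
have [Ri|iR] := leqP R0 i.
  apply: (@le_trans _ _ (jump_term tau t h i w)%:E).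
    rewrite lee_fin; apply: fkterm_le => // k ki; apply: hP.
      exact: leq_trans (chain_abs _ _ _) ki.
    by rewrite Ri orbT.
  apply: le_trans (leeDl _ E0).
  apply: (@le_nneseries_term _ (fun m => (jump_term tau t h m w)%:E)) => n.
  by rewrite lee_fin jump_term_ge0.
have [l [li pl lk]] := @last_index (fun j => p (chain eps j w)) i
  (ex_intro2 _ _ j ji pj).
apply: (@le_trans _ _ (exit_term l w)%:E); last first.
  apply: le_trans (leeDr _ J0).
  apply: (@le_nneseries_term _ (fun m => (exit_term m w)%:E)) => n.
  by rewrite lee_fin exit_term_ge0.
have Sl1 : S l.+1 w <= t by apply: le_trans i1; exact: jump_time_le.
have Sl : S l w <= t by apply: le_trans Sl1; exact: jump_time_le.
have S1 : S l.+1 w = S l w + tau l w by rewrite /S jump_timeS.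
rewrite lee_fin /exit_term /fkterm si pl Sl !mul1r.
rewrite (_ : (tau l w <= t - S l w) = true) ?mul1r; last first.
  by rewrite lerBrDl -S1.
rewrite /fkweight -!expRD ler_expR.
have gk k : (l < k)%N -> (k <= i)%N -> xi (chain eps k w) <= xiZ - g.
  move=> lk' ki; apply: gapP.
    exact: leq_ltn_trans (leq_trans (chain_abs _ _ _) ki) iR.
  move: ki; rewrite leq_eqVlt => /predU1P[->//|ki]; exact: lk.
(* The holding time at the last visit itself, of index [l], keeps the rate [xiZ]; the bound
   [xiZ - g] starts with index [l.+1]. *)
have := @exponent_le _ _ _ tau w (fun k => xi (chain eps k w)) (xiZ - g) l.+1 i tau0 li.
move=> /(_ (fun k lk' ki => gk k lk' (ltnW ki))).
rewrite big_ord_recr /= (xip pl) -/(S i w) -/(S l.+1 w) S1.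
have := gk i li (leqnn _).
have : 0 <= t - S i w by rewrite subr_ge0.
nra.
Qed.

(** Summing the exit estimates over the index of the last visit reconstitutes the full mass of paths
    ending in [p]. *)
Lemma rest_le : (\esum_(z in [set z | ~~ p z]) u z <=
  jump_series P tau t h +
  kap%:E * \int[P]_w fksum tau eps xi t p w)%E.
Proof.
apply: le_trans (esum_uFK ind tauP xi0 t0 (p := predC p) _) _ => //.
have mE : measurable_fun setT (fun w => \sum_(j <oo) (exit_term j w)%:E)%E.
  apply: (ge0_emeasurable_sum (P := xpredT)).
    by move=> n w _ _; rewrite lee_fin exit_term_ge0.
  by move=> n _; apply/measurable_EFinP; exact: measurable_exit_term.
have mJ : measurable_fun setT (fun w => \sum_(m <oo) (jump_term tau t h m w)%:E)%E.
  apply: (ge0_emeasurable_sum (P := xpredT)).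
    by move=> n w _ _; rewrite lee_fin jump_term_ge0.
  by move=> n _; apply/measurable_EFinP; exact: (measurable_jump_term ind).
have J0 w : (0 <= \sum_(m <oo) (jump_term tau t h m w)%:E)%E.
  by apply: nneseries_ge0 => n _ _; rewrite lee_fin jump_term_ge0.
have E0 w : (0 <= \sum_(j <oo) (exit_term j w)%:E)%E.
  by apply: nneseries_ge0 => n _ _; rewrite lee_fin exit_term_ge0.
apply: (@le_trans _ _ (\int[P]_w (\sum_(m <oo) (jump_term tau t h m w)%:E +
     \sum_(j <oo) (exit_term j w)%:E))%E).
  apply: (le_integral_off_null (measurable_degenerate ind t) (degenerate0 ind tauP t0)).
  - by move=> w; exact: fksum_ge0.
  - by move=> w; rewrite adde_ge0.
  - exact: (measurable_fksum ind).
  move=> w nb; have [i si] := degenerate_state t0 nb; rewrite (fksum_state _ _ _ nb si).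
  have [pi|npi] := boolP (p (chain eps i w)).
    by rewrite /= pi mul0r adde_ge0.
  by rewrite /= npi mul1r; exact: fkterm_exit.
rewrite ge0_integralD// (integral_jump_term ind); apply: leeD => //.
rewrite integral_nneseries//; last 2 first.
- by move=> n; apply/measurable_EFinP; exact: measurable_exit_term.
- by move=> n w _; rewrite lee_fin exit_term_ge0.
rewrite (integral_fksum ind) -nneseriesZl; last first.
  by move=> n _; apply: integral_ge0 => w _; exact: fksum_term_ge0.
apply: lee_nneseries => n _.
  by move=> _; apply: integral_ge0 => w _; rewrite lee_fin exit_term_ge0.
exact: integral_exit_term.
Qed.

End last_exit.

(** * Lower bound by a direct path *)

Section lower_bound.
Context d (Om : measurableType d) (R : realType) (P : probability Om R).
Variables (tau eps : nat -> Om -> R).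
Hypothesis ind : mutually_independent P (clocks tau eps).
Hypothesis tauP : forall k (x : R), 0 <= x ->
  P [set w | x < tau k w] = (expR (- (2 * x)))%:E.
Hypothesis epsP : forall k, P [set w | eps k w = 1] = (1 / 2)%:E.
Variables (xi : int -> R) (t : R).
Hypotheses (xi0 : forall z, 0 <= xi z) (t0 : 0 < t).

(** The event used: [n] steps to the right, the first [n] holding times at most [rho * t / n] each,
    the next one longer than [t]. The walk then sits at [n] for at least [(1 - rho) * t], and
    independence gives the probability as a product. *)
Lemma uFK_lower (n : nat) (rho : R) : (0 < n)%N -> 0 < rho -> rho < 1 ->
  (((rho * t / (n%:R + 2 * (rho * t))) ^+ n * expR (- (2 * t)) *
     expR (xi n%:Z * ((1 - rho) * t)))%:E <= uFK P tau eps xi t n%:Z)%E.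
Proof.
move=> n0 rho0 rho1; have n0' : 0 < n%:R :> R by rewrite ltr0n.
pose x : R := rho * t / n%:R.
have rt : 0 < rho * t by rewrite mulr_gt0.
have x0 : 0 < x by rewrite divr_gt0.
pose B (i : nat + nat) : set R := match i with
  | inl k => if (k < n)%N then `]0, x]%classic else `]t, +oo[%classic
  | inr k => [set 1] end.
have mB i : measurable (B i).
  case: i => k /=; last exact: measurable_set1.
  by case: ifP => _; exact: measurable_itv.
pose Ev := \big[setI/setT]_(i <- inl n :: past n) (clocks tau eps i @^-1` B i).
have PB1 k : (k < n)%N -> P (tau k @^-1` B (inl k)) = (1 - expR (- (2 * x)))%:E.
  move=> kn; have -> : 1 - expR (- (2 * x)) = expR (- (2 * 0)) - expR (- (2 * x)).
    by rewrite mulr0 oppr0 expR0.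
  rewrite -(tau_itv ind tauP k (lexx 0) (ltW x0)) /= kn; congr (P _).
have PB2 k : P (eps k @^-1` B (inr k)) = (1 / 2)%:E by exact: epsP.
have PB3 : P (tau n @^-1` B (inl n)) = (expR (- (2 * t)))%:E.
  rewrite -(tauP n (ltW t0)) /= ltnn; congr (P _).
  by apply/seteqP; split=> w; rewrite /preimage /= in_itv /= andbT.
have PEv : P Ev = (expR (- (2 * t)) *
    ((1 - expR (- (2 * x))) ^+ n * (1 / 2) ^+ n))%:E.
  rewrite /Ev (ind.2 (inl n :: past n) _ B mB); last first.
    by rewrite cons_uniq past_notin past_uniq.
  rewrite big_cons PB3 big_cat /= !big_map.
  rewrite (@prode_const _ _ _ _ (1 - expR (- (2 * x)))); last first.
    by move=> k; rewrite mem_iota /= add0n => kn; exact: PB1.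
  rewrite (@prode_const _ _ _ _ (1 / 2)); last by move=> k _; exact: PB2.
  by rewrite size_iota -!EFinM.
have mEv : measurable Ev.
  rewrite /Ev; elim/big_ind: _ => //; first exact: measurableI.
  by move=> i _; rewrite -[_ @^-1` _]setTI; apply: (ind.1 i).
have EvP w : Ev w -> [/\ (forall k, (k < n)%N -> 0 < tau k w /\ tau k w <= x),
     (forall k, (k < n)%N -> eps k w = 1) & t < tau n w].
  rewrite /Ev -bigcap_seq => EvA; split.
  - move=> k kn; have := EvA (inl k); rewrite /= in_cons mem_cat map_f ?mem_iota//= orbT.
    by move=> /(_ isT); rewrite /preimage /= kn /= in_itv /= => /andP[].
  - move=> k kn; have := EvA (inr k); rewrite /= in_cons mem_cat (@map_f _ _ inr _ k) ?mem_iota//= ?orbT.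
    by move=> /(_ isT).
  - have := EvA (inl n); rewrite /= in_cons eqxx => /(_ isT).
    by rewrite /preimage /= ltnn /= in_itv /= andbT.
set c := expR (xi n%:Z * ((1 - rho) * t)); have c0 : 0 <= c by exact: expR_ge0.
apply: (@le_trans _ _ (\int[P]_w (c * \1_Ev w)%:E)%E).
  rewrite ge0_integralMr ?expR_ge0//.
  rewrite integral_indic// setIT; move: PEv => /= ->.
  rewrite -EFinM lee_fin mulrC ler_pM2l ?expR_gt0//.
  rewrite mulrC ler_pM2l ?expR_gt0// -exprMn_comm; last exact: mulrC.
  have den : 0 < n%:R + 2 * (rho * t) by rewrite addr_gt0// mulr_gt0.
  have e1 : 0 < 1 - expR (- (2 * x)) by rewrite subr_gt0 expR_lt1 oppr_lt0 mulr_gt0.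
  rewrite lerXn2r ?nnegrE ?divr_ge0 ?mulr_ge0 ?(ltW den) ?(ltW rho0) ?(ltW t0) ?(ltW e1)//.
  have -> : rho * t = x * n%:R by rewrite /x divfK// gt_eqF.
  have -> : x * n%:R / (n%:R + 2 * (x * n%:R)) = x / (1 + 2 * x).
    by field; rewrite !gt_eqF//; nra.
  (* One fast step to the right has probability [(1 - expR (- (2 * x))) / 2], hence at least
     [x / (1 + 2 * x)], which is the base of the power in the statement. *)
  have ex : expR (- (2 * x)) <= (1 + 2 * x)^-1.
    rewrite expRN lef_pV2 ?posrE ?expR_gt0 ?expR_ge1Dx//; lra.
  have -> : x / (1 + 2 * x) = (1 - (1 + 2 * x)^-1) * (1 / 2).
    by field; rewrite gt_eqF//; lra.
  by rewrite ler_pM2r ?lerD2l ?lerN2//; lra.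
rewrite (uFK_fksum ind tauP xi0 t0); apply: le_integral_ge0 => w.
  by rewrite lee_fin mulr_ge0 ?expR_ge0// indicE.
rewrite indicE; case: (boolP (w \in Ev)) => [|_]; last by rewrite mulr0 fksum_ge0.
rewrite inE => /EvP[tk ek tn]; rewrite mulr1.
apply: le_trans (@le_nneseries_term _ (fun m => ((pred1 n%:Z (chain eps m w))%:R *
  fkterm tau eps xi t m w)%:E) n _); last by move=> m; exact: fksum_term_ge0.
have chn : chain eps n w = n%:Z.
  rewrite /chain (eq_bigr (fun=> 1)).
    by rewrite sumr_const card_ord natz.
  by move=> k _; rewrite /step ek// eqxx.
have Sn0 : 0 <= jump_time tau n w.
  by apply: sumr_ge0 => k _; apply: ltW; exact: (tk k (ltn_ord k)).1.
have Sn : jump_time tau n w <= rho * t.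
  apply: (@le_trans _ _ (\sum_(k < n) x)).
    by apply: ler_sum => k _; exact: (tk k (ltn_ord k)).2.
  by rewrite sumr_const card_ord -mulr_natr /x divfK// gt_eqF.
have rtt : rho * t <= t by rewrite ler_piMl// ltW.
rewrite lee_fin /= chn eqxx mul1r /fkterm /in_state jump_timeS.
rewrite (le_trans Sn rtt) (lt_le_trans tn) ?lerDr// !mul1r chn.
rewrite /fkweight -expRD ler_expR -[leLHS]add0r lerD//.
  apply: sumr_ge0 => k _; apply: mulr_ge0 => //.
  by apply: ltW; exact: (tk k (ltn_ord k)).1.
by rewrite ler_wpM2l// mulrBl mul1r lerD2l lerN2.
Qed.

End lower_bound.

(** * From path estimates to the ratio *)

Section two_sites.
Context d (Om : measurableType d) (R : realType) (P : probability Om R).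
Variables (tau eps : nat -> Om -> R).
Hypothesis ind : mutually_independent P (clocks tau eps).
Hypothesis tauP : forall k (x : R), 0 <= x ->
  P [set w | x < tau k w] = (expR (- (2 * x)))%:E.
Variables (xi : int -> R) (t : R).
Hypotheses (xi0 : forall z, 0 <= xi z) (t0 : 0 < t).
Let u := uFK P tau eps xi t.

Definition twin (n : nat) : pred int := fun z => (z == n%:Z) || (z == - n%:Z).

Lemma integral_fksum_twin n :
  (\int[P]_w fksum tau eps xi t (twin n) w <= u n%:Z + u (- n%:Z))%E.
Proof.
rewrite /u !(uFK_fksum ind tauP xi0 t0) -ge0_integralD//; last 4 first.
- by move=> w _; exact: fksum_ge0.
- exact: (measurable_fksum ind).
- by move=> w _; exact: fksum_ge0.
- exact: (measurable_fksum ind).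
apply: (le_integral_off_null (measurable_degenerate ind t) (degenerate0 ind tauP t0)).
- by move=> w; exact: fksum_ge0.
- by move=> w; rewrite adde_ge0// fksum_ge0.
- exact: (measurable_fksum ind).
move=> w nb; have [i si] := degenerate_state t0 nb; rewrite !(fksum_state _ _ _ nb si).
rewrite -EFinD lee_fin -mulrDl ler_wpM2r ?fkterm_ge0//= /twin -natrD ler_nat.
by case: (_ == _); case: (_ == _).
Qed.

Lemma UFK_split n : (0 < n)%N ->
  (UFK P tau eps xi t = u n%:Z + u (- n%:Z) +
     \esum_(z in [set z | ~~ twin n z]) u z)%E.
Proof.
move=> n0; have u0 z : (0 <= u z)%E by exact: (uFK_ge0 ind tauP xi0 t0).
rewrite /UFK -/u (esumID [set n%:Z])// setTI esum_set1//.
rewrite (esumID [set - n%:Z] ([set: int] `&` ~` [set n%:Z]))//.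
rewrite (_ : _ `&` [set - n%:Z] = [set - n%:Z]); last first.
  apply/seteqP; split=> [z [_]//|z /= ->]; split=> //; split=> //=.
  by move=> h; move: n0 h; lia.
rewrite esum_set1// addeA.
rewrite (_ : _ `&` ~` [set - n%:Z] = [set z | ~~ twin n z])//.
apply/seteqP; split=> z /=.
  move=> [[_ zn] zmn]; rewrite /twin negb_or.
  by apply/andP; split; apply/eqP.
by rewrite /twin negb_or => /andP[/eqP ? /eqP ?].
Qed.

(** The mass off the two sites is at most [kap * B] from the jump series plus [kap] times the mass
    on them. As [B] bounds [u n] from below, it is at most [2 * kap] times the mass on the two
    sites. *)
Lemma localisation_ratio n (g kap B : R) (h : nat -> R) (R0 : nat) :
  (0 < n)%N -> xi (- n%:Z) = xi n%:Z -> 0 <= kap -> 0 < B ->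
  (forall k (r : R), 0 <= r ->
    (\int[P]_w ((tau k w <= r)%R%:R * expR (- (g * (r - tau k w))))%:E
      <= (kap * expR (- (2 * r)))%:E)%E) ->
  (forall m y, (`|y| <= m)%N -> ~~ twin n y || (R0 <= m)%N -> xi y <= h m) ->
  (forall y, (`|y| < R0)%N -> ~~ twin n y -> xi y <= xi n%:Z - g) ->
  (B%:E <= u n%:Z)%E -> (jump_series P tau t h <= (kap * B)%:E)%E ->
  `| (fine (u n%:Z) + fine (u (- n%:Z))) / fine (UFK P tau eps xi t) - 1 |
    <= 2 * kap.
Proof.
move=> n0 xin kap0 B0 exitP hP gapP Bu Jh.
have u0 z : (0 <= u z)%E by exact: (uFK_ge0 ind tauP xi0 t0).
have h0 m : 0 <= h m.
  apply: le_trans (xi0 0) _; apply: hP => //.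
  by apply/orP; left; rewrite /twin; lia.
have xip z : twin n z -> xi z = xi n%:Z by case/orP => /eqP ->.
(* Needed because [fine] sends infinite values to 0. Raising the level by [xi n] covers the two
   excluded sites and only multiplies the jump series by a constant. *)
have ufin z : u z \is a fin_num.
  have uJ : (u z <= jump_series P tau t (fun m => h m + xi n%:Z)%R)%E.
    apply: (uFK_le ind tauP xi0 t0) => m y ym.
    have [ty|nty] := boolP (twin n y); first by rewrite (xip _ ty) lerDr.
    by apply: le_trans (hP m y ym _) _; rewrite ?nty// lerDl.
  rewrite ge0_fin_numE//; apply: le_lt_trans uJ _.
  rewrite (_ : jump_series _ _ _ _ =
      (expR (t * xi n%:Z))%:E * jump_series P tau t h)%E.
    apply: le_lt_trans (ltry (expR (t * xi n%:Z) * (kap * B))).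
    by rewrite [leRHS]EFinM; apply: lee_wpmul2l => //; rewrite lee_fin expR_ge0.
  rewrite /jump_series -nneseriesZl; last first.
    by move=> m _; rewrite mule_ge0// lee_fin expR_ge0.
  apply: eq_eseriesr => m _; rewrite muleCA; congr (_ * _)%E.
  by rewrite -EFinM -expRD; congr (expR _)%:E; ring.
rewrite (UFK_split n0).
have := rest_le ind tauP xi0 t0 xip kap0 exitP hP gapP.
have E0 : (0 <= \esum_(z in [set z | ~~ twin n z]) u z)%E by exact: esum_ge0.
rewrite -/u; set E := (\esum_(z in _) _)%E in E0 *.
move: (ufin n%:Z) (ufin (- n%:Z)) (u0 n%:Z) (u0 (- n%:Z)) Bu (integral_fksum_twin n).
case: (u n%:Z) => // x _; case: (u (- n%:Z)) => // y _.
rewrite !lee_fin => x0 y0 Bx Ixy EJ.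
have : (E <= (kap * B + kap * (x + y))%:E)%E.
  apply: le_trans EJ _; rewrite EFinD; apply: leeD => //.
  by rewrite [leRHS]EFinM; apply: lee_wpmul2l.
case: E E0 {EJ} => // E; rewrite !lee_fin => E0 EB.
rewrite -!EFinD /=.
have xy : 0 < x + y by lra.
have xyE : 0 < x + y + E by lra.
rewrite -[X in _ - X](divff (lt0r_neq0 xyE)) -mulrBl opprD addrA subrr add0r.
rewrite mulNr normrN ger0_norm ?divr_ge0//; last exact: ltW.
rewrite ler_pdivrMr//; nra.
Qed.

End two_sites.

Lemma nneseries_le (R : realType) (u : nat -> \bar R) (x : \bar R) :
  (forall n, 0 <= u n)%E -> (forall N, \sum_(0 <= i < N) u i <= x)%E ->
  (\sum_(i <oo) u i <= x)%E.
Proof.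
move=> u0 ux; apply: lime_le; first exact: is_cvg_nneseries.
by apply: nearW => N; exact: ux.
Qed.

Lemma nneseries_half (R : realType) (c : R) : 0 <= c ->
  (\sum_(i <oo) (c * 2^-1 ^+ i)%:E <= (2 * c)%:E)%E.
Proof.
move=> c0; apply: nneseries_le => [n|N].
  by rewrite lee_fin mulr_ge0// exprn_ge0.
have : (\sum_(0 <= i < N) (c * 2^-1 ^+ i)%:E = (2 * c - 2 * c * 2^-1 ^+ N)%:E)%E.
  elim: N => [|N IH]; first by rewrite big_geq// expr0 mulr1 subrr.
  by rewrite big_nat_recr//= IH -EFinD exprS; congr EFin; field.
move=> ->; rewrite lee_fin lerBlDr lerDl !mulr_ge0// exprn_ge0//.
Qed.

Lemma ln_le_subr1 (R : realType) (x : R) : 0 < x -> ln x <= x - 1.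
Proof.
move=> x0; have := @le_ln1Dx R (x - 1); rewrite addrCA subrr addr0; apply.
by rewrite ltrBrDl subrr.
Qed.

Lemma expR_ln_natM (R : realType) (x : R) n : 0 < x ->
  expR (n%:R * ln x) = x ^+ n.
Proof. by move=> x0; rewrite expRM_natl lnK. Qed.

(** * Localisation for a fixed typical potential *)

Section deterministic_estimates.
Context d (Om : measurableType d) (R : realType) (P : probability Om R).
Variables (tau eps : nat -> Om -> R).
Hypothesis ind : mutually_independent P (clocks tau eps).
Hypothesis tauP : forall k (x : R), 0 <= x ->
  P [set w | x < tau k w] = (expR (- (2 * x)))%:E.
Hypothesis epsP : forall k, P [set w | eps k w = 1] = (1 / 2)%:E.

Variables (xi : int -> R) (t L a r beta c K eta kap : R) (n : nat).
(** [C] comes from the tail [(C t / m)^m] of the number of jumps. [K1 a] bounds the potential within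
    [2 K r]; [delta r] is the allowed surplus of jumps over [n]; up to [nu r] jumps are counted as
    free; [zeta a] is the tolerated loss of height; [rho] is the share of time spent travelling. *)
Let C : R := 5 * expR 1.
Let theta := beta / 8.
Let K1 := beta * K / 4.
Let delta := eta / 8.
Let nu := eta / 16.
Let zeta := eta * beta / 64.
Let rho := eta / (32 * K).
Let x0 := xi n%:Z.
Let psi := Psi xi t n%:Z.
Hypotheses (beta0 : 0 < beta) (beta1 : beta <= 1) (c0 : 0 < c) (c1 : c <= 1)
  (K0 : 1 <= K) (eta0 : 0 < eta) (etac : eta <= c / 2) (kap0 : 0 < kap).
Hypotheses (t0 : 0 < t) (L0 : 0 < L) (a0 : 0 < a) (rL : r * L = t * a).
Hypothesis xi1 : forall z, 1 <= xi z.
Hypotheses (n0 : (0 < n)%N) (nr : n%:R <= K * r).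
Hypothesis xiT : forall y : int, xi y <= theta * Num.max `|y|%N%:R (K * r) * L / t.
Hypothesis sym : xi (- n%:Z) = xi n%:Z.
Hypothesis psi_ge : c * a <= psi.
Hypothesis gap : forall y : int, `|y|%N%:R <= 2 * K * r -> ~~ twin n y ->
  Psi xi t y <= psi - eta * a.
Hypothesis l1 : ln (K1 * a) <= 2 * L.
Hypothesis l2 : K * a / (rho * L) + 2 <= c * a.
Hypothesis l3 : 4 <= zeta * a.
Hypothesis l4 : C * L <= nu * a.
Hypothesis l5 : 0 <= ln (K1 * C * L / nu).
Hypothesis l5' : 2 * K * ln (K1 * C * L / nu) <= zeta * L.
Hypothesis l6 : beta / 2 * L <= ln (c * a).
Hypothesis l7 : C * L * expR (theta * L) <= K * a.
Hypothesis l8 : 2 * K * r + 2 - ln kap <= zeta * (r * L).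
Hypothesis l9 : 2 <= r.
Hypothesis l10 : 2 * L / t <= eta / 4 * a.
Hypothesis l11 : 2 * K * a / L <= c * a.

Let Kp : 0 < K. Proof. exact: lt_le_trans K0. Qed.
Let Cp : 0 < C. Proof. by rewrite mulr_gt0// expR_gt0. Qed.
Let nup : 0 < nu. Proof. by rewrite divr_gt0. Qed.
Let zetap : 0 < zeta. Proof. by rewrite divr_gt0// mulr_gt0. Qed.
Let K1p : 0 < K1. Proof. by rewrite divr_gt0// mulr_gt0. Qed.
Let rhop : 0 < rho. Proof. by rewrite divr_gt0// mulr_gt0. Qed.
Let rp : 0 < r. Proof. exact: lt_le_trans l9. Qed.
Let xip z : 0 < xi z. Proof. exact: lt_le_trans (xi1 z). Qed.
Let ta0 : 0 < t * a. Proof. exact: mulr_gt0. Qed.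

Let Krp : 0 < K * r. Proof. exact: mulr_gt0. Qed.
Let K2 : K * r <= 2 * K * r.
Proof. by rewrite -mulrA ler_peMl ?(ltW Krp)// ler1n. Qed.
Let zeta_eta : 64 * zeta <= eta.
Proof.
rewrite /zeta (_ : 64 * (eta * beta / 64) = eta * beta); last by field.
by rewrite ler_piMr// ltW.
Qed.
Let zeta_ta : 64 * (zeta * (t * a)) <= eta * (t * a).
Proof. by rewrite mulrA ler_pM2r. Qed.
Let eta1 : eta <= 1 / 2.
Proof. by move: etac c1; lra. Qed.

Let tPsi (y : int) : t * Psi xi t y = t * xi y - `|y|%N%:R * ln (xi y).
Proof. by rewrite /Psi; field; rewrite gt_eqF. Qed.

Let lnxi z : 0 <= ln (xi z). Proof. by rewrite ln_ge0. Qed.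

Lemma xi_le_near (y : int) : `|y|%N%:R <= 2 * K * r -> xi y <= K1 * a.
Proof.
move=> yr; apply: le_trans (xiT y) _; rewrite ler_pdivrMr//.
have -> : K1 * a * t = theta * (2 * K * (r * L)) by rewrite rL /K1 /theta; field.
have mx : Num.max `|y|%N%:R (K * r) <= 2 * K * r.
  by rewrite ge_max yr/=.
have th0 : 0 < theta by rewrite divr_gt0.
by rewrite -mulrA ler_pM2l// (mulrA (2 * K)) ler_pM2r.
Qed.

Let x0_le : x0 <= K1 * a.
Proof. by apply: xi_le_near; rewrite absz_nat; exact: le_trans nr K2. Qed.

Let psi_x0 : psi <= x0.
Proof. by rewrite /psi /Psi lerBlDr lerDl mulr_ge0// divr_ge0// ltW. Qed.

Let ca_x0 : c * a <= x0. Proof. exact: le_trans psi_x0. Qed.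

Let ln_near (y : int) : `|y|%N%:R <= 2 * K * r -> ln (xi y) <= 2 * L.
Proof.
move=> /xi_le_near h; apply: le_trans l1; rewrite ler_ln// posrE//.
exact: lt_le_trans (xip y) h.
Qed.

(** By [l2] each step of the direct path has probability at least [1 / x0], so the [n] steps cost at
    most the penalty [n ln x0] contained in [t * psi]. The travelling time (through [rho * x0]) and
    the factor [expR (- (2 * t))] each cost at most half of [zeta * (t * a)]. *)
Lemma uFK_ge_psi :
  ((expR (t * psi - zeta * (t * a)))%:E <= uFK P tau eps xi t n%:Z)%E.
Proof.
have rho1 : rho < 1.
  by rewrite /rho ltr_pdivrMr ?mulr_gt0//; move: eta1 K0; lra.
apply: le_trans (uFK_lower ind tauP epsP (fun z => ltW (xip z)) t0 n0 rhop rho1).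
rewrite lee_fin -/x0.
have rt : 0 < rho * t by rewrite mulr_gt0.
have den : 0 < n%:R + 2 * (rho * t) by rewrite addr_gt0 ?ltr0n// mulr_gt0.
have q : x0^-1 <= rho * t / (n%:R + 2 * (rho * t)).
  rewrite -[leRHS]invf_div lef_pV2 ?posrE ?divr_gt0// ?xip//.
  rewrite ler_pdivrMr//.
  have h : K * a / (rho * L) + 2 <= x0 by exact: le_trans ca_x0.
  have : (K * a / (rho * L) + 2) * (rho * t) <= x0 * (rho * t) by rewrite ler_pM2r.
  have -> : (K * a / (rho * L) + 2) * (rho * t) = K * (t * a / L) + 2 * (rho * t).
    by field; rewrite !gt_eqF.
  by rewrite -rL mulfK ?gt_eqF//; move: nr; lra.
have -> : t * psi = t * x0 - n%:R * ln x0 by rewrite /psi tPsi absz_nat.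
apply: (@le_trans _ _ (expR (- (n%:R * ln x0)) * expR (- (2 * t)) *
    expR (x0 * ((1 - rho) * t)))).
  rewrite -!expRD ler_expR.
  have h1 : rho * x0 <= zeta / 2 * a.
    have -> : zeta / 2 * a = rho * (K1 * a).
      by rewrite /zeta /rho /K1; field; rewrite gt_eqF.
    by rewrite ler_pM2l.
  move: (ler_wpM2l (ltW t0) h1) (ler_wpM2l (ltW t0) l3).
  by lra.
rewrite ler_pM2r ?expR_gt0// ler_pM2r ?expR_gt0//.
rewrite expRN expR_ln_natM; last exact: xip.
rewrite -exprVn lerXn2r ?nnegrE ?invr_ge0 ?divr_ge0 ?(ltW rt) ?(ltW den) ?(ltW (xip _))//.
Qed.

(* [expR (- cost m)] bounds the probability of [m] jumps before [t]; [level m] is the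
   potential with which [m] jumps would reach the height [psi - 2 zeta a]. *)
Definition cost (m : nat) : R :=
  if m%:R <= nu * r then 0 else m%:R * ln (m%:R / (C * t)).

Definition level (m : nat) : R :=
  if m%:R < 2 * K * r then psi - 2 * zeta * a + cost m / t
  else theta * m%:R * L / t.

Definition horizon : nat := (Num.truncn (2 * K * r)).+1.
Definition reach : nat := (n + (Num.truncn (delta * r)).+1)%N.

Let peak := expR (t * psi - 2 * zeta * (t * a)).

(** Below [2 K r] jumps the tail bound cancels [cost m] and leaves [peak]; the factor
    [2 ^+ horizon * 2^-1 ^+ m] is then at least 1 and merely gives both ranges the same shape.
    Beyond, [l7] makes the base of the [m]-th power at most one half. *)
Lemma jump_level m :
  (P [set w | (jump_time tau m w <= t)%R] * (expR (t * level m))%:E <=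
   (peak * 2 ^+ horizon * 2^-1 ^+ m)%:E)%E.
Proof.
have mP : measurable [set w | jump_time tau m w <= t].
  by apply: measurable_set_le => //; exact: (measurable_jump ind).
have hz : 2 * K * r <= horizon%:R by apply: ltW; exact: truncnS_gt.
have peak1 : 1 <= peak.
  rewrite -expR0 ler_expR.
  have h1 : 2 * zeta <= c by move: zeta_eta etac zetap c0; lra.
  have : 2 * zeta * (t * a) <= c * (t * a) by rewrite ler_pM2r.
  have : t * (c * a) <= t * psi by rewrite ler_pM2l.
  by lra.
rewrite /level; case: ltP => mK.
  have m1 : 1 <= 2 ^+ horizon * 2^-1 ^+ m :> R.
    rewrite exprVn -ler_pdivrMr ?invr_gt0 ?exprn_gt0// invrK mul1r.
    rewrite ler_eXn2l ?ltr1n//.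
    by rewrite -(ler_nat R); apply: ltW; exact: lt_le_trans mK hz.
  apply: (@le_trans _ _ peak%:E); last first.
    by rewrite lee_fin -mulrA ler_peMr// expR_ge0.
  have -> : t * (psi - 2 * zeta * a + cost m / t) =
      (t * psi - 2 * zeta * (t * a)) + cost m by field; rewrite gt_eqF.
  rewrite expRD EFinM muleCA -[leRHS]mule1 -/peak; apply: lee_wpmul2l.
    by rewrite lee_fin expR_ge0.
  rewrite /cost; case: (leP m%:R (nu * r)) => mnu.
    by rewrite expR0 mule1 probability_le1.
  have m0' : 0 < m%:R :> R by apply: lt_trans mnu; rewrite mulr_gt0.
  have m0 : (0 < m)%N by rewrite -(ltr0n R).
  have Ct : 0 < C * t by rewrite mulr_gt0.
  rewrite expR_ln_natM ?divr_gt0//.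
  apply: (@le_trans _ _ (((C * t / m%:R) ^+ m)%:E * ((m%:R / (C * t)) ^+ m)%:E)%E).
    apply: lee_wpmul2r; first by rewrite lee_fin exprn_ge0// divr_ge0// ltW.
    exact: (jump_time_tail ind tauP).
  rewrite -EFinM -exprMn_comm; last exact: mulrC.
  rewrite (_ : C * t / m%:R * (m%:R / (C * t)) = 1) ?expr1n//.
  by field; rewrite !gt_eqF.
have m0' : 0 < m%:R :> R by apply: lt_le_trans mK; rewrite !mulr_gt0.
have m0 : (0 < m)%N by rewrite -(ltr0n R).
have -> : t * (theta * m%:R * L / t) = m%:R * (theta * L) by field; rewrite gt_eqF.
rewrite expRM_natl.
apply: (@le_trans _ _ (((C * t / m%:R) ^+ m)%:E * (expR (theta * L) ^+ m)%:E)%E).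
  apply: lee_wpmul2r; first by rewrite lee_fin exprn_ge0// expR_ge0.
  exact: (jump_time_tail ind tauP).
rewrite -EFinM -exprMn_comm; last exact: mulrC.
apply: (@le_trans _ _ (2^-1 ^+ m)%:E).
  rewrite lee_fin lerXn2r ?nnegrE ?mulr_ge0 ?expR_ge0 ?invr_ge0 ?(ltW t0) ?(ltW Cp)//.
  rewrite mulrAC ler_pdivrMr//.
  have : C * t * expR (theta * L) <= K * r.
    rewrite -(ler_pM2r L0) -[leRHS]mulrA rL.
    by have := ler_wpM2r (ltW t0) l7; lra.
  by move: mK; lra.
rewrite lee_fin ler_peMl ?exprn_ge0//.
by rewrite mulr_ege1// exprn_ege1// ler1n.
Qed.

(** The geometric series sums to [peak] times [2 ^+ horizon.+1], which is [exp(O(r))]; by [l8] one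
    of the two margins [zeta * (t * a)] in [peak] pays for it and for [kap]. *)
Lemma jump_series_level :
  (jump_series P tau t level <= (kap * expR (t * psi - zeta * (t * a)))%:E)%E.
Proof.
apply: (@le_trans _ _ (\sum_(m <oo) (peak * 2 ^+ horizon * 2^-1 ^+ m)%:E)%E).
  apply: lee_nneseries => m _; last exact: jump_level.
  by move=> _; rewrite mule_ge0// lee_fin expR_ge0.
apply: le_trans (nneseries_half _) _.
  by rewrite mulr_ge0 ?expR_ge0// exprn_ge0.
rewrite lee_fin -[in leRHS](lnK kap0) -expRD.
rewrite mulrCA -exprS -(@expR_ln_natM _ 2)// -expRD ler_expR.
have ln2 : ln (2 : R) <= 1.
  by have := @le_ln1Dx R 1; rewrite -[1 + 1]/2; apply; lra.
have hz : horizon%:R <= 2 * K * r + 1.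
  by rewrite /horizon -natr1 lerD2r truncn_le//; exact: le_trans (ltW Krp) K2.
have : horizon.+1%:R * ln 2 <= 2 * K * r + 2.
  apply: (@le_trans _ _ (horizon.+1%:R * 1)); first by rewrite ler_pM2l.
  by rewrite mulr1 -natr1; move: hz; lra.
by move: l8; rewrite rL; lra.
Qed.

(** Since [|y| <= m], the gap gives [t xi(y) <= t psi - eta t a + m ln(xi(y))] off the two sites,
    and the last term is nearly compensated by [cost m]. At the two sites there is no gap, but
    [reach] jumps exceed the necessary [n] by [delta r], and every surplus jump costs about
    [ln x0]. *)
Lemma level_ge m y : (`|y| <= m)%N -> ~~ twin n y || (reach <= m)%N ->
  xi y <= level m.
Proof.
rewrite -(ler_nat R) => ym yp; rewrite /level; case: ltP => mK; last first.
  apply: le_trans (xiT y) _; rewrite ler_pM2r ?invr_gt0//.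
  rewrite ler_pM2r//; rewrite ler_pM2l ?divr_gt0//.
  by rewrite ge_max ym/=; exact: le_trans K2 mK.
have yK : `|y|%N%:R <= 2 * K * r by apply: le_trans ym _; exact: ltW.
rewrite -(ler_pM2l t0).
have -> : t * (psi - 2 * zeta * a + cost m / t) =
    t * psi - 2 * zeta * (t * a) + cost m by field; rewrite gt_eqF.
(* The difference is [m ln(xi(z) C t / m)]. For [m] above [nu r] the argument is of order [L], so
   with [m] below [2 K r] the product is at most of order [r ln L], negligible against
   [r L = t a]. *)
have mlog : nu * r < m%:R -> forall z : int, `|z|%N%:R <= 2 * K * r ->
    m%:R * ln (xi z) - cost m <= zeta * (t * a).
  move=> mnu z zK; rewrite /cost (leNgt m%:R) mnu /= -mulrBr.
  have m0' : 0 < m%:R :> R by apply: lt_trans mnu; rewrite mulr_gt0.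
  have Ct : 0 < C * t by rewrite mulr_gt0.
  rewrite -ln_div ?posrE ?divr_gt0//.
  have arg : xi z / (m%:R / (C * t)) <= K1 * C * L / nu.
    rewrite invf_div mulrA ler_pdivrMr//.
    apply: (@le_trans _ _ (K1 * a * (C * t))).
      by rewrite ler_pM2r// xi_le_near.
    apply: (@le_trans _ _ (K1 * C * L / nu * (nu * r))).
      have -> : K1 * C * L / nu * (nu * r) = K1 * C * (r * L) by field; rewrite gt_eqF.
      by rewrite rL le_eqVlt; apply/orP; left; apply/eqP; ring.
    rewrite ler_pM2l ?(ltW mnu)// divr_gt0// !mulr_gt0//.
  have lnarg : ln (xi z / (m%:R / (C * t))) <= ln (K1 * C * L / nu).
    by rewrite ler_ln ?posrE// ?divr_gt0 ?mulr_gt0// ?divr_gt0// ?mulr_gt0.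
  apply: (@le_trans _ _ (m%:R * ln (K1 * C * L / nu))); first by rewrite ler_pM2l.
  apply: (@le_trans _ _ (2 * K * r * ln (K1 * C * L / nu))).
    by rewrite ler_wpM2r// ltW.
  have -> : zeta * (t * a) = r * (zeta * L) by rewrite -rL; ring.
  have -> : 2 * K * r * ln (K1 * C * L / nu) = r * (2 * K * ln (K1 * C * L / nu)) by ring.
  by rewrite ler_pM2l.
have etata : 0 < eta * (t * a) by rewrite mulr_gt0.
have [tw|ntw] := boolP (twin n y); last first.
  have g : t * xi y - `|y|%N%:R * ln (xi y) <= t * psi - t * (eta * a).
    by rewrite -tPsi -mulrBr ler_pM2l// gap.
  have lnm : `|y|%N%:R * ln (xi y) <= m%:R * ln (xi y) by rewrite ler_wpM2r.
  have [mnu|mnu] := leP m%:R (nu * r).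
    have -> : cost m = 0 by rewrite /cost mnu.
    have : m%:R * ln (xi y) <= nu * r * (2 * L).
      by apply: ler_pM => //; exact: ln_near.
    have -> : nu * r * (2 * L) = eta / 8 * (t * a) by rewrite -rL /nu; field.
    by move: g lnm zeta_ta etata; lra.
  by have := mlog mnu y yK; move: g lnm zeta_ta etata; lra.
rewrite tw /= in yp.
(* The surplus [delta * r], at a price of at least [beta / 2 * L] per jump, is worth
   [4 * (zeta * (t * a))]; three are left after [mlog], and two are needed. *)
have mr : n%:R + delta * r <= m%:R.
  apply: (@le_trans _ _ reach%:R); last by rewrite ler_nat.
  by rewrite /reach natrD lerD2l; apply: ltW; exact: truncnS_gt.
have xy : xi y = x0.
  by case/orP: tw => /eqP ->.
have mnu : nu * r < m%:R.
  have : 0 <= n%:R :> R by [].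
  have : 0 < eta * r by rewrite mulr_gt0.
  by move: mr; rewrite /delta /nu; lra.
have nK : `|n%:Z|%N%:R <= 2 * K * r by rewrite absz_nat; exact: le_trans nr K2.
have := mlog mnu n%:Z nK; rewrite -/x0 xy.
have -> : t * psi = t * x0 - n%:R * ln x0 by rewrite /psi tPsi absz_nat.
have : (n%:R + delta * r) * ln x0 <= m%:R * ln x0 by rewrite ler_wpM2r// lnxi.
have : delta * r * (beta / 2 * L) <= delta * r * ln x0.
  rewrite ler_pM2l ?mulr_gt0 ?divr_gt0//; apply: le_trans l6 _.
  by rewrite ler_ln ?posrE ?mulr_gt0//; exact: xip.
have -> : delta * r * (beta / 2 * L) = 4 * (zeta * (t * a)).
  by rewrite -rL /delta /zeta; field.
have : 0 < zeta * (t * a) by rewrite mulr_gt0.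
by lra.
Qed.

(** Turns the gap of [Psi] into a gap of the potential: for sites at most [delta r + 1] farther than
    [n] the distance penalty grows by at most [eta * a / 2], which is how [delta] was chosen. *)
Lemma near_gap y : (`|y| < reach)%N -> ~~ twin n y -> xi y <= x0 - eta * a / 2.
Proof.
rewrite /reach => yR ntw.
have yn : `|y|%N%:R <= n%:R + delta * r + 1.
  apply: (@le_trans _ _ (n + (Num.truncn (delta * r)))%:R).
    by rewrite ler_nat -ltnS -addnS.
  have : (Num.truncn (delta * r))%:R <= delta * r.
    by rewrite truncn_le mulr_ge0 ?divr_ge0 ?(ltW eta0) ?(ltW rp).
  by rewrite natrD; lra.
have yK : `|y|%N%:R <= 2 * K * r.
  have : eta * r <= 1 / 2 * r by rewrite ler_pM2r.
  have : 1 * r <= K * r by rewrite ler_pM2r.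
  by move: yn nr l9; rewrite /delta; lra.
have nK : `|n%:Z|%N%:R <= 2 * K * r by rewrite absz_nat; exact: le_trans nr K2.
have g := gap yK ntw; rewrite /psi /Psi absz_nat -/x0 in g.
have lnx0 : ln x0 <= 2 * L by exact: ln_near nK.
have lnx00 : 0 <= ln x0 by exact: lnxi.
have extra : (`|y|%N%:R - n%:R) / t * ln x0 <= eta * a / 2.
  apply: (@le_trans _ _ ((delta * r + 1) / t * (2 * L))).
    apply: (@le_trans _ _ ((delta * r + 1) / t * ln x0)).
      by rewrite ler_wpM2r// ler_pM2r ?invr_gt0//; lra.
    by rewrite ler_pM2l// divr_gt0// addr_gt0// mulr_gt0// divr_gt0.
  have -> : (delta * r + 1) / t * (2 * L) = eta / 4 * (r * L) / t + 2 * L / t.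
    by rewrite /delta; field; rewrite gt_eqF.
  have -> : eta / 4 * (r * L) / t = eta / 4 * a by rewrite rL; field; rewrite gt_eqF.
  by move: l10; lra.
have [xx|xx] := leP (xi y) x0.
  have : `|y|%N%:R / t * ln (xi y) <= `|y|%N%:R / t * ln x0.
    rewrite ler_wpM2l ?divr_ge0 ?(ltW t0)// ler_ln// posrE; exact: xip.
  by move: extra g; rewrite !mulrBl; lra.
(* The function [u - s ln u] with [s = |y| / t] increases for [u >= s], and [s <= x0]. So
   [xi y > x0] would put [Psi] at [y] within [eta * a / 2] of its maximum. *)
exfalso.
have sx : `|y|%N%:R / t <= x0.
  apply: le_trans ca_x0; apply: le_trans l11; rewrite ler_pdivrMr//.
  have -> : 2 * K * a / L * t = 2 * K * (t * a / L) by ring.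
  by rewrite -rL mulfK ?gt_eqF.
have x0p : 0 < x0 by exact: xip.
have yp : 0 < xi y by exact: xip.
have lnd : ln (xi y) - ln x0 <= (xi y - x0) / x0.
  rewrite -ln_div ?posrE//; apply: le_trans (ln_le_subr1 _) _.
    by rewrite divr_gt0.
  by rewrite mulrBl divff ?gt_eqF.
have s0 : 0 <= `|y|%N%:R / t by rewrite divr_ge0// ltW.
have : `|y|%N%:R / t * (ln (xi y) - ln x0) <= xi y - x0.
  apply: le_trans (ler_wpM2l s0 lnd) _.
  rewrite mulrCA -[leRHS]mulr1 ler_pM2l ?subr_gt0//.
  by rewrite ler_pdivrMr// mul1r.
have : 0 < eta * a by rewrite mulr_gt0.
by move: extra g; rewrite !mulrBl mulrBr; lra.
Qed.

End deterministic_estimates.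

(** * Asymptotic conditions on [t], and localisation uniformly over potentials *)

Lemma thresholds (R : realDomainType) (s : seq R) : exists L0 : R,
  forall L, L0 <= L -> all (fun x => x <= L) s.
Proof.
elim: s => [|x s [L0 IH]]; first by exists 0.
exists (Num.max x L0) => L; rewrite ge_max => /andP[xL /IH sL] /=.
by rewrite xL.
Qed.

Lemma expR_ge_sqr2 (R : realType) (x : R) : 0 <= x -> x ^+ 2 / 2 <= expR x.
Proof.
move=> x0; apply: le_trans (@expR_ge1Dxn R x 1 x0).
by rewrite lerDr.
Qed.

(** Everything follows from [a] being at least [expR (beta * L)]: it beats any fixed multiple of
    [L], the quadratic bound on the exponential being enough. The threshold depends on the constants
    only. *)
Lemma regime_thresholds (R : realType) (beta c K eta kap g0 : R) :
  0 < beta -> beta <= 1 -> 0 < c -> c <= 1 -> 1 <= K -> 0 < eta -> 0 < kap ->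
  let C := 5 * expR 1 in let theta := beta / 8 in let K1 := beta * K / 4 in
  let nu := eta / 16 in let zeta := eta * beta / 64 in let rho := eta / (32 * K) in
  exists2 L0 : R, 0 < L0 & forall t L a r : R, 0 < t -> ln t = L -> L0 <= L ->
    0 < a -> beta * L <= ln a -> ln a <= L -> r * L = t * a ->
  [/\ ln (K1 * a) <= 2 * L, K * a / (rho * L) + 2 <= c * a, 4 <= zeta * a,
      C * L <= nu * a & 0 <= ln (K1 * C * L / nu)] /\
  [/\ 2 * K * ln (K1 * C * L / nu) <= zeta * L, beta / 2 * L <= ln (c * a),
      C * L * expR (theta * L) <= K * a,
      2 * K * r + 2 - ln kap <= zeta * (r * L) & 2 <= r] /\
  [/\ 2 * L / t <= eta / 4 * a, 2 * K * a / L <= c * a & g0 <= eta * a / 2].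
Proof.
move=> b0 b1 c0 c1 K0 e0 k0 C theta K1 nu zeta rho.
have Kp : 0 < K by exact: lt_le_trans K0.
have Cp : 0 < C by rewrite mulr_gt0// expR_gt0.
have nup : 0 < nu by rewrite divr_gt0.
have zetap : 0 < zeta by rewrite divr_gt0// mulr_gt0.
have K1p : 0 < K1 by rewrite divr_gt0// mulr_gt0.
have rhop : 0 < rho by rewrite divr_gt0// mulr_gt0.
pose D := K1 * C / nu; have Dp : 0 < D by rewrite divr_gt0// mulr_gt0.
pose ep := zeta / (4 * K); have epp : 0 < ep by rewrite divr_gt0// mulr_gt0.
pose X := 4 / c + 4 / zeta + 2 + 8 / eta + `|2 * g0 / eta|.
have [L0 HL] := thresholds [:: ln K1; 2 * K / (rho * c); X / beta;
  2 * C / (nu * beta ^+ 2); D^-1; 4 * K * ln (D / ep) / zeta; - 2 * ln c / beta;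
  4 * C / (K * beta ^+ 2); (2 * K + 2 + `|ln kap|) / zeta; 2 * K / c; 1].
exists (Num.max L0 1); first by rewrite lt_max ltr01 orbT.
move=> t L a r t0 tL; rewrite ge_max => /andP[/HL + L1] a0 aL1 aL2 rL.
move=> /= /and5P[h1 h2 h3 h4 /and5P[h5 h6 h7 h8 /and4P[h9 h10 _ _]]].
have L0' : 0 < L by exact: lt_le_trans L1.
have tE : t = expR L by rewrite -tL lnK.
have Lt : L <= t.
  by rewrite tE; apply: le_trans (expR_ge1Dx L); rewrite lerDr.
have aE : expR (beta * L) <= a by rewrite -[leRHS]lnK// ler_expR.
have aX : X <= a.
  apply: le_trans aE; apply: le_trans (expR_ge1Dx _).
  by rewrite ler_pdivrMr// mulrC in h3; apply: le_trans h3 _; rewrite lerDr.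
have [a1 a2 a3 a4 a5] : [/\ 4 / c <= a, 4 / zeta <= a, 2 <= a, 8 / eta <= a &
    2 * g0 / eta <= a].
  have x1 : 0 < 4 / c by rewrite divr_gt0.
  have x2 : 0 < 4 / zeta by rewrite divr_gt0.
  have x3 : 0 < 8 / eta by rewrite divr_gt0.
  have x4 : 0 <= `|2 * g0 / eta| by [].
  have x5 : 2 * g0 / eta <= `|2 * g0 / eta| by exact: ler_norm.
  move: aX; rewrite /X; split; lra.
have asq : beta ^+ 2 * L ^+ 2 / 2 <= a.
  apply: le_trans aE; rewrite -exprMn; apply: expR_ge_sqr2.
  by rewrite mulr_ge0// ltW.
have ra : a <= r.
  by rewrite -(ler_pM2r L0') rL mulrC ler_pM2r.
have rp : 0 < r by exact: lt_le_trans ra.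
have DL : K1 * C * L / nu = D * L by rewrite /D; ring.
split; [split|split; split].
- rewrite lnM ?posrE//; lra.
- have h : K / (rho * L) <= c / 2.
    have rc : 0 < rho * c by exact: mulr_gt0.
    have rl : 0 < rho * L by exact: mulr_gt0.
    have h2' : 2 * K <= L * (rho * c) by rewrite -ler_pdivrMr.
    by rewrite ler_pdivrMr//; lra.
  have := ler_wpM2r (ltW a0) h.
  rewrite ler_pdivrMr// in a1.
  have -> : K / (rho * L) * a = K * a / (rho * L) by ring.
  lra.
- by rewrite ler_pdivrMr// mulrC in a2.
- apply: (@le_trans _ _ (nu * (beta ^+ 2 * L ^+ 2 / 2))); last by rewrite ler_pM2l.
  have nb : 0 < nu * beta ^+ 2 by apply: mulr_gt0 => //; exact: exprn_gt0.
  have h4' : 2 * C <= L * (nu * beta ^+ 2) by rewrite -ler_pdivrMr.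
  have := ler_wpM2r (ltW L0') h4'; rewrite (expr2 L); lra.
- rewrite DL ln_ge0//.
  by rewrite -(ler_pM2l Dp) mulfV ?gt_eqF// in h5.
(* Scaling by [ep] before using [ln x <= x] leaves half of [zeta * L] for [2 K ln(ep L)] and the
   other half for the constant. *)
- have -> : K1 * C * L / nu = (D / ep) * (ep * L).
    by rewrite /D; field; rewrite !gt_eqF.
  have Dep : 0 < D / ep by exact: divr_gt0.
  have epL : 0 < ep * L by exact: mulr_gt0.
  rewrite lnM ?posrE//.
  have g1 : ln (ep * L) <= ep * L by apply: ltW; exact: ln_sublinear.
  have g2 : 2 * K * (ep * L) = zeta / 2 * L.
    by rewrite /ep; field; rewrite gt_eqF.
  rewrite ler_pdivrMr// in h6.
  have := ler_wpM2l (ltW Kp) g1; lra.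
- rewrite lnM ?posrE//; rewrite ler_pdivrMr// in h7; lra.
(* As [theta = beta / 8], the lower bound on [a] splits as [expR (theta * L)] times
   [expR (7 / 8 * (beta * L))], and the second factor absorbs [C * L]. *)
- have x0 : 0 <= 7 / 8 * (beta * L) by rewrite mulr_ge0// mulr_ge0// ltW.
  have ee : expR (theta * L) * expR (7 / 8 * (beta * L)) <= a.
    by rewrite -expRD (_ : _ + _ = beta * L)// /theta; field.
  have := expR_ge_sqr2 x0 => e2.
  have g1 : C * L <= K * expR (7 / 8 * (beta * L)).
    apply: (@le_trans _ _ (K * ((7 / 8 * (beta * L)) ^+ 2 / 2))); last by rewrite ler_pM2l.
    have nb : 0 < K * beta ^+ 2 by apply: mulr_gt0 => //; exact: exprn_gt0.
    have h8' : 4 * C <= L * (K * beta ^+ 2) by rewrite -ler_pdivrMr.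
    have g2 := ler_wpM2r (ltW L0') h8'.
    have g3 : 0 < C * L by rewrite mulr_gt0.
    have -> : K * ((7 / 8 * (beta * L)) ^+ 2 / 2) = 49 / 128 * (L * (K * beta ^+ 2) * L).
      by rewrite !expr2; field.
    lra.
  apply: (@le_trans _ _ (K * (expR (theta * L) * expR (7 / 8 * (beta * L))))).
    have := ler_wpM2r (expR_ge0 (theta * L)) g1; lra.
  by rewrite ler_pM2l.
- rewrite ler_pdivrMr// in h9.
  have g1 := ler_wpM2l (ltW rp) h9.
  have g2 : - ln kap <= `|ln kap| by rewrite -normrN ler_norm.
  have g3 : `|ln kap| <= r * `|ln kap| by rewrite ler_peMl//; lra.
  lra.
- lra.
- apply: (@le_trans _ _ 2); first by rewrite ler_pdivrMr// ler_pM2l.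
  by rewrite ler_pdivrMr// in a4; lra.
- rewrite ler_pdivrMr// in h10.
  rewrite ler_pdivrMr//; have := ler_wpM2r (ltW a0) h10; lra.
- rewrite ler_pdivrMr// in a5; lra.
Qed.

Section localisation.
Context d (Om : measurableType d) (R : realType) (P : probability Om R).
Variables (tau eps : nat -> Om -> R).
Hypothesis ind : mutually_independent P (clocks tau eps).
Hypothesis tauP : forall k (x : R), 0 <= x ->
  P [set w | x < tau k w] = (expR (- (2 * x)))%:E.
Hypothesis epsP : forall k, P [set w | eps k w = 1] = (1 / 2)%:E.

(** [L0] is fixed before the potential, so one threshold serves all typical potentials. The last
    condition of [regime_thresholds] makes the gap [eta * a / 2] exceed the rate [g0] demanded by
    [late_exit]. *)
Lemma localisation (beta c K eta kap : R) :
  0 < beta -> beta <= 1 -> 0 < c -> c <= 1 -> 1 <= K -> 0 < eta ->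
  eta <= c / 2 -> 0 < kap ->
  exists2 L0 : R, 0 < L0 & forall (xi : int -> R) (t a r : R) (n : nat),
    0 < t -> L0 <= ln t -> 0 < a -> beta * ln t <= ln a -> ln a <= ln t ->
    r * ln t = t * a -> (forall z, 1 <= xi z) -> (0 < n)%N -> n%:R <= K * r ->
    (forall y : int, xi y <= beta / 8 * Num.max `|y|%N%:R (K * r) * ln t / t) ->
    xi (- n%:Z) = xi n%:Z -> c * a <= Psi xi t n%:Z ->
    (forall y : int, `|y|%N%:R <= 2 * K * r -> ~~ twin n y ->
      Psi xi t y <= Psi xi t n%:Z - eta * a) ->
  `| (fine (uFK P tau eps xi t n%:Z) + fine (uFK P tau eps xi t (- n%:Z))) /
      fine (UFK P tau eps xi t) - 1 | <= 2 * kap.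
Proof.
move=> b0 b1 c0 c1 K0 e0 ec k0.
have [g0 g00 exitP] := late_exit ind tauP k0.
have [L0 L0p HL] := regime_thresholds g0 b0 b1 c0 c1 K0 e0 k0.
exists L0 => // xi t a r n t0 L0t a0 aL1 aL2 rL xi1 n0 nr xiT sym psi_ge gap.
have Lp : 0 < ln t by exact: lt_le_trans L0t.
have [[l1 l2 l3 l4 l5] [[l5' l6 l7 l8 l9] [l10 l11 l12]]] :=
  HL t _ a r t0 erefl L0t a0 aL1 aL2 rL.
have xi0 z : 0 <= xi z by exact: le_trans (xi1 z).
apply: (@localisation_ratio _ _ _ _ _ _ ind tauP xi t xi0 t0 n (eta * a / 2) kap
  (expR (t * Psi xi t n%:Z - eta * beta / 64 * (t * a)))
  (level xi t (ln t) a r beta K eta n) (reach r eta n)) => //.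
- exact: ltW.
- exact: expR_gt0.
- by move=> k s s0; exact: exitP.
- move=> m y ym yp; apply: (level_ge (beta := beta) (c := c)) => //.
- move=> y yR ntw; apply: (near_gap (beta := beta) (c := c) (K := K) (t := t) (L := ln t) (r := r)) => //.
- exact: (uFK_ge_psi ind tauP epsP b0 c1 K0 e0 ec t0 Lp rL xi1 n0 nr xiT psi_ge l2 l3 l9).
- exact: (jump_series_level ind tauP b0 b1 c0 K0 e0 ec k0 t0 Lp a0 rL psi_ge l7 l8 l9).
Qed.

End localisation.

(** * Typical potentials *)

Section union_bounds.
Context d (Om : measurableType d) (R : realType) (P : probability Om R).

Lemma le_measure_bigcup (F : nat -> set Om) (b : nat -> R) (B : R) :
  (forall y, measurable (F y)) -> (forall y, 0 <= b y) ->
  (forall y, P (F y) <= (b y)%:E)%E ->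
  (forall M, \sum_(0 <= y < M) b y <= B) ->
  (P (\bigcup_y F y) <= B%:E)%E.
Proof.
move=> mF b0 Fb bB.
apply: le_trans (measure_sigma_subadditive P mF _ (@subset_refl _ _)) _.
  exact: bigcup_measurable.
apply: nneseries_le => // N; apply: (@le_trans _ _ (\sum_(0 <= i < N) (b i)%:E)%E).
  by apply: lee_sum => i _; exact: Fb.
by rewrite sumEFin lee_fin.
Qed.

Lemma le_measure_bigcup_lt (N : nat) (F : nat -> set Om) (b : nat -> R) :
  (forall y, measurable (F y)) -> (forall y, 0 <= b y) ->
  (forall y, (y < N)%N -> P (F y) <= (b y)%:E)%E ->
  (P (\bigcup_(y in [set y | (y < N)%N]) F y) <= (\sum_(y < N) b y)%:E)%E.
Proof.
move=> mF b0 Fb; rewrite bigcup_mkcond.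
apply: (le_measure_bigcup (b := fun y => if (y < N)%N then b y else 0)).
- by move=> y; case: ifP.
- by move=> y; case: ifP.
- move=> y; case: (boolP (y < N)%N) => yN.
    by rewrite mem_set//; exact: Fb.
  by rewrite memNset ?measure0//; exact/negP.
move=> M; rewrite -big_mkcond /= -(big_mkord xpredT b) /=.
have [NM|MN] := leqP N M.
  rewrite [leRHS](big_nat_widen _ _ _ _ _ NM) /= le_eqVlt; apply/orP; left; apply/eqP.
  by apply: eq_bigl => i.
rewrite [leRHS](@big_cat_nat _ _ _ M)//=; last exact: ltnW.
apply: (@le_trans _ _ (\sum_(0 <= i < M) b i)).
  by rewrite big_mkcond /=; apply: ler_sum => i _; case: ifP.
by rewrite lerDl sumr_ge0.
Qed.

Lemma measureU_le (A B : set Om) (x y : R) : measurable A -> measurable B ->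
  (P A <= x%:E)%E -> (P B <= y%:E)%E -> (P (A `|` B) <= (x + y)%:E)%E.
Proof.
move=> mA mB Ax By; rewrite EFinD; apply: le_trans (measureU2 P mA mB) _.
exact: leeD.
Qed.

End union_bounds.

Section pareto_potential.
Context (R : realType) (alpha : R) d (Om : measurableType d) (P : probability Om R).
Variables (p : nat -> R) (xi0 : int -> Om -> R) (C : nat -> Om -> R).
Hypothesis alpha2 : 2 <= alpha.
Hypothesis p01 : forall n, 0 <= p n <= 1.
Hypothesis ind : mutually_independent P (pot_family xi0 C).
Hypothesis pareto : forall z (x : R), 1 <= x ->
  P [set w | x < xi0 z w] = (x `^ (- alpha))%:E.
Hypothesis coin1 : forall n, P [set w | C n w = 1] = (p n.+1)%:E.

Lemma measurable_xi0 z : measurable_fun setT (xi0 z).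
Proof. exact: (ind.1 (inl z)). Qed.

Lemma measurable_coin n : measurable_fun setT (C n).
Proof. exact: (ind.1 (inr n)). Qed.

Lemma measurable_xi0_gt z (x : R) : measurable [set w | x < xi0 z w].
Proof. by apply: measurable_set_lt => //; exact: measurable_xi0. Qed.

Lemma measurable_xi0_le z (x : R) : measurable [set w | xi0 z w <= x].
Proof. by apply: measurable_set_le => //; exact: measurable_xi0. Qed.

Lemma pot_indep2 (i j : int + nat) (A B : set R) : i != j ->
  measurable A -> measurable B ->
  P ((pot_family xi0 C i @^-1` A) `&` (pot_family xi0 C j @^-1` B)) =
  (P (pot_family xi0 C i @^-1` A) * P (pot_family xi0 C j @^-1` B))%E.
Proof.
move=> ij mA mB.
have := ind.2 [:: i; j] _ (fun k => if k == i then A else B).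
rewrite !big_cons !big_nil setIT mule1 eqxx eq_sym (negPf ij); apply.
  by rewrite /= inE ij.
by move=> k; case: ifP.
Qed.

Lemma xi0_le_prob z (x : R) : 1 <= x ->
  P [set w | xi0 z w <= x] = (1 - x `^ (- alpha))%:E.
Proof.
move=> x1; have -> : [set w | xi0 z w <= x] = ~` [set w | x < xi0 z w].
  by apply/seteqP; split=> w /=; rewrite leNgt => /negP.
by rewrite probability_setC ?pareto//; exact: measurable_xi0_gt.
Qed.

Lemma xi0_all_le (Y : nat) (x : R) : 1 <= x ->
  P (\bigcap_(y in [set y | (y < Y)%N]) [set w | xi0 y.+1%:Z w <= x]) =
  ((1 - x `^ (- alpha)) ^+ Y)%:E.
Proof.
move=> x1; rewrite bigcap_mkord.
pose F : seq (int + nat) := [seq inl y.+1%:Z | y <- iota 0 Y].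
have uF : uniq F by rewrite map_inj_uniq ?iota_uniq// => i j [].
have mB : forall i : int + nat, measurable (`]-oo, x]%classic : set R) by [].
have := ind.2 F uF (fun=> `]-oo, x]%classic) mB.
rewrite /F !big_map -[X in iota 0 X]subn0 -/(index_iota 0 Y) !big_mkord => H.
transitivity (P (\big[setI/setT]_(i < Y) (pot_family xi0 C (inl i.+1%:Z) @^-1` `]-oo, x]%classic))).
  congr (P _); apply: eq_bigr => i _; apply/seteqP; split=> w; rewrite /preimage /= in_itv//=.
rewrite H.
have -> : forall n, (\big[*%E/1%E]_(i < n) P (pot_family xi0 C (inl i.+1%:Z) @^-1` `]-oo, x]%classic) =
    ((1 - x `^ (- alpha)) ^+ n)%:E)%E.
  elim=> [|n IH]; first by rewrite big_ord0 expr0.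
  rewrite big_ord_recr /= IH exprSr EFinM; congr (_ * _)%E.
  by rewrite -(xi0_le_prob n.+1%:Z x1); congr (P _).
by [].
Qed.

(** A difference of two tails, bounded through [1 - exp(-x) <= x] and [ln (1 + h / l) <= h / l]; it
    stands in for the density at [l] times [h]. *)
Lemma pareto_interval z (l h : R) : 1 <= l -> 0 <= h ->
  (P [set w | (l < xi0 z w) && (xi0 z w <= l + h)]%R <=
   (l `^ (- alpha) * (alpha * (h / l)))%:E)%E.
Proof.
move=> l1 h0; have l0 : 0 < l by exact: lt_le_trans l1.
have lh1 : 1 <= l + h by rewrite (le_trans l1)// lerDl.
have mxi := measurable_xi0 z.
have mI : measurable [set w | (l < xi0 z w) && (xi0 z w <= l + h)].
  by apply: measurable_bool_set; apply: measurable_and;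
    [apply: (@measurable_fun_ltr _ _ R)|apply: (@measurable_fun_ler _ _ R)].
have : P [set w | l < xi0 z w] =
    (P [set w | (l < xi0 z w) && (xi0 z w <= l + h)]%R + P [set w | l + h < xi0 z w]%R)%E.
  rewrite -measureU//; first last.
  - by rewrite -subset0 => w /= [/andP[_ wy]]; rewrite ltNge wy.
  - exact: measurable_xi0_gt.
  congr (P _); apply/seteqP; split=> w /=.
    by move=> xw; have [h'|h'] := leP (xi0 z w) (l + h); [left; rewrite xw|right].
  by move=> [/andP[]//|]; apply: le_lt_trans; rewrite lerDl.
rewrite !pareto//.
have : P [set w | (l < xi0 z w) && (xi0 z w <= l + h)] \is a fin_num by exact: fin_num_measure.
case: (P [set w | (l < xi0 z w) && (xi0 z w <= l + h)]) => // b _ /eqP.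
rewrite -EFinD eqe => /eqP bE; rewrite lee_fin.
have -> : b = l `^ (- alpha) - (l + h) `^ (- alpha) by rewrite bE addrK.
have -> : l + h = l * (1 + h / l) by rewrite mulrDr mulr1 mulrCA divff ?mulr1// gt_eqF.
have hl : 0 <= h / l by rewrite divr_ge0// ltW.
have hl1 : 0 < 1 + h / l by rewrite ltr_pwDl.
rewrite powRM ?(ltW l0) ?(ltW hl1)//.
rewrite -[X in X - _]mulr1 -mulrBr ler_pM2l ?powR_gt0//.
rewrite /powR gt_eqF//.
have := expR_ge1Dx (- alpha * ln (1 + h / l)).
have : ln (1 + h / l) <= h / l by apply: le_ln1Dx; apply: lt_le_trans hl; rewrite ltrN10.
have a0 : 0 <= alpha by apply: le_trans alpha2.
move=> g; have := ler_wpM2l a0 g; lra.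
Qed.

Lemma coin_prob n (A : set R) z : measurable A ->
  P ([set w | C n w <> 1] `&` (xi0 z @^-1` A)) =
  ((1 - p n.+1)%:E * P (xi0 z @^-1` A))%E.
Proof.
move=> mA; have m1 : measurable (~` [set 1] : set R).
  by apply: measurableC; exact: measurable_set1.
have := @pot_indep2 (inr n) (inl z) (~` [set 1]) A isT m1 mA.
rewrite /= => ->; congr (_ * _)%E; rewrite -preimage_setC probability_setC.
  by rewrite (_ : _ @^-1` _ = [set w | C n w = 1])// coin1.
by rewrite -[_ @^-1` _]setTI; apply: measurable_coin.
Qed.

End pareto_potential.

(** * Height and distance scales *)

Section scales.
Context (R : realType) (alpha t : R).
Hypotheses (alpha2 : 2 <= alpha) (t0 : 0 < t) (L1 : 1 <= ln t).
Let L := ln t.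

Definition height : R := expR ((ln t - ln (ln t)) / (alpha - 1)).
Definition reach_scale : R := t * height / ln t.
(** A power of [t] lying below [a]: half the exponent [1 / (alpha - 1)], the other half paying for
    the logarithmic correction in [a]. *)
Definition rate : R := 1 / (2 * (alpha - 1)).

Let L0 : 0 < L. Proof. exact: lt_le_trans L1. Qed.
Let alpha1 : 1 <= alpha - 1. Proof. by move: alpha2; lra. Qed.
Let alpha0 : 0 < alpha - 1. Proof. exact: lt_le_trans alpha1. Qed.

Lemma height_gt0 : 0 < height. Proof. exact: expR_gt0. Qed.

Lemma reach_scale_ln : reach_scale * ln t = t * height.
Proof. by rewrite /reach_scale divfK// gt_eqF. Qed.

Let lnh : ln height = (L - ln L) / (alpha - 1). Proof. by rewrite expRK. Qed.

Lemma ln_height_le : ln height <= ln t.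
Proof.
rewrite lnh ler_pdivrMr//; have : 0 <= ln L by rewrite ln_ge0.
have : L * 1 <= L * (alpha - 1) by rewrite ler_pM2l.
rewrite -/L; lra.
Qed.

Lemma ln_height_ge : rate * ln t <= ln height.
Proof.
rewrite lnh ler_pdivlMr// /rate -/L.
have -> : 1 / (2 * (alpha - 1)) * L * (alpha - 1) = L / 2 by field; rewrite gt_eqF.
have : ln (L / 2) <= L / 2 - 1 by apply: ln_le_subr1; rewrite divr_gt0.
have : ln (2 : R) <= 2 - 1 by exact: ln_le_subr1.
rewrite ln_div ?posrE//; lra.
Qed.

Lemma height_ge : rate * ln t <= height.
Proof.
apply: le_trans ln_height_ge _; apply: ltW; exact: (ln_sublinear height_gt0).
Qed.

Lemma height_reach_scale : height <= reach_scale.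
Proof.
rewrite /reach_scale -mulrA mulrCA ler_peMr ?(ltW height_gt0)// ler_pdivlMr// mul1r.
by apply: ltW; exact: ln_sublinear.
Qed.

Lemma reach_scale_gt0 : 0 < reach_scale. Proof. exact: lt_le_trans height_gt0 height_reach_scale. Qed.

(** The equation that fixes [a]: a site exceeds height [a] with probability [1 / r], so a box of
    radius [r] holds boundedly many such sites on average. *)
Lemma powR_height : height `^ (- alpha) = reach_scale^-1.
Proof.
rewrite /powR gt_eqF ?height_gt0// lnh.
rewrite -[RHS]lnK ?posrE ?invr_gt0 ?reach_scale_gt0//; congr expR.
rewrite lnV ?posrE ?reach_scale_gt0// /reach_scale ln_div ?posrE ?mulr_gt0 ?height_gt0//.
rewrite lnM ?posrE ?height_gt0// lnh -/L; field; exact: lt0r_neq0.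
Qed.

Lemma powRM_height (x : R) : 0 <= x -> (x * height) `^ (- alpha) = x `^ (- alpha) / reach_scale.
Proof. by move=> x0; rewrite powRM// ?powR_height// ltW// height_gt0. Qed.

Lemma rate_gt0 : 0 < rate. Proof. by rewrite divr_gt0// mulr_gt0. Qed.

Lemma rate_le1 : rate <= 1.
Proof. by rewrite ler_pdivrMr ?mulr_gt0// mul1r; move: alpha1; lra. Qed.

End scales.

Lemma powRN_le (R : realType) (alpha x y : R) : 0 <= alpha -> 0 < x -> x <= y ->
  y `^ (- alpha) <= x `^ (- alpha).
Proof.
move=> a0 x0 xy; rewrite !powRN lef_pV2 ?posrE ?powR_gt0//; last first.
  exact: lt_le_trans xy.
by rewrite ge0_ler_powR// nnegrE ltW//; exact: lt_le_trans xy.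
Qed.

Lemma powRN_ge1 (R : realType) (alpha x : R) : 2 <= alpha -> 1 <= x ->
  x `^ (- alpha) <= x ^- 2.
Proof.
move=> a2 x1; have x0 : 0 < x by exact: lt_le_trans x1.
rewrite powRN lef_pV2 ?posrE ?powR_gt0 ?exprn_gt0//.
by rewrite -powR_mulrn ?ler_powR// ltW.
Qed.

Lemma powRN_le1 (R : realType) (alpha x : R) : 2 <= alpha -> 0 < x -> x <= 1 ->
  x ^- 2 <= x `^ (- alpha).
Proof.
move=> a2 x0 x1; rewrite powRN lef_pV2 ?posrE ?powR_gt0 ?exprn_gt0//.
rewrite -powR_mulrn ?(ltW x0)// /powR gt_eqF// ler_expR.
have : ln x <= 0 by exact: ln_le0.
by rewrite -[2%:R]/(2 : R); nra.
Qed.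

(** * Probabilities of the exceptional events *)

Section event_bounds.
Context (R : realType) (alpha t : R) d (Om : measurableType d) (P : probability Om R).
Variables (p : nat -> R) (xi0 : int -> Om -> R) (C : nat -> Om -> R).
Hypothesis alpha2 : 2 <= alpha.
Hypothesis p01 : forall n, 0 <= p n <= 1.
Hypothesis ind : mutually_independent P (pot_family xi0 C).
Hypothesis pareto : forall z (x : R), 1 <= x ->
  P [set w | x < xi0 z w] = (x `^ (- alpha))%:E.
Hypothesis coin1 : forall n, P [set w | C n w = 1] = (p n.+1)%:E.
Hypotheses (t0 : 0 < t) (L1 : 1 <= ln t).
Let a := height alpha t.
Let r := reach_scale alpha t.
Let a0 : 0 < a. Proof. exact: height_gt0. Qed.
Let r0 : 0 < r. Proof. exact: reach_scale_gt0. Qed.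
Let alpha0 : 0 <= alpha. Proof. exact: le_trans alpha2. Qed.

Definition low_event : set Om :=
  \bigcup_y ([set w | xi0 y%:Z w <= 1] `|` [set w | xi0 (- y%:Z) w <= 1]).

Lemma measurable_low : measurable low_event.
Proof.
by apply: bigcup_measurable => y _; apply: measurableU; apply: (measurable_xi0_le ind).
Qed.

Lemma low_prob : (P low_event <= 0%:E)%E.
Proof.
have z0 z : (P [set w | (xi0 z w <= 1)%R] <= 0%:E)%E.
  by rewrite (xi0_le_prob ind pareto)// powR1 subrr.
apply: (le_measure_bigcup (b := fun=> 0)) => //.
- by move=> y; apply: measurableU; apply: (measurable_xi0_le ind).
- move=> y; rewrite -[0]addr0; apply: measureU_le => //; exact: (measurable_xi0_le ind).
- by move=> M; rewrite big1.
Qed.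

Definition flat_event (c : R) : set Om :=
  \bigcap_(y in [set y | (y < Num.truncn (c * r))%N])
    [set w | xi0 y.+1%:Z w <= 2 * c * a].

Lemma measurable_flat c : measurable (flat_event c).
Proof.
by apply: bigcap_measurableType => y _; exact: (measurable_xi0_le ind).
Qed.

(** There are about [c r] sites, and each is tall with probability [q] at least [1 / (4 c^2 r)],
    because [alpha >= 2] and [2 * c <= 1]. The expected number of tall sites is at least
    [1 / (8 c)], and [exp(-x) <= 1 / x] concludes. *)
Lemma flat_prob (c : R) : 0 < c -> c <= 1 / 2 -> 1 <= 2 * c * a -> 2 <= c * r ->
  (P (flat_event c) <= (8 * c)%:E)%E.
Proof.
move=> c0 c1 ca cr; rewrite /flat_event (xi0_all_le ind pareto)//.
set q := _ `^ _; set Y := Num.truncn _.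
have c2 : 0 < 2 * c by rewrite mulr_gt0.
have qE : q = (2 * c) `^ (- alpha) / r by rewrite /q powRM_height// ltW.
have q0 : 0 < q by rewrite powR_gt0// mulr_gt0.
have q1 : q <= 1.
  have -> : (1 : R) = 1 `^ (- alpha) by rewrite powR1.
  exact: powRN_le.
have Yr : c * r / 2 <= Y%:R.
  have : c * r < Y.+1%:R by exact: truncnS_gt.
  by rewrite -natr1; lra.
have qr : (4 * c ^+ 2 * r)^-1 <= q.
  rewrite qE invfM ler_pM2r ?invr_gt0//.
  have -> : (4 * c ^+ 2)^-1 = (2 * c) ^- 2 by rewrite exprMn -natrX.
  by apply: powRN_le1 => //; lra.
have qY : (8 * c)^-1 <= q * Y%:R.
  have -> : (8 * c)^-1 = (4 * c ^+ 2 * r)^-1 * (c * r / 2).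
    by field; rewrite !gt_eqF.
  have i0 : 0 <= (4 * c ^+ 2 * r)^-1.
    by rewrite invr_ge0; apply: ltW; apply: mulr_gt0 => //; rewrite mulr_gt0// exprn_gt0.
  have i1 : 0 <= c * r / 2 by rewrite divr_ge0//; apply: ltW; exact: mulr_gt0.
  exact: ler_pM.
rewrite lee_fin; apply: (@le_trans _ _ (expR (- q) ^+ Y)).
  rewrite lerXn2r ?nnegrE ?expR_ge0 ?subr_ge0//.
  exact: expR_ge1Dx.
rewrite -expRM_natr mulNr expRN -[leRHS]invrK lef_pV2 ?posrE ?expR_gt0 ?invr_gt0 ?mulr_gt0//.
apply: le_trans qY _; apply: le_trans (expR_ge1Dx _).
by rewrite lerDr.
Qed.

(** Coin [y] belongs to the pair of sites at distance [y.+1]. Where it is not 1 the two values need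
    not coincide, and neither may then be tall. *)
Definition asym_event (N : nat) (x : R) : set Om :=
  \bigcup_(y in [set y | (y < N)%N])
   (([set w | C y w <> 1] `&` [set w | x < xi0 y.+1%:Z w]) `|`
    ([set w | C y w <> 1] `&` [set w | x < xi0 (- y.+1%:Z) w])).

Let measurable_coinN y : measurable [set w | C y w <> 1].
Proof.
rewrite (_ : [set w | _] = ~` (C y @^-1` [set 1])).
  apply: measurableC; rewrite -[_ @^-1` _]setTI.
  by apply: (measurable_coin ind) => //; exact: measurable_set1.
by [].
Qed.

Lemma measurable_asym N x : measurable (asym_event N x).
Proof.
apply: bigcup_measurable => y _.
by apply: measurableU; apply: measurableI => //; exact: (measurable_xi0_gt ind).
Qed.

Lemma asym_prob N (x : R) : 1 <= x -> (P (asym_event N x) <=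
  (\sum_(y < N) 2 * (1 - p y.+1) * x `^ (- alpha))%:E)%E.
Proof.
move=> x1; apply: (le_measure_bigcup_lt (b := fun y => 2 * (1 - p y.+1) * x `^ (- alpha))).
- move=> y; by apply: measurableU; apply: measurableI => //; exact: (measurable_xi0_gt ind).
- by move=> y; rewrite !mulr_ge0 ?powR_ge0// subr_ge0; case/andP: (p01 y.+1).
- move=> y _.
  have -> : 2 * (1 - p y.+1) * x `^ (- alpha) =
    (1 - p y.+1) * x `^ (- alpha) + (1 - p y.+1) * x `^ (- alpha) by ring.
  have mI z : measurable ([set w | C y w <> 1] `&` [set w | x < xi0 z w]).
    by apply: measurableI => //; exact: (measurable_xi0_gt ind).
  have PI z : (P ([set w | C y w <> 1] `&` [set w | x < xi0 z w])%R <=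
      ((1 - p y.+1) * x `^ (- alpha))%:E)%E.
    have -> : [set w | x < xi0 z w] = xi0 z @^-1` `]x, +oo[%classic.
      by apply/seteqP; split=> w; rewrite /preimage /= in_itv /= andbT.
    rewrite (coin_prob ind coin1)// EFinM; apply: lee_wpmul2l.
      by rewrite lee_fin subr_ge0; case/andP: (p01 y.+1).
    rewrite -(pareto z x1) (_ : _ @^-1` _ = [set w | x < xi0 z w])//.
    by apply/seteqP; split=> w; rewrite /preimage /= in_itv /= andbT.
  exact: measureU_le.
Qed.

Definition high_event (theta K : R) : set Om :=
  \bigcup_y ([set w | theta * Num.max y%:R (K * r) * ln t / t < xi0 y%:Z w] `|`
             [set w | theta * Num.max y%:R (K * r) * ln t / t < xi0 (- y%:Z) w]).

Lemma measurable_high theta K : measurable (high_event theta K).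
Proof.
by apply: bigcup_measurable => y _; apply: measurableU; exact: (measurable_xi0_gt ind).
Qed.

(** Since [L / t = a / r], the threshold at [y] is [theta * (m y / r) * a], exceeded with
    probability at most [theta^(-alpha) r / (m y)^2], using [alpha >= 2]. The sum of these is of
    order [1 / K]. *)
Lemma high_prob (theta K : R) : 0 < theta -> 1 <= K -> 1 <= theta * K * a -> 2 <= r ->
  (P (high_event theta K) <= (16 * theta `^ (- alpha) / K)%:E)%E.
Proof.
move=> th0 K1 tKa r2; have K0 : 0 < K by exact: lt_le_trans K1.
have N0 : 2 <= K * r by apply: le_trans r2 _; rewrite ler_peMl// ltW.
have Np : 0 < K * r by exact: lt_le_trans N0.
pose N : R := K * r.
have Lt : ln t / t = a / r.
  have rL : r * ln t = t * a by exact: reach_scale_ln.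
  have -> : a = r * ln t / t by rewrite rL mulrC mulKf// gt_eqF.
  by field; rewrite !gt_eqF.
pose m (y : nat) : R := Num.max y%:R N.
have m0 y : 0 < m y by rewrite lt_max Np orbT.
have levE y : theta * m y * ln t / t = theta * (m y / r) * a.
  by rewrite -mulrA Lt; ring.
have mr y : K <= m y / r by rewrite ler_pdivlMr// le_max lexx orbT.
have lev1 y : 1 <= theta * m y * ln t / t.
  rewrite levE; apply: le_trans tKa _; rewrite ler_pM2r// ler_pM2l//.
have Pz y z : (P [set w | (theta * m y * ln t / t < xi0 z w)%R] <=
    (theta `^ (- alpha) * r * (m y) ^- 2)%:E)%E.
  have mr0 : 0 <= m y / r by apply: divr_ge0; apply: ltW; [exact: m0|exact: r0].
  have th0' := ltW th0.
  rewrite pareto// lee_fin levE (powRM_height alpha2 t0 L1); last exact: mulr_ge0.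
  rewrite powRM// -/r.
  have h : (m y / r) `^ (- alpha) <= (m y / r) ^- 2.
    by apply: powRN_ge1 => //; exact: le_trans K1 (mr y).
  rewrite -[leLHS]mulrA -[leRHS]mulrA ler_pM2l ?powR_gt0//.
  apply: (@le_trans _ _ ((m y / r) ^- 2 / r)).
    by rewrite ler_pM2r ?invr_gt0.
  rewrite expr_div_n invf_div le_eqVlt; apply/orP; left; apply/eqP.
  by field; rewrite !gt_eqF ?m0.
pose b y : R := 2 * (theta `^ (- alpha) * r) * (m y) ^- 2.
have b0 y : 0 <= b y.
  apply: ltW; apply: divr_gt0; last exact: exprn_gt0.
  by apply: mulr_gt0 => //; apply: mulr_gt0 => //; exact: powR_gt0.
apply: (le_measure_bigcup (b := b)) => //.
- by move=> y; apply: measurableU; exact: (measurable_xi0_gt ind).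
- move=> y; have -> : b y = theta `^ (- alpha) * r * (m y) ^- 2 +
    theta `^ (- alpha) * r * (m y) ^- 2 by rewrite /b; ring.
  apply: measureU_le; [exact: (measurable_xi0_gt ind)|exact: (measurable_xi0_gt ind)| |];
    exact: Pz.
move=> M.
(* The maximum is at least half the sum [y + N], which gives the 4 and a telescoping series of total
   at most [4 / (N - 1)], itself at most [8 / N]. *)
have ms y : (m y) ^- 2 <= 4 * ((y%:R + N - 1)^-1 - (y.+1%:R + N - 1)^-1).
  have y0 : 0 <= y%:R :> R by [].
  have d1 : 0 < y%:R + N - 1 by rewrite /N; lra.
  have d2 : 0 < y.+1%:R + N - 1 by rewrite -natr1; lra.
  have yN : y%:R + N <= 2 * m y.
    have : y%:R <= m y by rewrite le_max lexx.
    have : N <= m y by rewrite le_max lexx orbT.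
    by lra.
  have d3 : 0 < y%:R + N by rewrite /N; lra.
  have -> : (y%:R + N - 1)^-1 - (y.+1%:R + N - 1)^-1 = ((y%:R + N - 1) * (y%:R + N))^-1.
    rewrite -natr1; have -> : y%:R + 1 + N - 1 = y%:R + N by ring.
    by field; rewrite !gt_eqF.
  apply: (@le_trans _ _ (4 * ((y%:R + N) ^+ 2)^-1)).
    have -> : 4 * ((y%:R + N) ^+ 2)^-1 = ((y%:R + N) / 2) ^- 2.
      by rewrite expr_div_n invf_div -natrX.
    rewrite lef_pV2 ?posrE ?exprn_gt0 ?divr_gt0//.
    by rewrite lerXn2r ?nnegrE ?divr_ge0 ?(ltW d3) ?(ltW (m0 y))//; lra.
  rewrite ler_pM2l// lef_pV2 ?posrE ?mulr_gt0 ?exprn_gt0// expr2 ler_pM2r//; lra.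
have sm : \sum_(0 <= y < M) (m y) ^- 2 <= 4 * ((N - 1)^-1 - (M%:R + N - 1)^-1).
  elim: M => [|M IH]; first by rewrite big_geq// add0r subrr mulr0.
  rewrite big_nat_recr//=; have := ms M; lra.
rewrite -mulr_sumr.
have d1 : 0 < M%:R + N - 1.
  have : 0 <= M%:R :> R by [].
  by rewrite /N; lra.
have N1 : (N - 1)^-1 <= 2 * N^-1.
  have Np' : 0 < N by [].
  have N2 : 2 <= N by [].
  have N1p : 0 < N - 1 by lra.
  by rewrite -[leLHS]mul1r ler_pdivrMr// mulrAC ler_pdivlMr//; lra.
have i1 : 0 < (M%:R + N - 1)^-1 by rewrite invr_gt0.
have T0 : 0 < 2 * (theta `^ (- alpha) * r).
  by apply: mulr_gt0 => //; apply: mulr_gt0 => //; exact: powR_gt0.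
apply: (@le_trans _ _ (2 * (theta `^ (- alpha) * r) * (8 * N^-1))).
  by rewrite ler_pM2l//; lra.
rewrite /N invfM le_eqVlt; apply/orP; left; apply/eqP.
by field; rewrite !gt_eqF.
Qed.

(* [l j y] will be the left end of the interval of potential values at [y] for which
   [Psi_t(y)] lies in the cell of index [j]: a tie is two sites in the same cell. *)
Definition tie_event (N J : nat) (l : nat -> nat -> R) (h : R) : set Om :=
  \bigcup_(j in [set j | (j < J)%N]) \bigcup_(y in [set y | (y < N)%N])
  \bigcup_(y' in [set y' | (y' < N)%N]) (if y == y' then set0 else
    [set w | (l j y < xi0 y%:Z w) && (xi0 y%:Z w <= l j y + h)] `&`
    [set w | (l j y' < xi0 y'%:Z w) && (xi0 y'%:Z w <= l j y' + h)]).

Let measurable_itv_event z (l h : R) :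
  measurable [set w | (l < xi0 z w) && (xi0 z w <= l + h)].
Proof.
by apply: measurable_bool_set; apply: measurable_and;
  [apply: (@measurable_fun_ltr _ _ R)|apply: (@measurable_fun_ler _ _ R)] => //;
  exact: (measurable_xi0 ind).
Qed.

Lemma measurable_tie N J l h : measurable (tie_event N J l h).
Proof.
apply: bigcup_measurable => j _; apply: bigcup_measurable => y _.
apply: bigcup_measurable => y' _; case: ifP => // _; exact: measurableI.
Qed.

(** Union bound over cells and ordered pairs; distinct sites being independent, each pair
    contributes the square of the one-site bound [b]. *)
Lemma tie_prob N J l h (b : R) : 0 <= h -> 0 <= b ->
  (forall j y, 1 <= l j y) ->
  (forall j y, l j y `^ (- alpha) * (alpha * (h / l j y)) <= b) ->
  (P (tie_event N J l h) <= (J%:R * (N%:R * (N%:R * b ^+ 2)))%:E)%E.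
Proof.
move=> h0 b0 l1 lb.
have Pb j y : (P [set w | (l j y < xi0 y%:Z w) && (xi0 y%:Z w <= l j y + h)]%R <= b%:E)%E.
  apply: le_trans (pareto_interval alpha2 ind pareto _ (l1 j y) h0) _.
  by rewrite lee_fin.
have mF j y y' : measurable (if y == y' then set0 else
    [set w | (l j y < xi0 y%:Z w) && (xi0 y%:Z w <= l j y + h)] `&`
    [set w | (l j y' < xi0 y'%:Z w) && (xi0 y'%:Z w <= l j y' + h)]).
  by case: ifP => // _; exact: measurableI.
have sc n (x : R) : \sum_(i < n) x = n%:R * x by rewrite sumr_const card_ord mulr_natl.
rewrite -sc; apply: (le_measure_bigcup_lt (b := fun=> N%:R * (N%:R * b ^+ 2))).
- move=> j; apply: bigcup_measurable => y _; exact: bigcup_measurable.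
- by move=> j; rewrite !mulr_ge0// exprn_ge0.
move=> j _; rewrite -sc; apply: (le_measure_bigcup_lt (b := fun=> N%:R * b ^+ 2)).
- move=> y; exact: bigcup_measurable.
- by move=> y; rewrite !mulr_ge0// exprn_ge0.
move=> y _; rewrite -sc; apply: (le_measure_bigcup_lt (b := fun=> b ^+ 2)) => //.
- by move=> y'; rewrite exprn_ge0.
move=> y' _; case: eqP => [_|yy']; first by rewrite measure0 lee_fin exprn_ge0.
pose I k : set R := `]l j k, l j k + h]%classic.
have mI k : measurable (I k) by exact: measurable_itv.
have EI k : [set w | (l j k < xi0 k%:Z w) && (xi0 k%:Z w <= l j k + h)] =
    pot_family xi0 C (inl k%:Z) @^-1` I k.
  by apply/seteqP; split=> w; rewrite /preimage /I /= in_itv.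
rewrite (EI y) (EI y') (pot_indep2 ind)//; last first.
  by apply/eqP => -[]; exact: yy'.
by rewrite expr2 EFinM -!EI; apply: lee_pmul.
Qed.

End event_bounds.

(** * The profile [u - s ln u] and its windows *)

Lemma Psi_profile_mono (R : realType) (s u v : R) : 0 <= s -> 0 < u -> s <= u ->
  u <= v -> u - s * ln u <= v - s * ln v.
Proof.
move=> s0 u0 su uv; have v0 : 0 < v by exact: lt_le_trans uv.
have h : s * (ln v - ln u) <= v - u.
  have : ln (v / u) <= v / u - 1 by apply: ln_le_subr1; rewrite divr_gt0.
  rewrite ln_div ?posrE// => h1; apply: le_trans (ler_wpM2l s0 h1) _.
  have -> : s * (v / u - 1) = s / u * (v - u) by field; rewrite gt_eqF.
  by rewrite ler_piMl ?subr_ge0// ler_pdivrMr// mul1r.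
lra.
Qed.

(** The slope [1 - s / u] is at least one half as soon as [u >= 2 s]; obtained by applying
    monotonicity with [2 * s] and halving. *)
Lemma Psi_profile_expand (R : realType) (s u v : R) : 0 <= s -> 0 < u ->
  2 * s <= u -> u <= v -> (v - u) / 2 <= (v - s * ln v) - (u - s * ln u).
Proof.
move=> s0 u0 su uv.
have := @Psi_profile_mono R (2 * s) u v; rewrite mulr_ge0// => /(_ isT u0 su uv).
lra.
Qed.

(** A profile value of at least [c / 2 * a] forces [x >= 2 s], where the slope is at least one half.
    So the preimage of a window of width [2 * e] has diameter at most [4 * e], and lies in an
    interval of length [9 * e], open on the left, around any of its points. *)
Lemma cell_interval (R : realType) (c a e s b : R) :
  0 < c -> 0 < a -> 0 < e -> 20 * e <= c * a -> 0 <= s -> 4 * s <= c * a ->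
  c / 2 * a <= b ->
  exists2 l : R, c / 4 * a <= l & forall x : R, 1 <= x -> b <= x - s * ln x ->
    x - s * ln x < b + 2 * e -> l < x /\ x <= l + 9 * e.
Proof.
move=> c0 a0 e0 ec s0 sc cb.
pose Q x := [/\ 1 <= x, b <= x - s * ln x & x - s * ln x < b + 2 * e].
have Qx x : Q x -> c / 2 * a <= x.
  move=> [x1 xb _]; apply: le_trans cb _; apply: le_trans xb _.
  by rewrite lerBlDr lerDl mulr_ge0// ln_ge0.
have [[x1 Qx1]|nQ] := pselect (exists x, Q x); last first.
  (* When the window is not attained any left end will do; this value meets the required lower
     bound. *)
  exists (c / 4 * a) => // x x1 xb xe; exfalso; apply: nQ; by exists x.
have near u v : Q u -> Q v -> u <= v -> v - u <= 4 * e.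
  move=> Qu Qv uv; have ua := Qx _ Qu; case: Qu Qv => _ u1 u2 [_ v1 v2].
  have ca : 0 < c * a by rewrite mulr_gt0.
  have u0 : 0 < u by lra.
  have su : 2 * s <= u by lra.
  have := Psi_profile_expand s0 u0 su uv; lra.
exists (x1 - 5 * e).
  have := Qx _ Qx1; lra.
move=> x x_1 xb xe; have Qxx : Q x by [].
have [xx|xx] := leP x x1.
  have := near _ _ Qxx Qx1 xx; split; lra.
have := near _ _ Qx1 Qxx (ltW xx); split; lra.
Qed.

Lemma potential_nat (R : realType) (T : Type) (xi0 : int -> T -> R) C w (n : nat) :
  potential xi0 C w n%:Z = xi0 n%:Z w.
Proof. by []. Qed.

Lemma potential_neg (R : realType) (T : Type) (xi0 : int -> T -> R) C w (n : nat) :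
  potential xi0 C w (- n.+1%:Z) =
  if C n w == 1 then xi0 n.+1%:Z w else xi0 (- n.+1%:Z) w.
Proof. by rewrite /potential abszN absz_nat. Qed.

Lemma int_abs_cases (y : int) : y = `|y|%N%:Z \/ y = - `|y|%N%:Z.
Proof. by case: y => n; [left|right; rewrite NegzE abszN absz_nat]. Qed.

Lemma potential_cases (R : realType) (T : Type) (xi0 : int -> T -> R) C w (y : int) :
  potential xi0 C w y = xi0 y w \/ potential xi0 C w y = xi0 `|y|%N%:Z w.
Proof.
rewrite /potential; case: ifP => _; first by left.
by case: ifP; [right|left].
Qed.

(** * Consequences of the absence of exceptional events *)

Section good_environment.
Context (R : realType) (T : Type) (xi0 : int -> T -> R) (C : nat -> T -> R) (w : T).
Variables (t L a r c K eta theta beta : R) (n J : nat) (l : nat -> nat -> R).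
Let xi := potential xi0 C w.
Hypotheses (t0 : 0 < t) (Lt : ln t = L) (a0 : 0 < a) (rL : r * L = t * a)
  (c0 : 0 < c) (c1 : c <= 1 / 2) (K1 : 1 <= K) (eta0 : 0 < eta)
  (eta_c : 20 * eta <= c) (beta0 : 0 < beta) (thetaE : theta = beta / 8)
  (L1 : 1 <= L) (LK : 8 * K <= c * L) (aL : ln a <= L)
  (caL : beta / 2 * L <= ln (c * a)).
Hypothesis xi0_gt1 : forall z, 1 < xi0 z w.
Hypothesis tall : exists2 y, (y < Num.truncn (c * r))%N & 2 * c * a < xi0 y.+1%:Z w.
Hypothesis symm : forall y, (y < Num.truncn (2 * K * r))%N -> C y w <> 1 ->
  xi0 y.+1%:Z w <= c / 2 * a /\ xi0 (- y.+1%:Z) w <= c / 2 * a.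
Hypothesis high : forall y : int,
  xi0 y w <= theta * Num.max `|y|%N%:R (K * r) * L / t.
Hypothesis lP : forall j y, (y < (Num.truncn (2 * K * r)).+1)%N ->
  forall x, 1 <= x -> c / 2 * a + j%:R * (eta * a) <= x - y%:R / t * ln x ->
    x - y%:R / t * ln x < c / 2 * a + j%:R * (eta * a) + 2 * (eta * a) ->
    l j y < x /\ x <= l j y + 9 * (eta * a).
Hypothesis JP : 2 * theta * K <= J%:R * eta.
Hypothesis notie : forall j y y', (j < J)%N ->
  (y < (Num.truncn (2 * K * r)).+1)%N -> (y' < (Num.truncn (2 * K * r)).+1)%N ->
  y != y' -> ~ ((l j y < xi0 y%:Z w /\ xi0 y%:Z w <= l j y + 9 * (eta * a)) /\
               (l j y' < xi0 y'%:Z w /\ xi0 y'%:Z w <= l j y' + 9 * (eta * a))).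
Hypothesis zero : xi0 0 w <= c / 2 * a.

Let Lp : 0 < L. Proof. exact: lt_le_trans L1. Qed.
Let Kp : 0 < K. Proof. exact: lt_le_trans K1. Qed.
Let rE : r = t * a / L. Proof. by rewrite -rL mulfK// gt_eqF. Qed.
Let rp : 0 < r. Proof. by rewrite rE divr_gt0// mulr_gt0. Qed.
Let ca : 0 < c * a. Proof. exact: mulr_gt0. Qed.
Let rt : r / t = a / L. Proof. by rewrite rE; field; rewrite !gt_eqF. Qed.
Let Kr : 0 < K * r. Proof. exact: mulr_gt0. Qed.

Lemma xi_gt1 z : 1 < xi z.
Proof. by have [] := potential_cases xi0 C w z; rewrite -/xi => ->. Qed.

Lemma xi_high (y : int) : xi y <= theta * Num.max `|y|%N%:R (K * r) * L / t.
Proof.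
have [] := potential_cases xi0 C w y; rewrite -/xi => ->; first exact: high.
by have := high `|y|%N%:Z; rewrite absz_nat.
Qed.

Let ln_xi z : 0 <= ln (xi z). Proof. by rewrite ln_ge0// ltW// xi_gt1. Qed.

Lemma Psi_le (y : int) : Psi xi t y <= xi y.
Proof. by rewrite /Psi lerBlDr lerDl mulr_ge0// divr_ge0// ltW. Qed.

Let inN (y : nat) : (y < Num.truncn (2 * K * r))%N = (y.+1%:R <= 2 * K * r).
Proof. by rewrite truncn_ge_nat// !mulr_ge0// ltW. Qed.

(** [zero] excludes the origin and [symm] forces the coin to be 1, so that the value at [y] may be
    read off at [|y|], a symmetric site. *)
Lemma tall_coin (y : int) : `|y|%N%:R <= 2 * K * r -> c / 2 * a < xi y ->
  exists2 m : nat, `|y|%N = m.+1 &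
    [/\ C m w = 1, xi m.+1%:Z = xi0 m.+1%:Z w, xi (- m.+1%:Z) = xi m.+1%:Z &
        xi y = xi m.+1%:Z].
Proof.
move=> yK xy; case E : `|y|%N => [|m].
  exfalso; have y0 : y = 0 by apply/eqP; rewrite -absz_eq0 E.
  by move: xy; rewrite y0 ltNge; move/negP; apply; exact: zero.
exists m => //.
have mN : (m < Num.truncn (2 * K * r))%N by rewrite inN -E.
have Cm : C m w = 1.
  apply: contrapT => /(symm mN)[h1 h2]; move: xy; apply/negP; rewrite -leNgt.
  have [] := potential_cases xi0 C w y; rewrite -/xi => ->; last by rewrite E.
  by have [] := int_abs_cases y; rewrite E => ->.
have e1 : xi (- m.+1%:Z) = xi m.+1%:Z by rewrite /xi potential_neg Cm eqxx.
split => //.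
by have [] := int_abs_cases y; rewrite E => ->.
Qed.

(** Within [c r] the distance penalty at height [2 * c * a] is at most [(c a / L) * L = c a], half
    of that height. Monotonicity of the profile covers larger values. *)
Lemma tall_Psi : exists2 y : nat, Dset xi y & c * a <= Psi xi t y%:Z.
Proof.
have [y yY xy] := tall.
have ycr : y.+1%:R <= c * r.
  by rewrite truncn_ge_nat// in yY; rewrite mulr_ge0// ltW.
have yK : `|y.+1%:Z|%N%:R <= 2 * K * r.
  rewrite absz_nat; apply: le_trans ycr _; rewrite ler_pM2r//; move: c1 K1; lra.
have xy' : c / 2 * a < xi y.+1%:Z.
  apply: le_lt_trans xy; rewrite ler_pM2r//; move: c0; lra.
have [m Em [_ _ sm _]] := tall_coin yK xy'.
exists y.+1; first by rewrite /Dset /=; move: Em; rewrite absz_nat => -[->].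
rewrite /Psi absz_nat.
have s1 : y.+1%:R / t <= c * a / L.
  by rewrite -mulrA -rt mulrA ler_pM2r ?invr_gt0.
have s0 : 0 <= y.+1%:R / t by rewrite divr_ge0// ltW.
have c2a : 0 < 2 * c * a by rewrite -mulrA mulr_gt0.
have su : y.+1%:R / t <= 2 * c * a.
  apply: le_trans s1 _; rewrite ler_pdivrMr//.
  have : c * a * 1 <= c * a * L by rewrite ler_pM2l.
  by move: ca; lra.
have := Psi_profile_mono s0 c2a su (ltW xy); rewrite -/(xi y.+1%:Z).
have lnc : ln (2 * c * a) <= L.
  apply: le_trans aL; rewrite ler_ln ?posrE// ler_piMl ?(ltW a0)//; move: c1; lra.
have : y.+1%:R / t * ln (2 * c * a) <= c * a.
  apply: (@le_trans _ _ (y.+1%:R / t * L)); first by rewrite ler_wpM2l.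
  by rewrite -ler_pdivlMr.
rewrite /xi potential_nat; lra.
Qed.

(** Beyond [K r] the potential is at most [theta y L / t], whereas a site of height at least [c * a]
    pays a penalty of at least [(beta / 2) y L / t]; as [theta = beta / 8], [Psi] would be
    negative. *)
Lemma Psi_far (y : nat) : c * a <= Psi xi t y%:Z -> y%:R <= K * r.
Proof.
move=> py; rewrite leNgt; apply/negP => yK.
have cx : c * a <= xi y%:Z by apply: le_trans py _; exact: Psi_le.
have := xi_high y%:Z; rewrite absz_nat max_l ?(ltW yK)// => xh.
have lnx : beta / 2 * L <= ln (xi y%:Z).
  apply: le_trans caL _; rewrite ler_ln ?posrE//; exact: lt_le_trans cx.
have yt : 0 < y%:R / t by rewrite divr_gt0//; exact: lt_trans yK.
have h := ler_wpM2l (ltW yt) lnx.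
move: py; rewrite /Psi absz_nat.
have e1 : theta * y%:R * L / t = y%:R / t * (theta * L) by ring.
have : 0 < y%:R / t * (beta * L) by apply: mulr_gt0 => //; exact: mulr_gt0.
move: xh h ca; rewrite e1 thetaE; lra.
Qed.

(** By [Psi_far] only finitely many sites reach the level [c * a], which is attained on [D], so a
    finite maximum suffices. *)
Lemma maximiser_exists : exists z, is_maximiser_D xi t z.
Proof.
have [y0 Dy0 py0] := tall_Psi.
pose N := (Num.truncn (K * r)).+1.
have inN' y : c * a <= Psi xi t y%:Z -> (y < N)%N.
  by move=> /Psi_far yK; rewrite ltnS truncn_ge_nat// ltW.
pose i0 : 'I_N := Ordinal (inN' _ py0).
pose Q (i : 'I_N) := `[< Dset xi i >].
have Qi0 : Q i0 by apply/asboolP.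
case: (@Order.TotalTheory.arg_maxP _ _ 'I_N i0 Q (fun i => Psi xi t (i : nat)%:Z) Qi0).
move=> i /asboolP Di imax; exists i; split => // y Dy.
have pi : c * a <= Psi xi t (i : nat)%:Z by exact: le_trans py0 (imax i0 Qi0).
have [py|py] := leP (c * a) (Psi xi t y%:Z); last by apply: ltW; exact: lt_le_trans py pi.
exact: (imax (Ordinal (inN' _ py)) (asboolT Dy)).
Qed.

Hypothesis nmax : is_maximiser_D xi t n.

Lemma maximiser_Psi : c * a <= Psi xi t n%:Z.
Proof. by have [y Dy py] := tall_Psi; apply: le_trans py _; exact: nmax.2. Qed.

Lemma maximiser_le : n%:R <= K * r. Proof. exact: Psi_far maximiser_Psi. Qed.

Let nK2 : `|n%:Z|%N%:R <= 2 * K * r.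
Proof. by rewrite absz_nat; move: maximiser_le Kr; lra. Qed.

Let n_tall : c / 2 * a < xi n%:Z.
Proof.
by apply: (@lt_le_trans _ _ (c * a)); [move: ca; lra|exact: le_trans maximiser_Psi (Psi_le _)].
Qed.

Lemma maximiser_gt0 : (0 < n)%N.
Proof. by have [m] := tall_coin nK2 n_tall; rewrite absz_nat => ->. Qed.

(** A competitor within [eta * a] is tall, hence symmetric, and may be replaced by [|y|], which lies
    in [D]. By maximality its [Psi] does not exceed that of [n], so the two values fall into a
    common window, contradicting [notie]. *)
Lemma maximiser_gap (y : int) : `|y|%N%:R <= 2 * K * r -> ~~ twin n y ->
  Psi xi t y <= Psi xi t n%:Z - eta * a.
Proof.
move=> yK ntw; rewrite leNgt; apply/negP => py.
have ea : 20 * (eta * a) <= c * a by rewrite mulrA ler_pM2r.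
have eap : 0 < eta * a by rewrite mulr_gt0.
have py2 : c / 2 * a < Psi xi t y by move: maximiser_Psi ca; lra.
have xy : c / 2 * a < xi y by apply: lt_le_trans py2 (Psi_le _).
have [m Em [Cm xm sm xyE]] := tall_coin yK xy.
have [k Ek [_ xk _ _]] := tall_coin nK2 n_tall.
rewrite absz_nat in Ek.
have pyE : Psi xi t y = Psi xi t m.+1%:Z by rewrite /Psi Em absz_nat xyE.
have pm : Psi xi t m.+1%:Z <= Psi xi t n%:Z by apply: nmax.2; rewrite /Dset /= sm.
rewrite pyE in py py2.
have mn : m.+1 != n.
  apply: contraNneq ntw => mn; rewrite /twin.
  by have [] := int_abs_cases y; rewrite Em mn => ->; rewrite eqxx ?orbT.
have mN : (m.+1 < (Num.truncn (2 * K * r)).+1)%N by rewrite ltnS inN -Em.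
have nN : (n < (Num.truncn (2 * K * r)).+1)%N by rewrite Ek ltnS inN -Ek -[n in n%:R]absz_nat.
(* The windows start at multiples of [eta * a] but have width [2 * (eta * a)]: the window that
   starts just below the smaller value also contains the larger one. *)
pose j := Num.truncn ((Psi xi t m.+1%:Z - c / 2 * a) / (eta * a)).
have j0 : 0 <= (Psi xi t m.+1%:Z - c / 2 * a) / (eta * a).
  by rewrite divr_ge0 ?(ltW eap)// subr_ge0 ltW.
have /andP[j1 j2] := truncn_itv j0; rewrite -/j in j1 j2.
rewrite ler_pdivlMr// in j1; rewrite ltr_pdivrMr// -[j.+1%:R]natr1 in j2.
have xm1 : 1 <= xi m.+1%:Z by apply: ltW; exact: xi_gt1.
have xn1 : 1 <= xi n%:Z by apply: ltW; exact: xi_gt1.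
have pE k' : Psi xi t k'%:Z = xi k'%:Z - k'%:R / t * ln (xi k'%:Z) by rewrite /Psi absz_nat.
have im : l j m.+1 < xi m.+1%:Z /\ xi m.+1%:Z <= l j m.+1 + 9 * (eta * a).
  by apply: lP => //; rewrite -pE; lra.
have inn : l j n < xi n%:Z /\ xi n%:Z <= l j n + 9 * (eta * a).
  by apply: lP => //; rewrite -pE; lra.
(* Within [2 K r] the potential is at most [2 * theta * K * a], so [J] windows exhaust the possible
   heights. *)
have jJ : (j < J)%N.
  rewrite -(ltr_nat R) -(ltr_pM2r eap).
  have xh : xi m.+1%:Z <= 2 * theta * K * a.
    apply: le_trans (xi_high _) _; rewrite absz_nat.
    have mx : Num.max m.+1%:R (K * r) <= 2 * K * r.
      by rewrite ge_max -Em yK /=; move: Kr; lra.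
    have th0 : 0 < theta by rewrite thetaE divr_gt0.
    rewrite ler_pdivrMr//.
    have -> : 2 * theta * K * a * t = theta * (2 * K * r) * L.
      have -> : theta * (2 * K * r) * L = 2 * theta * K * (r * L) by ring.
      by rewrite rL; ring.
    by rewrite ler_pM2r// ler_pM2l.
  have : Psi xi t m.+1%:Z <= xi m.+1%:Z by exact: Psi_le.
  have := ler_wpM2r (ltW a0) JP; move: ca; lra.
apply: (notie jJ mN nN mn).
by move: im inn; rewrite /xi !potential_nat.
Qed.

Lemma maximiser_sym : xi (- n%:Z) = xi n%:Z.
Proof. by case: nmax => Dn _; rewrite /Dset /= in Dn; rewrite Dn. Qed.

End good_environment.

(** The Cesaro argument: the first [N1] terms count at most 1 each, the others at most [eps]. *)
Lemma sum_le_of_cvg0 (R : realType) (q : nat -> R) (eps : R) :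
  (forall n, q n <= 1) -> 0 < eps -> q n @[n --> \oo] --> (0 : R) ->
  exists N1 : nat, forall N : nat, \sum_(y < N) q y.+1 <= N1%:R + eps * N%:R.
Proof.
move=> q1 e0 /cvgrPdist_le/(_ _ e0)[N1 _ qe]; exists N1 => N.
elim: N => [|N IH]; first by rewrite big_ord0 mulr0 addr0.
rewrite big_ord_recr /= -natr1 mulrDr mulr1 addrA.
have [h|h] := leqP N1 N.
  apply: lerD => //; have /= := qe N.+1 (leqW h).
  by rewrite sub0r normrN; exact/le_trans/ler_norm.
have : \sum_(y < N) q y.+1 <= N%:R.
  rewrite -[N%:R]mulr1 mulr_natl -[in leRHS](card_ord N) -sumr_const.
  exact: ler_sum.
have : N%:R + 1 <= N1%:R :> R by rewrite natr1 ler_nat.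
have : 0 <= eps * N%:R by rewrite mulr_ge0// ltW.
by have := q1 N.+1; move: e0; lra.
Qed.

(** * Typical environments have high probability *)

Section environment.
Context (R : realType) (alpha : R) d (Om : measurableType d) (P : probability Om R).
Variables (p : nat -> R) (xi0 : int -> Om -> R) (C : nat -> Om -> R).
Hypothesis alpha2 : 2 <= alpha.
Hypothesis p01 : forall n, 0 <= p n <= 1.
Hypothesis pcvg : p n @[n --> \oo] --> (1 : R).
Hypothesis ind : mutually_independent P (pot_family xi0 C).
Hypothesis pareto : forall z (x : R), 1 <= x ->
  P [set w | x < xi0 z w] = (x `^ (- alpha))%:E.
Hypothesis coin1 : forall n, P [set w | C n w = 1] = (p n.+1)%:E.
Let beta := rate alpha.
Let theta := beta / 8.
Let beta0 : 0 < beta. Proof. exact: rate_gt0. Qed.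
Let theta0 : 0 < theta. Proof. exact: divr_gt0. Qed.
Let alpha0 : 0 < alpha. Proof. exact: lt_le_trans alpha2. Qed.

(** The expected number of asymmetric pairs within [2 K r] is at most [N1 + eps * 2 K r], each tall
    with probability of order [1 / r]. The choice of [eps] bounds the linear part by [delta / 12],
    and [r >= r1] does the same for [N1]. *)
Lemma asym_prob_small (c K delta : R) : 0 < c -> 1 <= K -> 0 < delta ->
  exists r1 : R, forall t : R, 0 < t -> 1 <= ln t -> r1 <= reach_scale alpha t ->
    1 <= c / 2 * height alpha t ->
    (P (asym_event xi0 C (Num.truncn (2 * K * reach_scale alpha t))
          (c / 2 * height alpha t)) <= (delta / 6)%:E)%E.
Proof.
move=> c0 K1 d0; have K0 : 0 < K by exact: lt_le_trans K1.
pose Q := (c / 2) `^ (- alpha); have Q0 : 0 < Q by rewrite powR_gt0// divr_gt0.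
pose eps := delta / (48 * K * Q).
have KQ : 0 < 48 * K * Q by rewrite mulr_gt0// mulr_gt0.
have e0 : 0 < eps by rewrite divr_gt0.
have q1 n : 1 - p n <= 1 by rewrite lerBlDr lerDl; case/andP: (p01 n).
have qcvg : 1 - p n @[n --> \oo] --> (0 : R).
  by rewrite -(subrr 1); apply: cvgB => //; exact: cvg_cst.
have [N1 N1P] := sum_le_of_cvg0 q1 e0 qcvg.
exists (24 * N1%:R * Q / delta) => t t0 L1 r1 x1.
have r0 : 0 < reach_scale alpha t by exact: reach_scale_gt0.
apply: le_trans (asym_prob p01 ind pareto coin1 _ x1) _.
rewrite lee_fin -mulr_suml -mulr_sumr powRM_height ?divr_ge0 ?(ltW c0)// -/Q.
move: (reach_scale alpha t) r0 r1 => r r0 r1.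
have NK : (Num.truncn (2 * K * r))%:R <= 2 * K * r.
  by rewrite -truncn_ge_nat// !mulr_ge0// ltW.
have S1 := N1P (Num.truncn (2 * K * r)).
have S2 := ler_wpM2l (ltW e0) NK.
rewrite mulrA ler_pdivrMr//.
have E : eps * (2 * K * r) * Q = delta * r / 24 by rewrite /eps; field; rewrite !gt_eqF.
have r1' : 24 * N1%:R * Q <= r * delta by rewrite -ler_pdivrMr.
have S3 := ler_wpM2r (ltW Q0) (le_trans S1 (lerD (lexx N1%:R) S2)).
by rewrite [leRHS]mulrDl E in S3; lra.
Qed.

Lemma cell_bounds (c K eta t : R) : 0 < c -> 0 < K -> 0 < eta -> 20 * eta <= c ->
  0 < t -> 1 <= ln t -> 8 * K <= c * ln t ->
  exists l : nat -> nat -> R, (forall j y, c / 4 * height alpha t <= l j y) /\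
  forall j y, (y < (Num.truncn (2 * K * reach_scale alpha t)).+1)%N ->
  forall x, 1 <= x ->
    c / 2 * height alpha t + j%:R * (eta * height alpha t) <= x - y%:R / t * ln x ->
    x - y%:R / t * ln x < c / 2 * height alpha t + j%:R * (eta * height alpha t) +
      2 * (eta * height alpha t) ->
    l j y < x /\ x <= l j y + 9 * (eta * height alpha t).
Proof.
move=> c0 K0 e0 ec t0 L1 LK.
have a0 := height_gt0 alpha t; have r0 := reach_scale_gt0 alpha t0 L1.
have Lp : 0 < ln t by exact: lt_le_trans L1.
have rL := reach_scale_ln alpha L1.
move: (height alpha t) (reach_scale alpha t) a0 r0 rL => a r a0 r0 rL.
have cell (jy : nat * nat) : exists l : R, c / 4 * a <= l /\
    ((jy.2 < (Num.truncn (2 * K * r)).+1)%N -> forall x, 1 <= x ->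
    c / 2 * a + jy.1%:R * (eta * a) <= x - jy.2%:R / t * ln x ->
    x - jy.2%:R / t * ln x < c / 2 * a + jy.1%:R * (eta * a) + 2 * (eta * a) ->
    l < x /\ x <= l + 9 * (eta * a)).
  case: jy => j y /=.
  have [yN|yN] := ltnP y (Num.truncn (2 * K * r)).+1; last by exists (c / 4 * a).
  have y2 : y%:R <= 2 * K * r.
    by rewrite -truncn_ge_nat ?mulr_ge0 ?(ltW K0) ?(ltW r0).
  have sc : 4 * (y%:R / t) <= c * a.
    rewrite mulrA ler_pdivrMr// -(ler_pM2r Lp).
    have -> : c * a * t * ln t = c * ln t * (r * ln t) by rewrite rL; ring.
    have h := ler_wpM2r (ltW (mulr_gt0 r0 Lp)) LK.
    have := ler_wpM2r (ltW Lp) y2; lra.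
  have [|||||l l1 l2] := @cell_interval R c a (eta * a) (y%:R / t)
    (c / 2 * a + j%:R * (eta * a)) c0 a0; last by exists l.
  - exact: mulr_gt0.
  - by rewrite mulrA ler_pM2r.
  - by rewrite divr_ge0// ltW.
  - exact: sc.
  - by rewrite lerDl mulr_ge0// ltW// mulr_gt0.
have [f fP] := choice cell.
exists (fun j y => f (j, y)); split=> j y; first by have [] := fP (j, y).
by have [_] := fP (j, y).
Qed.

(** An interval of length [9 * (eta * a)] above [c / 4 * a] has probability at most [G * eta / r].
    With at most [3 K r] sites and [J * eta] bounded, the sum over cells and pairs is of order
    [eta], uniformly in [t]. *)
Lemma tie_prob_small (c K eta t delta : R) (J : nat) (l : nat -> nat -> R) :
  let G := 36 * alpha / c * (c / 4) `^ (- alpha) in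
  0 < c -> 1 <= K -> 0 < eta -> 0 < t -> 1 <= ln t -> 1 <= K * reach_scale alpha t ->
  1 <= c / 4 * height alpha t -> (forall j y, c / 4 * height alpha t <= l j y) ->
  J%:R * eta <= 2 * theta * K + 1 ->
  54 * K ^+ 2 * G ^+ 2 * (2 * theta * K + 1) * eta <= delta ->
  (P (tie_event xi0 (Num.truncn (2 * K * reach_scale alpha t)).+1 J l
        (9 * (eta * height alpha t))) <= (delta / 6)%:E)%E.
Proof.
move=> G c0 K1 e0 t0 L1 Kr ca la JE Ge.
have K0 : 0 < K by exact: lt_le_trans K1.
have a0 := height_gt0 alpha t; have r0 := reach_scale_gt0 alpha t0 L1.
have c4 : 0 < c / 4 by rewrite divr_gt0.
have Q0 : 0 < (c / 4) `^ (- alpha) by rewrite powR_gt0.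
have QE := powRM_height alpha2 t0 L1 (ltW c4).
have G0 : 0 < G by rewrite mulr_gt0// divr_gt0// mulr_gt0.
have ca0 : 0 < c / 4 * height alpha t by rewrite mulr_gt0.
have b0 : 0 <= G * eta / reach_scale alpha t by
  apply: ltW; apply: divr_gt0 => //; exact: mulr_gt0.
have h0 : 0 <= 9 * (eta * height alpha t) by
  apply: ltW; apply: mulr_gt0 => //; exact: mulr_gt0.
apply: le_trans (tie_prob alpha2 ind pareto _ _ h0 b0 _ _) _.
- by move=> j y; exact: le_trans (la j y).
- move=> j y; have l0 : 0 < l j y by exact: lt_le_trans (la j y).
  have -> : G * eta / reach_scale alpha t = (c / 4) `^ (- alpha) / reach_scale alpha t *
      (alpha * (9 * (eta * height alpha t) / (c / 4 * height alpha t))).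
    by rewrite /G; field; rewrite !gt_eqF.
  apply: ler_pM; rewrite ?powR_ge0//.
  + by apply: mulr_ge0; [exact: ltW|apply: divr_ge0 => //; exact: ltW].
  + by rewrite -QE; apply: powRN_le => //; exact: ltW.
  + by rewrite ler_pM2l// ler_wpM2l// lef_pV2 ?posrE.
rewrite lee_fin.
move: (reach_scale alpha t) r0 Kr {QE b0} => r r0 Kr.
have N3 : (Num.truncn (2 * K * r)).+1%:R <= 3 * K * r.
  have : (Num.truncn (2 * K * r))%:R <= 2 * K * r.
    by rewrite -truncn_ge_nat// !mulr_ge0// ltW.
  by rewrite -natr1; move: Kr; lra.
have b2 : 0 <= (G * eta / r) ^+ 2 by rewrite sqr_ge0.
apply: (@le_trans _ _ (J%:R * (3 * K * r * (3 * K * r * (G * eta / r) ^+ 2)))).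
  rewrite ler_wpM2l//; apply: ler_pM => //; first by rewrite mulr_ge0.
  by rewrite ler_wpM2r.
have -> : J%:R * (3 * K * r * (3 * K * r * (G * eta / r) ^+ 2)) =
    9 * K ^+ 2 * G ^+ 2 * eta * (J%:R * eta) by field; rewrite gt_eqF.
have w0 : 0 <= 9 * K ^+ 2 * G ^+ 2 * eta.
  by rewrite mulr_ge0 ?(ltW e0)// mulr_ge0 ?sqr_ge0// mulr_ge0 ?sqr_ge0.
have := ler_wpM2l w0 JE; move: Ge; lra.
Qed.

Definition localised_at (c K eta t : R) (w : Om) (n : nat) : Prop :=
  let xi := potential xi0 C w in
  [/\ (0 < n)%N, n%:R <= K * reach_scale alpha t, xi (- n%:Z) = xi n%:Z,
      c * height alpha t <= Psi xi t n%:Z &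
      forall y : int, `|y|%N%:R <= 2 * K * reach_scale alpha t -> ~~ twin n y ->
        Psi xi t y <= Psi xi t n%:Z - eta * height alpha t].

Definition tame (K t : R) (w : Om) : Prop :=
  let xi := potential xi0 C w in (forall z, 1 <= xi z) /\
  forall y : int, xi y <= theta * Num.max `|y|%N%:R (K * reach_scale alpha t) * ln t / t.

(** Quantifies over all maximisers because [Z] is an arbitrary selection; existence is included
    because [Z] is constrained only where a maximiser exists. *)
Definition typical (c K eta t : R) (w : Om) : Prop :=
  [/\ tame K t w, exists z, is_maximiser_D (potential xi0 C w) t z &
      forall n, is_maximiser_D (potential xi0 C w) t n -> localised_at c K eta t w n].

Section atypical.
Variables (c K eta t : R) (J : nat) (l : nat -> nat -> R).
Local Notation a := (height alpha t).
Local Notation r := (reach_scale alpha t).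
Local Notation N := (Num.truncn (2 * K * r)).
Hypotheses (c0 : 0 < c) (c1 : c <= 1 / 2) (K1 : 1 <= K) (eta0 : 0 < eta)
  (eta_c : 20 * eta <= c) (t0 : 0 < t) (L1 : 1 <= ln t) (LK : 8 * K <= c * ln t)
  (caL : beta / 2 * ln t <= ln (c * a)).
Hypothesis lP : forall j y, (y < N.+1)%N ->
  forall x, 1 <= x -> c / 2 * a + j%:R * (eta * a) <= x - y%:R / t * ln x ->
    x - y%:R / t * ln x < c / 2 * a + j%:R * (eta * a) + 2 * (eta * a) ->
    l j y < x /\ x <= l j y + 9 * (eta * a).
Hypothesis JP : 2 * theta * K <= J%:R * eta.

Definition atypical_event : set Om :=
  low_event xi0 `|` (flat_event alpha t xi0 c `|` (asym_event xi0 C N (c / 2 * a) `|`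
  (high_event alpha t xi0 theta K `|` (tie_event xi0 N.+1 J l (9 * (eta * a)) `|`
  [set w | c / 2 * a < xi0 0 w])))).

Lemma measurable_atypical : measurable atypical_event.
Proof.
do !apply: measurableU.
- exact: (measurable_low ind).
- exact: (measurable_flat alpha t ind).
- exact: (measurable_asym ind).
- exact: (measurable_high alpha t ind).
- exact: (measurable_tie ind).
- exact: (measurable_xi0_gt ind).
Qed.

Lemma typical_not_atypical w : ~ atypical_event w -> typical c K eta t w.
Proof.
move=> /not_orP[nlow /not_orP[nflat /not_orP[nasym /not_orP[nhigh /not_orP[ntie nzero]]]]].
have a0 := height_gt0 alpha t.
have gt1 z : 1 < xi0 z w.
  rewrite ltNge; apply/negP => h; apply: nlow; exists `|z|%N => //.
  by have [e|e] := int_abs_cases z; [left|right]; rewrite /= -e.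
have tall : exists2 y, (y < Num.truncn (c * r))%N & 2 * c * a < xi0 y.+1%:Z w.
  apply: contrapT => H; apply: nflat => y /= yY.
  by rewrite leNgt; apply/negP => h; apply: H; exists y.
have symm y : (y < N)%N -> C y w <> 1 ->
    xi0 y.+1%:Z w <= c / 2 * a /\ xi0 (- y.+1%:Z) w <= c / 2 * a.
  move=> yN Cy; split; rewrite leNgt; apply/negP => h; apply: nasym; exists y => //;
    [left|right]; split => //.
have high (y : int) : xi0 y w <= theta * Num.max `|y|%N%:R (K * r) * ln t / t.
  rewrite leNgt; apply/negP => h; apply: nhigh; exists `|y|%N => //.
  by have [e|e] := int_abs_cases y; [left|right]; rewrite /= -e.
have notie j y y' : (j < J)%N -> (y < N.+1)%N -> (y' < N.+1)%N ->
  y != y' -> ~ ((l j y < xi0 y%:Z w /\ xi0 y%:Z w <= l j y + 9 * (eta * a)) /\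
               (l j y' < xi0 y'%:Z w /\ xi0 y'%:Z w <= l j y' + 9 * (eta * a))).
  move=> jJ yN yN' yy' [[h1 h2] [h3 h4]]; apply: ntie; exists j => //.
  exists y => //; exists y' => //; rewrite (negbTE yy').
  by split; apply/andP.
have zero : xi0 0 w <= c / 2 * a by rewrite leNgt; apply/negP.
have rL := reach_scale_ln alpha L1.
have aL := ln_height_le alpha2 L1.
have thE : theta = beta / 8 by [].
split.
- split; first by move=> z; apply: ltW; exact: (xi_gt1 _ gt1).
  exact: (xi_high C high).
- by apply: (@maximiser_exists _ _ xi0 C w t (ln t) a r c K theta beta).
- move=> n nmax; split.
  + by apply: (@maximiser_gt0 _ _ xi0 C w t (ln t) a r c K theta beta).
  + by apply: (@maximiser_le _ _ xi0 C w t (ln t) a r c K theta beta).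
  + exact: (maximiser_sym nmax).
  + by apply: (@maximiser_Psi _ _ xi0 C w t (ln t) a r c K n).
  + by apply: (@maximiser_gap _ _ xi0 C w t (ln t) a r c K eta theta beta n J l).
Qed.

End atypical.

Lemma typical_environment (delta : R) : 0 < delta ->
  exists c K eta : R, [/\ 0 < c, c <= 1, 1 <= K, 0 < eta & eta <= c / 2] /\
  exists L0 : R, forall t : R, 0 < t -> L0 <= ln t -> exists A : set Om,
    [/\ measurable A, (P A < delta%:E)%E & forall w, ~ A w -> typical c K eta t w].
Proof.
move=> d0.
pose c := Num.min (1 / 2) (delta / 48).
have c0 : 0 < c by rewrite lt_min !divr_gt0.
have c1 : c <= 1 / 2 by rewrite ge_min lexx.
have c8 : 8 * c <= delta / 6.
  have : c <= delta / 48 by rewrite ge_min lexx orbT.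
  by lra.
clearbody c.
pose T := theta `^ (- alpha); have T0 : 0 < T by rewrite powR_gt0.
pose K := 1 + 96 * T / delta.
have K1 : 1 <= K by rewrite lerDl; apply: ltW; rewrite divr_gt0// mulr_gt0.
have K0 : 0 < K by exact: lt_le_trans K1.
have TK : 16 * T / K <= delta / 6.
  rewrite ler_pdivrMr// /K mulrDr.
  have -> : delta / 6 * (96 * T / delta) = 16 * T by field; rewrite gt_eqF.
  by move: d0; lra.
clearbody K.
pose G := 36 * alpha / c * (c / 4) `^ (- alpha).
have G0 : 0 < G by rewrite mulr_gt0 ?powR_gt0 ?divr_gt0 ?mulr_gt0.
pose D := 54 * K ^+ 2 * G ^+ 2 * (2 * theta * K + 1).
have tK : 0 < theta * K by exact: mulr_gt0.
have D0 : 0 < D.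
  apply: mulr_gt0; last by move: tK; lra.
  by apply: mulr_gt0; [apply: mulr_gt0 => //|]; exact: exprn_gt0.
(* [c / 20] keeps the cell intervals above [c / 4 * a], [delta / D] makes near-ties unlikely, and 1
   bounds the rounding error in [J * eta]. *)
pose eta := Num.min 1 (Num.min (c / 20) (delta / D)).
have eta0 : 0 < eta by rewrite !lt_min ltr01 !divr_gt0.
have eta1 : eta <= 1 by rewrite ge_min lexx.
have eta_c : 20 * eta <= c.
  have : eta <= c / 20 by rewrite !ge_min lexx !orbT.
  by lra.
have etaD : D * eta <= delta.
  by rewrite mulrC -ler_pdivlMr// !ge_min lexx !orbT.
clearbody eta.
exists c, K, eta; split; first by split => //; move: c0 c1 eta_c eta0; lra.
have [r1 r1P] := asym_prob_small c0 K1 d0.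
pose Q := (c / 2) `^ (- alpha).
have Q0 : 0 < Q by rewrite powR_gt0// divr_gt0.
have [L0 L0P] := thresholds [:: 1; 8 * K / c; - (2 * ln c) / beta; (4 / c) / beta;
  (theta * K)^-1 / beta; 2 / beta; r1 / beta; (6 * Q / delta) / beta].
exists L0 => t t0 /L0P /= /andP[L1 /andP[LK /andP[Lc /andP[a1]]]].
move=> /andP[a2 /andP[a3 /andP[a4 /andP[a5 _]]]].
have ba : beta * ln t <= height alpha t by exact: height_ge.
have ar : height alpha t <= reach_scale alpha t by exact: height_reach_scale.
have toa x : x / beta <= ln t -> x <= height alpha t.
  by rewrite ler_pdivrMr// mulrC => h; exact: le_trans ba.
move: a1 a2 a3 a4 a5 => /toa a1 /toa a2 /toa a3 /toa a4 /toa a5.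
have a0 := height_gt0 alpha t; have r0 := reach_scale_gt0 alpha t0 L1.
have LK' : 8 * K <= c * ln t by rewrite [leRHS]mulrC -ler_pdivrMr.
have caL : beta / 2 * ln t <= ln (c * height alpha t).
  rewrite lnM ?posrE//; have := ln_height_ge alpha2 L1.
  by move: Lc; rewrite ler_pdivrMr// -/beta; lra.
have ca4 : 1 <= c / 4 * height alpha t.
  by move: a1; rewrite ler_pdivrMr//; lra.
have ca : 1 <= 2 * c * height alpha t by move: (mulr_gt0 c0 a0) ca4; lra.
have ca2 : 1 <= c / 2 * height alpha t by move: (mulr_gt0 c0 a0) ca4; lra.
have cr : 2 <= c * reach_scale alpha t.
  have := ler_wpM2l (ltW c0) ar; move: ca4; lra.
have tKa : 1 <= theta * K * height alpha t.
  by move: a2; rewrite -[_^-1]div1r ler_pdivrMr// mulrC.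
have r2 : 2 <= reach_scale alpha t by exact: le_trans ar.
have Kr : 1 <= K * reach_scale alpha t.
  by have := ler_wpM2r (ltW r0) K1; move: r2; lra.
have [l [la lP]] := cell_bounds c0 K0 eta0 eta_c t0 L1 LK'.
(* Enough windows of step [eta * a] to reach the height [2 * theta * K * a], yet with [J * eta]
   bounded independently of [eta]. *)
pose J := (Num.truncn (2 * theta * K / eta)).+1.
have J0 : 0 <= 2 * theta * K / eta.
  by rewrite divr_ge0 ?(ltW eta0)// -mulrA mulr_ge0// ltW.
have /andP[J1 J2] := truncn_itv J0; rewrite -/J in J2.
have JP : 2 * theta * K <= J%:R * eta by rewrite -ler_pdivrMr// ltW.
have JE : J%:R * eta <= 2 * theta * K + 1.
  have -> : J%:R = (Num.truncn (2 * theta * K / eta))%:R + 1 :> R by rewrite natr1.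
  by rewrite [leLHS]mulrDl [1 * eta]mul1r; apply: lerD => //; rewrite -ler_pdivlMr.
exists (atypical_event c K eta t J l); split.
- exact: measurable_atypical.
(* Low values have probability 0 and each of the other five events at most [delta / 6], which leaves
   the strict inequality. *)
- apply: (@le_lt_trans _ _ (0 + (delta / 6 + (delta / 6 + (delta / 6 +
    (delta / 6 + delta / 6)))))%:E); last by rewrite lte_fin; move: d0; lra.
  have ml := measurable_low ind; have mf := measurable_flat alpha t ind c.
  have ma N x := measurable_asym ind N x.
  have mh := measurable_high alpha t ind theta K.
  have mt N h := measurable_tie ind N J l h.
  have mz := measurable_xi0_gt ind 0 (c / 2 * height alpha t).
  apply: measureU_le => //; [do !apply: measurableU => // |exact: low_prob ind pareto|].
  apply: measureU_le => //; [do !apply: measurableU => // | |].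
    apply: le_trans (flat_prob alpha2 ind pareto t0 L1 c0 c1 ca cr) _.
    by rewrite lee_fin.
  apply: measureU_le => //; [do !apply: measurableU => // | |].
    by apply: r1P => //; exact: le_trans ar.
  apply: measureU_le => //; [do !apply: measurableU => // | |].
    apply: le_trans (high_prob alpha2 ind pareto t0 L1 theta0 K1 tKa r2) _.
    by rewrite lee_fin.
  apply: measureU_le => //.
    exact: (tie_prob_small c0 K1 eta0 t0 L1 Kr ca4 la JE etaD).
  rewrite pareto// lee_fin powRM_height ?divr_ge0 ?(ltW c0)// -/Q ler_pdivrMr//.
  have : 6 * Q / delta <= reach_scale alpha t by exact: le_trans ar.
  by rewrite ler_pdivrMr//; lra.
- by move=> w; apply: typical_not_atypical.
Qed.

End environment.

Theorem theorem1p1 (R : realType) (alpha : R) (p : nat -> R)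
  (d : measure_display) (Omega : measurableType d) (P : probability Omega R)
  (xi0 : int -> Omega -> R) (C : nat -> Omega -> R)
  (d' : measure_display) (Omega' : measurableType d') (P' : probability Omega' R)
  (tau eps : nat -> Omega' -> R)
  (Z : R -> Omega -> nat) :
  2 <= alpha ->
  (* p : N -> [0,1], eventually nondecreasing, p(n) -> 1 *)
  (forall n, 0 <= p n <= 1) ->
  (exists N, forall m n, (N <= m)%N -> (m <= n)%N -> p m <= p n) ->
  p n @[n --> \oo] --> (1 : R) ->
  (* xi_0 i.i.d. Pareto(alpha); coins independent with P(coin for -n = 1) = p(n) *)
  mutually_independent P (pot_family xi0 C) ->
  (forall z x, 1 <= x -> P [set w | x < xi0 z w] = (x `^ (- alpha))%:E) ->
  (forall n, P [set w | C n w = 1] = (p n.+1)%:E) ->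
  (forall n, P [set w | C n w = 0] = (1 - p n.+1)%:E) ->
  (* the random walk: i.i.d. Exp(2) holding times, i.i.d. uniform +-1 steps *)
  mutually_independent P'
    (fun i : nat + nat => match i with inl k => tau k | inr k => eps k end) ->
  (forall k x, 0 <= x -> P' [set w | x < tau k w] = (expR (- (2 * x)))%:E) ->
  (forall k, P' [set w | eps k w = 1] = (1 / 2)%:E) ->
  (forall k, P' [set w | eps k w = -1] = (1 / 2)%:E) ->
  (* Z t is a maximiser of Psi_t over D whenever one exists *)
  (forall t w, 0 < t ->
     (exists z, is_maximiser_D (potential xi0 C w) t z) ->
     is_maximiser_D (potential xi0 C w) t (Z t w)) ->
  (* convergence in (outer) probability of the ratio to 1 *)
  forall e delta : R, 0 < e -> 0 < delta ->
  exists t0 : R, forall t, t0 <= t ->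
    exists A : set Omega, measurable A /\ (P A < delta%:E)%E /\
      [set w | e < `| (fine (uFK P' tau eps (potential xi0 C w) t (Z t w)%:Z)
                      + fine (uFK P' tau eps (potential xi0 C w) t (- (Z t w)%:Z)))
                     / fine (UFK P' tau eps (potential xi0 C w) t) - 1 | ] `<=` A.
Proof.
move=> alpha2 p01 _ pcvg ind pareto coin1 _ ind' tauP epsP _ ZP e delta e0 d0.
have [c [K [eta [[c0 c1 K1 eta0 etac] [L1 L1P]]]]] :=
  typical_environment alpha2 p01 pcvg ind pareto coin1 d0.
have b0 := rate_gt0 alpha2; have b1 := rate_le1 alpha2.
have e2 : 0 < e / 2 by rewrite divr_gt0.
have [L2 L20 L2P] := localisation ind' tauP epsP b0 b1 c0 c1 K1 eta0 etac e2.
have [L0 L0P] := thresholds [:: 1; L1; L2].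
(* All conditions on [t] are lower bounds on [ln t]. *)
exists (expR L0) => t tL.
have t0 : 0 < t by exact: lt_le_trans (expR_gt0 _) tL.
have /L0P /= /andP[l1 /andP[L1t /andP[L2t _]]] : L0 <= ln t.
  by rewrite -[L0]expRK ler_ln// posrE expR_gt0.
have [A [mA PA AP]] := L1P t t0 L1t.
(* [A] is the exceptional event of the potential, chosen without reference to [Z] or to the ratio,
   so no measurability of either in [w] is involved. *)
exists A; split => //; split => // w /= ew; apply: contrapT => /AP.
move=> [[xi1 xiT] zex zP].
have [n0 nK sym psi_ge gap] := zP _ (ZP t w t0 zex).
have := L2P (potential xi0 C w) t (height alpha t) (reach_scale alpha t) (Z t w) t0 L2t
  (height_gt0 _ _) (ln_height_ge alpha2 l1) (ln_height_le alpha2 l1)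
  (reach_scale_ln _ l1) xi1 n0 nK xiT sym psi_ge gap.
have -> : 2 * (e / 2) = e by field.
by move=> /(lt_le_trans ew); rewrite ltxx.
Qed.
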